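(* Let $\mathsf{E}^c=\varphi(\mathcal{E}^c)$ and $\mathsf{F}=\varphi(\mathcal{F})$ be the dendriform images of the series $\mathcal{E}^c$ of closed connected flows on rooted trees and of the series $\mathcal{F}$ defined by $\mathcal{E}^c=\bullet+b\,\bullet\curvearrowleft\mathcal{F}$. Then $$\mathsf{E}^c=Y+b\;1\vee\mathbf{N}\mathbf{T}\mathbf{P}-b\;\mathbf{N}\mathbf{T}\mathbf{P}\vee1,\qquad \mathsf{F}=-\mathbf{N}\mathbf{T}\mathbf{P},$$ where the noncommutative series $\mathbf{N}\mathbf{T}\mathbf{P}$ is interpreted as a series of planar binary trees through the full canopy. Moreover $\mathsf{F}$ belongs to the descent algebra, i.e. each homogeneous component of $\mathsf{F}$ lies in the subalgebra $\mathbf{Sym}$ of $\mathrm{Dend}$.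
   Context: All series have coefficients in $\mathbb{Q}[b]$. **Flows.** A rooted tree $T$ is a finite tree with a distinguished vertex (the root), edges oriented towards the root; $w\to v$ means that $w$ is a child of $v$. A flow on $T$ of size $k$ is a set $O$ of $k$ vertices (outputs) and a function $m:V(T)\to\mathbb{N}$ vanishing on $O$ such that the rates determined by $r(v)=m(v)-[v\in O]+\sum_{w\to v}r(w)$ are all $\ge 0$. It is closed if $r(\mathrm{root})=0$, and connected if $r(v)\ge1$ for every non-root vertex $v$. Let $\mathcal{E}^c_T=\sum b^{\text{size}}$ over closed connected flows on $T$, and $\mathcal{E}^c=\sum_T\mathcal{E}^c_T\,T/\mathrm{aut}(T)$, sum over isomorphism classes of rooted trees, $\mathrm{aut}(T)$ being the number of automorphisms. A tree with at least two vertices carrying a closed connected flow has a root with exactly one child, and such a flow has an output at the root; hence there is a unique series $\mathcal{F}$ of rooted trees with $\mathcal{E}^c=\bullet+b\,\bullet\curvearrowleft\mathcal{F}$ (explicitly $\mathcal{F}=\sum_T\mathcal{F}_T\,T/\mathrm{aut}(T)$, $\mathcal{F}_T=\sum b^{\text{size}}$ over connected flows on $T$ with $r(\mathrm{root})=1$). Let $\mathbf{ca}_n=\sum b^{\text{size}}$ over closed flows on the linear rooted tree (chain) with $n$ vertices. **Pre-Lie and dendriform algebras.** The free pre-Lie algebra on one generator $\bullet$ (the one-vertex tree) has basis the rooted trees, with $S\curvearrowleft T$ the sum over vertices $v$ of $S$ of the tree obtained by grafting the root of $T$ on $v$. A planar binary tree is either the trivial tree $1=|$ or $x\vee y$, obtained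 by gluing planar binary trees $x$ (left) and $y$ (right) on a new root vertex. The free dendriform algebra $\mathrm{Dend}$ on one generator has basis the planar binary trees with $n\ge1$ inner vertices (degree $n$), generator $Y=1\vee1$, and products $\prec,\succ$, $x*y=x\prec y+x\succ y$, determined bilinearly by $(x\vee y)\prec z=x\vee(y*z)$, $z\succ(x\vee y)=(z*x)\vee y$, $1$ being a unit for $*$. The operation $\vee$ is extended bilinearly to series. $\varphi$ is the unique morphism of pre-Lie algebras with $\varphi(\bullet)=Y$, for the pre-Lie product $x\curvearrowleft y:=y\succ x-x\prec y$ on $\mathrm{Dend}$, extended to formal series. **Canopy, word series and $\mathbf{Sym}$.** The canopy of a planar binary tree with $n$ inner vertices is the word of length $n-1$ in letters $\mathtt{p},\mathtt{m}$ (written $+,-$ in the paper) with one letter for each leaf except the leftmost and the rightmost, from left to right: $\mathtt{m}$ if the leaf is a left child, $\mathtt{p}$ if it is a right child. The full canopy is $\mathtt{m}\cdot\text{canopy}\cdot\mathtt{p}$. A noncommutative series all of whose words start with $\mathtt{m}$ and end with $\mathtt{p}$ is interpreted as the series of planar binary trees in which the coefficient of a tree is the coefficient of its full canopy. The algebra $\mathbf{Sym}$ of noncommutative symmetric functions is embedded in $\mathrm{Dend}$ (with $1$ adjoined) by sending the ribbon Schur function indexed by a word $\epsilon$ to the sum of all planar binary trees with canopy $\epsilon$. Let $\mathbf{P}=\sum_{k\ge1}\mathbf{ca}_k\mathtt{p}^k$, $\mathbf{N}=\sum_{k\ge1}(-1)^k\mathbf{ca}_k\mathtt{m}^k$, $\mathbf{T}=\sum_{k\ge0}b^k(\mathbf{P}\mathbf{N})^k$.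 *)

(* Defs.v *)
From HB Require Import structures.
From mathcomp Require Import all_boot all_order all_algebra generic_quotient.
From mathcomp Require Import finmap.
From mathcomp Require Import mathcomp_extra boolp classical_sets functions.
From mathcomp Require Import cardinality fsbigop.
From mathcomp Require Import monalg.

Set Implicit Arguments.
Unset Strict Implicit.
Unset Printing Implicit Defensive.

Import Order.TTheory GRing.Theory Num.Theory.
Local Open Scope ring_scope.
Local Open Scope quotient_scope.
Local Open Scope classical_set_scope.

(* The indeterminate b is 'X.  A sum  \sum_(i \in A) F i  over
   a classical set A is a finite-support sum (fsbigop.v). *)
Notation Qb := {poly rat}.

(* A formal series over a basis X is its family of coefficients; equality of
   series is extensional thanks to functional extensionality. *)
Definition fseries (X : Type) : Type := X -> Qb.

Section Bilinear.
Variables (X1 X2 X3 : choiceType).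
Implicit Types (u : {malg Qb[X1]}) (v : {malg Qb[X2]}).

Definition bilin (op : X1 -> X2 -> {malg Qb[X3]}) u v : {malg Qb[X3]} :=
  \sum_(x <- msupp u) \sum_(y <- msupp v) (u@_x * v@_y) *: op x y.

(* Only meaningful when each z occurs in finitely many op x y, as for a graded
   operation on bases that are finite in each degree. *)
Definition bilin_series (op : X1 -> X2 -> {malg Qb[X3]})
    (f : fseries X1) (g : fseries X2) : fseries X3 :=
  fun z => \sum_(xy \in [set: X1 * X2])
             f xy.1 * g xy.2 * (op xy.1 xy.2)@_z.

Definition lin_series (phi : {malg Qb[X1]} -> {malg Qb[X2]}) (f : fseries X1) :
    fseries X2 :=
  fun z => \sum_(x \in [set: X1]) f x * (phi << x >>)@_z.

End Bilinear.

Definition single (X : eqType) (x : X) (c : Qb) : fseries X :=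
  fun y => if y == x then c else 0.

(* Planar representatives: the order of the children is forgotten below, when
   trees are taken up to isomorphism. *)
Inductive ptree := PNode of seq ptree.

Fixpoint ptree_enc (t : ptree) : GenTree.tree unit :=
  let: PNode s := t in GenTree.Node 0 (map ptree_enc s).

Fixpoint ptree_dec (t : GenTree.tree unit) : ptree :=
  match t with
  | GenTree.Leaf _ => PNode [::]
  | GenTree.Node _ s => PNode (map ptree_dec s)
  end.

Lemma ptree_encK : cancel ptree_enc ptree_dec.
Proof.
rewrite /cancel; fix IH 1 => -[s] /=; congr PNode; rewrite -map_comp.
by elim: s => //= t s ->; rewrite IH.
Qed.

HB.instance Definition _ := Countable.copy ptree (can_type ptree_encK).

(* A vertex is the path leading to it from the root: i :: p stands for the
   vertex p of the i-th subtree of the root. *)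
Fixpoint vertices (t : ptree) : seq (seq nat) :=
  let: PNode s := t in
  let vs := map vertices s in
  [::] :: flatten [seq map (cons i) (nth [::] vs i) | i <- iota 0 (size vs)].

Definition vertex (t : ptree) := seq_sub (vertices t).
HB.instance Definition _ t := Finite.on (vertex t).

Lemma root_in (t : ptree) : [::] \in vertices t.
Proof. by case: t => s; rewrite inE eqxx. Qed.

Definition rootv (t : ptree) : vertex t := SeqSub (root_in t).

Definition child (t : ptree) (w v : vertex t) : bool :=
  ssval w == rcons (ssval v) (last 0%N (ssval w)).

Fixpoint graft (v : seq nat) (s t : ptree) : ptree :=
  let: PNode l := s in
  match v with
  | [::] => PNode (rcons l t)
  | i :: v' => PNode (set_nth s l i (graft v' (nth s l i) t))
  end.

Definition is_iso (s t : ptree) (f : {ffun vertex s -> vertex t}) : bool :=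
  [&& injectiveb f, [forall y, y \in codom f], f (rootv s) == rootv t &
      [forall w, forall v, child (f w) (f v) == child w v]].

Definition iso (s t : ptree) : bool :=
  [exists f : {ffun vertex s -> vertex t}, is_iso f].

Definition aut (t : ptree) : nat :=
  #|[set f : {ffun vertex t -> vertex t} | is_iso f]%SET|.

Lemma iso_refl : reflexive iso.
Proof.
move=> t; apply/existsP; exists [ffun x => x]; apply/and4P; split.
- by apply/injectiveP => x y; rewrite !ffunE.
- by apply/forallP => y; apply/codomP; exists y; rewrite ffunE.
- by rewrite ffunE.
- by apply/forallP => w; apply/forallP => v; rewrite !ffunE.
Qed.

Lemma iso_sym : symmetric iso.
Proof.
suff h s t : iso s t -> iso t s by move=> s t; apply/idP/idP => /h.
case/existsP=> f /and4P[/injectiveP fi /forallP fs /eqP fr /forallP fc].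
pose g := [ffun y => iinv (fs y)].
have gK : cancel g f by move=> y; rewrite ffunE f_iinv.
have fK : cancel f g by move=> x; apply: fi; rewrite gK.
apply/existsP; exists g; apply/and4P; split.
- by apply/injectiveP; exact: can_inj gK.
- by apply/forallP => x; apply/codomP; exists (f x); rewrite fK.
- by rewrite -fr fK.
- apply/forallP => w; apply/forallP => v.
  by have /forallP/(_ (g v))/eqP := fc (g w); rewrite !gK => ->.
Qed.

Lemma iso_trans : transitive iso.
Proof.
move=> t s u.
case/existsP=> f /and4P[/injectiveP fi /forallP fs /eqP fr /forallP fc].
case/existsP=> g /and4P[/injectiveP gi /forallP gs /eqP gr /forallP gc].
apply/existsP; exists [ffun x => g (f x)]; apply/and4P; split.
- by apply/injectiveP => x y; rewrite !ffunE => /gi/fi.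
- apply/forallP => z; have /codomP[y ->] := gs z; have /codomP[x ->] := fs y.
  by apply/codomP; exists x; rewrite ffunE.
- by rewrite ffunE fr gr.
- apply/forallP => w; apply/forallP => v; rewrite !ffunE.
  have /forallP/(_ (f v))/eqP -> := gc (f w).
  by have /forallP/(_ v) := fc w.
Qed.

Canonical iso_equiv := EquivRel iso iso_refl iso_sym iso_trans.

Definition rtree := {eq_quot iso_equiv}.
HB.instance Definition _ := Choice.on rtree.

Definition rtree_of (t : ptree) : rtree := \pi_rtree t.

Definition bullet : rtree := rtree_of (PNode [::]).

Notation PreLie := {malg Qb[rtree]}.

Definition graft_rtree (S T : rtree) : PreLie :=
  \sum_(v : vertex (repr S)) << rtree_of (graft (ssval v) (repr S) (repr T)) >>.

Definition prelie : PreLie -> PreLie -> PreLie := bilin graft_rtree.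
Definition prelie_series : fseries rtree -> fseries rtree -> fseries rtree :=
  bilin_series graft_rtree.

Section Flows.
Variable t : ptree.

(* the set O of outputs, and the function m *)
Definition flow_data := ({set vertex t} * {ffun vertex t -> nat})%type.

(* The tree being finite, these equations determine r. *)
Definition has_rates (f : flow_data) (r : vertex t -> int) : Prop :=
  forall v, r v = (f.2 v)%:Z - (v \in f.1)%:Z + \sum_(w | child w v) r w.

Definition flows (Q : (vertex t -> int) -> Prop) : set flow_data :=
  [set f : flow_data | (forall v, v \in f.1 -> f.2 v = 0%N) /\
           exists r, [/\ has_rates f r, forall v, 0 <= r v & Q r]].

Definition closed_rates (r : vertex t -> int) : Prop := r (rootv t) = 0.
Definition connected_rates (r : vertex t -> int) : Prop :=
  forall v, v != rootv t -> 1 <= r v.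

Definition closed_flows : set flow_data := flows closed_rates.
Definition closed_connected_flows : set flow_data :=
  flows (fun r => closed_rates r /\ connected_rates r).

Definition size_gf (A : set flow_data) : Qb := \sum_(f \in A) ('X^#|f.1| : Qb).

End Flows.

Arguments closed_flows : clear implicits.
Arguments closed_connected_flows : clear implicits.

Definition Ec : fseries rtree :=
  fun T => ((aut (repr T))%:R^-1 : rat) *:
             size_gf (closed_connected_flows (repr T)).

(* the chain with n.+1 vertices *)
Definition chain (n : nat) : ptree := iter n (fun t => PNode [:: t]) (PNode [::]).

(* used for n >= 1 only *)
Definition ca (n : nat) : Qb := size_gf (closed_flows (chain n.-1)).

Inductive pbt := Leaf | Vee of pbt & pbt.

Fixpoint pbt_enc (x : pbt) : GenTree.tree unit :=
  match x with
  | Leaf => GenTree.Leaf tt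
  | Vee x1 x2 => GenTree.Node 0 [:: pbt_enc x1; pbt_enc x2]
  end.

Fixpoint pbt_dec (t : GenTree.tree unit) : pbt :=
  match t with
  | GenTree.Node _ [:: t1; t2] => Vee (pbt_dec t1) (pbt_dec t2)
  | _ => Leaf
  end.

Lemma pbt_encK : cancel pbt_enc pbt_dec.
Proof. by elim=> //= x1 -> x2 ->. Qed.

HB.instance Definition _ := Countable.copy pbt (can_type pbt_encK).

Fixpoint inner (x : pbt) : nat :=
  if x is Vee x1 x2 then (inner x1 + inner x2).+1 else 0%N.

Definition Ytree : pbt := Vee Leaf Leaf.

(* Dend with the unit 1 = << Leaf >> adjoined *)
Notation Dend1 := {malg Qb[pbt]}.

Definition vee : Dend1 -> Dend1 -> Dend1 := bilin (fun x y => << Vee x y >>).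

Definition vee_series (f g : fseries pbt) : fseries pbt :=
  fun z => if z is Vee x y then f x * g y else 0.

(* (x1 v x2) * (y1 v y2) = x1 v (x2 * (y1 v y2)) + ((x1 v x2) * y1) v y2 *)
Fixpoint star_tree (x : pbt) : pbt -> Dend1 :=
  fix star_x (y : pbt) : Dend1 :=
    match x, y with
    | Leaf, _ => << y >>
    | _, Leaf => << x >>
    | Vee x1 x2, Vee y1 y2 =>
        vee << x1 >> (star_tree x2 y) + vee (star_x y1) << y2 >>
    end.

(* The value 0 for x = 1 is a convention: it does not affect Dend. *)
Definition prec_tree (x z : pbt) : Dend1 :=
  if x is Vee x1 x2 then vee << x1 >> (star_tree x2 z) else 0.
Definition succ_tree (z x : pbt) : Dend1 :=
  if x is Vee x1 x2 then vee (star_tree z x1) << x2 >> else 0.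

Definition prec : Dend1 -> Dend1 -> Dend1 := bilin prec_tree.
Definition succ : Dend1 -> Dend1 -> Dend1 := bilin succ_tree.

Definition dend_prelie (x y : Dend1) : Dend1 := succ y x - prec x y.

(* A morphism with phi(bullet) = Y takes its values in the part of degree >= 1,
   that is, in Dend. *)
Definition prelie_morphism (phi : PreLie -> Dend1) : Prop :=
  forall x y, phi (prelie x y) = dend_prelie (phi x) (phi y).

Notation letter := bool.
Notation word := (seq letter).
Definition lp : letter := true.
Definition lm : letter := false.

Definition wmul (f g : fseries word) : fseries word :=
  fun w => \sum_(i < (size w).+1) f (take i w) * g (drop i w).

Definition wpow (f : fseries word) (n : nat) : fseries word :=
  iter n (wmul f) (single [::] 1).

(* for families u such that each word occurs in finitely many u k *)
Definition wsum (A : set nat) (u : nat -> fseries word) : fseries word :=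
  fun w => \sum_(k \in A) u k w.

Definition Pser : fseries word :=
  wsum [set k | (0 < k)%N] (fun k => single (nseq k lp) (ca k)).
Definition Nser : fseries word :=
  wsum [set k | (0 < k)%N] (fun k => single (nseq k lm) ((-1) ^+ k * ca k)).
Definition Tser : fseries word :=
  wsum [set: nat] (fun k => 'X^k \*o wpow (wmul Pser Nser) k).
Definition NTP : fseries word := wmul (wmul Nser Tser) Pser.

(* The sequence of the leaves of x, each labelled by its side; d is the side
   of x itself. *)
Fixpoint leaves (d : letter) (x : pbt) : word :=
  if x is Vee x1 x2 then leaves lm x1 ++ leaves lp x2 else [:: d].

(* For x = Leaf this is a junk value. *)
Definition canopy (x : pbt) : word :=
  let l := leaves lm x in take (size l).-2 (behead l).

Definition full_canopy (x : pbt) : word := lm :: rcons (canopy x) lp.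

Definition tree_series (f : fseries word) : fseries pbt :=
  fun x => if x is Leaf then 0 else f (full_canopy x).

(* Sym as a vector space on the ribbon basis; None stands for the unit 1. *)
Notation NSym := {malg Qb[option word]}.

Definition ribbon_image (e : option word) : Dend1 :=
  if e is Some w then
    \sum_(x \in [set x : pbt | x != Leaf /\ canopy x = w])
      (<< x >> : Dend1)
  else << Leaf >>.

Definition Sym_embed (s : NSym) : Dend1 :=
  \sum_(e <- msupp s) s@_e *: ribbon_image e.

Definition hcomp (n : nat) (f : fseries pbt) : Dend1 :=
  \sum_(x \in [set x : pbt | inner x = n]) f x *: << x >>.

Definition in_descent_algebra (f : fseries pbt) : Prop :=
  forall n, range Sym_embed (hcomp n f).

(* Main.v *)
Require Import Defs.
From mathcomp Require Import all_boot all_order all_algebra generic_quotient.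
From mathcomp Require Import finmap.
From mathcomp Require Import boolp classical_sets fsbigop.
From mathcomp Require Import monalg.
From mathcomp Require Import ring zify.

Set Implicit Arguments.
Unset Strict Implicit.
Unset Printing Implicit Defensive.

Import GRing.Theory.
Local Open Scope ring_scope.

(** Why the theorem holds.

Let t mark the rate of a flow at the root, and s = t / (1 - t).  Adding a root
below branches of total contribution X multiplies X by 1/(1-t) (any input) or
by b/t (an output), without the pole at t = 0.  In terms of s this is
  G = (1 + s) (X + b (X - X(0)) / s),
so the flows on a tree are counted by polynomials in s, and every series below
has coefficients in R = Q[b][s].  A branch of a connected flow has a positive
rate: it contributes f = G - G(0), and X(T) is the product of the f(T_i) over
the branches T_i of T (flow_gf_theta, branches_gf_PNode, tree_gf_eq).  Then
E^c = G(0), and F is the coefficient of s in f, because t and s agree to first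
order.

The product X is not a pre-Lie product, and a pre-Lie morphism only sees binary
ones.  It becomes binary after differentiation: with N the number of vertices,
let g be the series determined by N f = g + f <- g, where <- is the pre-Lie
product.  Then also N X = X + X <- g, since a marked vertex other than the root
lies in a unique branch (pos_gf_leibniz, branches_gf_leibniz).  On coefficients
without the factor 1/aut, the pre-Lie product is a sum over the ways of cutting
one edge (cut_conv, phihat_cut_conv).  This rests on the identity graft_cuts for
the numbers of isomorphisms, proved by expanding permanents along a row and
along a column.

The image of these equations by phi is solved in Dend.  Let A be the series
with constant term 1 and N A = g * A.  A linear recursion on the degree has at
most one solution, and the axioms of dendriform algebras show that X < A and
A v 1 obey the same recursion, as do A and 1 + f < A (X_prec_A, A_fixpoint; here
< is the left dendriform product).  Applying < A to the relation between f and X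
eliminates both and leaves the equation tree_eq, in which F is the coefficient
of s in A.  It determines A, so a solution may be guessed and checked:
  A = 1 - N T (sum of s^k P^k over k >= 1),
read through full canopies.  Concatenation of words corresponds to v, and the
coproduct dual to * cuts a tree along the path of a leaf, hence the word of its
leaves at a letter (leaves_coproduct); so the check becomes an identity between
coefficients of words.  As NTP is multiplicative over the maximal blocks
m^i p^j up to a factor b, it reduces to a single block, where it is the equation
P = p (1 + P) (1 + b P) of the closed flows on chains (block_series_lm,
canopy_sol_tree_eq).  The coefficient of s gives F = - NTP, and
E^c = Y + b (F v 1 - 1 v F) gives the rest.  The image of F lies in Sym because
its coefficients depend on canopies only. *)

(** * Dendriform operations on functions on planar binary trees *)

(** The variable 'X of R is s = t / (1 - t), where t marks the rate at the root;
    the indeterminate of the statement becomes the constant b. *)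
Notation R := {poly Qb}.
Definition b : R := ('X : Qb)%:P.

(** Dual of the product *: the coefficient of z in x * y is the number of occurrences
of (x, y) in this list.  Working with functions on trees and this finite list
replaces the infinite sums of products of series. *)
Fixpoint coproduct (z : pbt) : seq (pbt * pbt) :=
  if z is Vee z1 z2 then
    [seq (x.1, Vee x.2 z2) | x <- coproduct z1]
      ++ [seq (Vee z1 x.1, x.2) | x <- coproduct z2]
  else [:: (Leaf, Leaf)].

Definition star_fun (f g : pbt -> R) (z : pbt) : R :=
  \sum_(x <- coproduct z) f x.1 * g x.2.
Definition prec_fun (f g : pbt -> R) (z : pbt) : R :=
  if z is Vee z1 z2 then star_fun (fun x => f (Vee z1 x)) g z2 else 0.
Definition succ_fun (g f : pbt -> R) (z : pbt) : R :=
  if z is Vee z1 z2 then star_fun g (fun x => f (Vee x z2)) z1 else 0.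
Definition prelie_fun (f g : pbt -> R) (z : pbt) : R := succ_fun g f z - prec_fun f g z.

Lemma star_vee f g z1 z2 :
  star_fun f g (Vee z1 z2) = succ_fun f g (Vee z1 z2) + prec_fun f g (Vee z1 z2).
Proof. by rewrite /star_fun /= big_cat !big_map. Qed.

Lemma star_leaf f g : star_fun f g Leaf = f Leaf * g Leaf.
Proof. by rewrite /star_fun big_seq1. Qed.

Lemma eq_star f f' g g' z :
  (forall x, x \in coproduct z -> f x.1 * g x.2 = f' x.1 * g' x.2) ->
    star_fun f g z = star_fun f' g' z.
Proof. by move=> h; rewrite /star_fun big_seq [RHS]big_seq; apply: eq_bigr. Qed.

Lemma star_sum_l (I : Type) (r : seq I) (F : I -> pbt -> R) g z :
  star_fun (fun x => \sum_(i <- r) F i x) g z = \sum_(i <- r) star_fun (F i) g z.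
Proof.
by rewrite /star_fun exchange_big /=; apply: eq_bigr => x _; rewrite mulr_suml.
Qed.

Lemma star_sum_r (I : Type) (r : seq I) f (G : I -> pbt -> R) z :
  star_fun f (fun x => \sum_(i <- r) G i x) z = \sum_(i <- r) star_fun f (G i) z.
Proof.
by rewrite /star_fun exchange_big /=; apply: eq_bigr => x _; rewrite mulr_sumr.
Qed.

Lemma starDl f f' g z :
  star_fun (fun x => f x + f' x) g z = star_fun f g z + star_fun f' g z.
Proof. by rewrite /star_fun -big_split; apply: eq_bigr => x _; rewrite /= mulrDl. Qed.

Lemma starDr f g g' z :
  star_fun f (fun x => g x + g' x) z = star_fun f g z + star_fun f g' z.
Proof. by rewrite /star_fun -big_split; apply: eq_bigr => x _; rewrite /= mulrDr. Qed.

Lemma starBl f f' g z :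
  star_fun (fun x => f x - f' x) g z = star_fun f g z - star_fun f' g z.
Proof. by rewrite /star_fun -sumrB; apply: eq_bigr => x _; rewrite /= mulrBl. Qed.

(** Coassociativity of the coproduct, read on functions. *)
Lemma starA f g h z : star_fun (star_fun f g) h z = star_fun f (star_fun g h) z.
Proof.
elim: z f g h => [|z1 IH1 z2 IH2] f g h; first by rewrite !star_leaf mulrA.
rewrite !star_vee /= /succ_fun /prec_fun.
have -> : star_fun (fun x => star_fun f g (Vee z1 x)) h z2
        = star_fun (fun x => star_fun f (fun y => g (Vee y x)) z1) h z2
          + star_fun (star_fun (fun x => f (Vee z1 x)) g) h z2.
  by rewrite -starDl; apply: eq_star => x _; rewrite star_vee.
have -> : star_fun f (fun x => star_fun g h (Vee x z2)) z1
        = star_fun f (star_fun g (fun x => h (Vee x z2))) z1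
          + star_fun f (fun x => star_fun (fun y => g (Vee x y)) h z2) z1.
  by rewrite -starDr; apply: eq_star => x _; rewrite star_vee.
rewrite -addrA IH1 IH2; congr (_ + (_ + _)).
rewrite /star_fun; under eq_bigr do rewrite mulr_suml.
rewrite exchange_big /=; apply: eq_bigr => x _; rewrite mulr_sumr.
by apply: eq_bigr => y _; rewrite mulrA.
Qed.

Lemma prec_prec f g h z : prec_fun (prec_fun f g) h z = prec_fun f (star_fun g h) z.
Proof. by case: z => //= z1 z2; rewrite -starA; apply: eq_star => x _. Qed.

(** Both sides cut the two subtrees of z independently. *)
Lemma succ_prec f g h z : prec_fun (succ_fun g f) h z = succ_fun g (prec_fun f h) z.
Proof.
case: z => //= z1 z2; rewrite /star_fun; under eq_bigr do rewrite mulr_suml.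
rewrite exchange_big /=; apply: eq_bigr => x _; rewrite mulr_sumr.
by apply: eq_bigr => y _; rewrite mulrA.
Qed.

Lemma inner_coproduct z x : x \in coproduct z -> (inner x.1 + inner x.2)%N = inner z.
Proof.
elim: z x => [|z1 IH1 z2 IH2] x /=; first by rewrite inE => /eqP ->.
rewrite mem_cat => /orP[] /mapP[[y1 y2] hy ->] /=.
  by have /= := IH1 _ hy; lia.
by have /= := IH2 _ hy; lia.
Qed.

Definition deg_der (f : pbt -> R) (z : pbt) : R := (inner z)%:R * f z.

Lemma deg_der_prec f g z :
  deg_der (prec_fun f g) z = prec_fun (deg_der f) g z + prec_fun f (deg_der g) z.
Proof.
case: z => [|z1 z2]; first by rewrite /deg_der mulr0 addr0.
rewrite /deg_der /= /star_fun mulr_sumr -big_split /= [LHS]big_seq [RHS]big_seq.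
apply: eq_bigr => x /inner_coproduct <-.
by rewrite -addSn addnA -addSn natrD; ring.
Qed.

Lemma natr_R_neq0 n : n.+1%:R != 0 :> R.
Proof. by rewrite -!polyC_natr !polyC_eq0 Num.Theory.pnatr_eq0. Qed.

Lemma succ_fun_small g Z z :
  (forall x, (inner x < inner z)%N -> Z x = 0) -> g Leaf = 0 -> succ_fun g Z z = 0.
Proof.
case: z => //= z1 z2 h hg;
  rewrite /star_fun big_seq big1 // => -[[|x1 x2] y] /inner_coproduct /= hxy.
  by rewrite hg mul0r.
by rewrite h ?mulr0 //=; lia.
Qed.

(** The equation expresses (n - c) Z in degree n by the values of Z in smaller
degrees, because g has no constant term. *)
Lemma degree_rec_eq0 g Z (c : nat) :
  g Leaf = 0 -> (forall z, (inner z <= c)%N -> Z z = 0) ->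
  (forall z, deg_der Z z = c%:R * Z z + succ_fun g Z z) -> forall z, Z z = 0.
Proof.
move=> hg Z0 hZ z; have [n] := ubnP (inner z); elim: n z => // n IH z hz.
have [/Z0//|hc] := leqP (inner z) c.
have h := hZ z; rewrite succ_fun_small // in h; last by move=> x hx; apply: IH; lia.
move: h; rewrite addr0 /deg_der => /eqP; rewrite -subr_eq0 -mulrBl -natrB 1?ltnW //.
case: (inner z - c)%N (subn_gt0 c (inner z)) => [|k _]; first by rewrite hc.
by rewrite mulf_eq0 (negPf (natr_R_neq0 k)) => /eqP.
Qed.

(** The equation says that g is the logarithmic derivative of A for the product *;
dividing by the degree solves it recursively. *)
Lemma logder_exists g : g Leaf = 0 ->
  exists A, A Leaf = 1 /\ forall z, deg_der A z = star_fun g A z.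
Proof.
move=> hg.
pose inv n : R := ((n%:R^-1 : rat)%:P)%:P.
have invP n : n.+1%:R * inv n.+1 = 1.
  by rewrite /inv -!polyC_natr -!polyCM divff // Num.Theory.pnatr_eq0.
(* The first argument is fuel; any bound on the degree gives the same value. *)
pose A := fix A k z : R := if k is k'.+1 then
  (if z is Leaf then 1 else inv (inner z) * star_fun g (A k') z) else (z == Leaf)%:R.
have stab k k' z : (inner z <= k)%N -> (inner z <= k')%N -> A k z = A k' z.
  have [n] := ubnP (inner z); elim: n z k k' => // n IH z k k' hn.
  case: z hn => [|z1 z2] hn; first by case: k k' => [|?] [|?].
  case: k k' => [|k] [|k'] // hk hk'; rewrite [LHS]/= [RHS]/=; congr (_ * _).
  apply: eq_star => -[x y] /inner_coproduct /= hxy.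
  case: x hxy => [|x1 x2] /= hxy; first by rewrite hg !mul0r.
  by congr (_ * _); apply: IH; move: hxy hn hk hk' => /=; lia.
exists (fun z => A (inner z) z); split=> // z.
case: z => [|z1 z2]; first by rewrite /deg_der mul0r star_leaf hg mul0r.
rewrite /deg_der [A _ _]/= mulrA invP mul1r.
apply: eq_star => -[x y] /inner_coproduct /= hxy.
case: x hxy => [|x1 x2] /= hxy; first by rewrite hg !mul0r.
by congr (_ * _); apply: stab; move: hxy => /=; lia.
Qed.

Definition is_leaf (z : pbt) : bool := if z is Leaf then true else false.

(** The series f v 1; the next definition is 1 v f. *)
Definition veeL (f : pbt -> R) (z : pbt) : R :=
  if z is Vee z1 z2 then f z1 * (is_leaf z2)%:R else 0.
Definition veeR (f : pbt -> R) (z : pbt) : R :=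
  if z is Vee z1 z2 then (is_leaf z1)%:R * f z2 else 0.

Definition deltaY (z : pbt) : R := (z == Ytree)%:R.

Lemma star_is_leaf f z : star_fun f (fun x => (is_leaf x)%:R) z = f z.
Proof.
elim: z f => [|z1 IH1 z2 IH2] f; first by rewrite star_leaf mulr1.
rewrite star_vee /= IH2 [X in X + _](_ : _ = 0) ?add0r //.
by rewrite /star_fun big1 // => x _; rewrite mulr0.
Qed.

Lemma star_leaf_is f z : star_fun (fun x => (is_leaf x)%:R) f z = f z.
Proof.
elim: z f => [|z1 IH1 z2 IH2] f; first by rewrite star_leaf mul1r.
rewrite star_vee /= IH1 [X in _ + X](_ : _ = 0) ?addr0 //.
by rewrite /star_fun big1 // => x _; rewrite mul0r.
Qed.

Section Core.
Variables (f g X A : pbt -> R).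
Hypotheses (der_f : forall z, deg_der f z = g z + prelie_fun f g z).
Hypotheses (der_X : forall z, deg_der X z = X z + prelie_fun X g z).
Hypothesis (X1 : X Ytree = 1).
Hypotheses (A0 : A Leaf = 1) (der_A : forall z, deg_der A z = star_fun g A z).

Lemma logder_leaf : g Leaf = 0.
Proof. by have := der_f Leaf; rewrite /deg_der /prelie_fun mul0r subr0 addr0. Qed.

(** Both sides solve N Z = Z + g > Z, with > the right dendriform product, and agree
in degree 1.  On the left, the terms X < g of N X and g * A of N A cancel since
(X < g) < A = X < (g * A). *)
Lemma X_prec_A z : prec_fun X A z = veeL A z.
Proof.
apply/eqP; rewrite -subr_eq0; apply/eqP.
apply: (degree_rec_eq0 (g := g) (Z := fun z => prec_fun X A z - veeL A z) (c := 1)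
  logder_leaf).
  case=> [|[|x1 x2] [|y1 y2]] //= _; first by rewrite subr0.
  by rewrite star_leaf X1 A0 !mulr1 subrr.
move=> {}z; rewrite mul1r.
have -> : succ_fun g (fun z => prec_fun X A z - veeL A z) z =
          succ_fun g (prec_fun X A) z - succ_fun g (veeL A) z.
  by case: z => [|z1 z2]; rewrite ?subrr //= /star_fun -sumrB; apply: eq_bigr => x _;
    rewrite mulrBr.
have -> : deg_der (fun z => prec_fun X A z - veeL A z) z
  = deg_der (prec_fun X A) z - deg_der (veeL A) z.
  by rewrite /deg_der mulrBr.
have -> : deg_der (prec_fun X A) z = prec_fun X A z + succ_fun g (prec_fun X A) z.
  rewrite deg_der_prec -succ_prec.
  have -> : prec_fun (deg_der X) A z
    = prec_fun X A z + prec_fun (succ_fun g X) A z - prec_fun (prec_fun X g) A z.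
    case: z => [|z1 z2]; rewrite ?addr0 ?subr0 //= -starDl -starBl.
    by apply: eq_star => x _; rewrite der_X /prelie_fun /= addrA.
  have -> : prec_fun X (deg_der A) z = prec_fun (prec_fun X g) A z.
    by rewrite prec_prec; case: z => //= z1 z2; apply: eq_star => x _; rewrite der_A.
  by ring.
suff -> : deg_der (veeL A) z = veeL A z + succ_fun g (veeL A) z by ring.
case: z => [|z1 z2]; first by rewrite /deg_der mulr0 addr0.
case: z2 => [|? ?] /=; last first.
  by rewrite /deg_der /= /star_fun big1 ?mulr0 ?addr0 // => x _; rewrite /= !mulr0.
have := der_A z1; rewrite /deg_der /= addn0 !mulr1 -addn1 natrD mulrDl => ->.
by rewrite mul1r addrC; congr (_ + _); apply: eq_star => x _ /=; rewrite mulr1.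
Qed.

(** The difference Z of both sides satisfies N Z = g > Z: the terms of f <- g and
N A = g * A cancel as in the previous lemma. *)
Lemma A_fixpoint z : A z = (is_leaf z)%:R + prec_fun f A z.
Proof.
pose W z := (is_leaf z)%:R + prec_fun f A z.
apply/eqP; rewrite -[_ + _]/(W z) -subr_eq0; apply/eqP.
apply: (degree_rec_eq0 (g := g) (Z := fun z => A z - W z) (c := 0) logder_leaf).
  by case=> //= _; rewrite /W /= addr0 A0 subrr.
move=> {}z; rewrite mul0r add0r.
have -> : deg_der (fun z => A z - W z) z = star_fun g A z - deg_der (prec_fun f A) z.
  by rewrite -der_A /deg_der mulrBr /W; case: z => [|z1 z2] /=; rewrite ?mul0r ?add0r.
have -> : deg_der (prec_fun f A) z = prec_fun g A z + succ_fun g (prec_fun f A) z.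
  rewrite deg_der_prec -succ_prec.
  have -> : prec_fun (deg_der f) A z
    = prec_fun g A z + prec_fun (succ_fun g f) A z - prec_fun (prec_fun f g) A z.
    case: z => [|z1 z2]; rewrite ?addr0 ?subr0 //= -starDl -starBl.
    by apply: eq_star => x _; rewrite der_f /prelie_fun /= addrA.
  have -> : prec_fun f (deg_der A) z = prec_fun (prec_fun f g) A z.
    by rewrite prec_prec; case: z => //= z1 z2; apply: eq_star => x _; rewrite der_A.
  by ring.
case: z => [|z1 z2]; first by rewrite star_leaf logder_leaf mul0r /= addr0 subrr.
rewrite star_vee opprD addrA addrK /= /star_fun -sumrB; apply: eq_bigr => x _.
by rewrite /W /= add0r mulrBr.
Qed.

End Core.

(** * Closed flows on chains and series of words *)

(** The divided difference (p - p(0)) / s. *)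
Notation dv := (drop_poly 1).

Lemma dvE (K : nzRingType) (p : {poly K}) : p = (p`_0)%:P + 'X * dv p.
Proof.
apply/polyP => i; rewrite coefD coefC coefXM coef_drop_poly addn1.
by case: i => [|i] /=; rewrite ?addr0 ?add0r.
Qed.

Lemma XdvE (K : nzRingType) (p : {poly K}) : 'X * dv p = p - (p`_0)%:P.
Proof. by rewrite {2}[p]dvE addrC addKr. Qed.

(** chain_poly n generates the flows on the chain with n+1 vertices: the number of
flows of rate r at the root is the coefficient of t^r in
chain_poly n (t/(1-t)) / (1-t).  Its constant term counts the closed flows. *)
Fixpoint chain_poly (j : nat) : R :=
  if j is j'.+1 then ('X + 1 + b) * chain_poly j' + b * dv (chain_poly j') else 1.

Definition chain_const (j : nat) : Qb := (chain_poly j)`_0.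

(** With P the series of the closed flows on chains, this is (E - P) / s = P E for the
generating series E of the chain polynomials, that is E = P / (1 - s P). *)
Lemma dv_chain_poly j :
  dv (chain_poly j) = \sum_(i < j) (chain_const i)%:P * chain_poly (j.-1 - i).
Proof.
elim: j => [|j IH].
  rewrite big_ord0; apply/polyP => i; rewrite coef_drop_poly coef1 coef0.
  by rewrite addn1.
(* Multiplied by s, the identity no longer involves divided differences on the left. *)
have hX : 'X * dv (chain_poly j.+1) =
   'X * \sum_(i < j.+1) (chain_const i)%:P * chain_poly (j - i) :> R.
  rewrite XdvE big_ord_recr /= subnn.
  have -> : \sum_(i < j) (chain_const i)%:P * chain_poly (j - i) =
     ('X + 1 + b) * dv (chain_poly j) +
       b * \sum_(i < j) (chain_const i)%:P * dv (chain_poly (j.-1 - i)).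
    rewrite IH !mulr_sumr -big_split; apply: eq_bigr => i _ /=.
    have -> : (j - i = (j.-1 - i).+1)%N by have := ltn_ord i; lia.
    by rewrite /=; ring.
  have h : 'X * \sum_(i < j) (chain_const i)%:P * dv (chain_poly (j.-1 - i)) =
         dv (chain_poly j) - (((dv (chain_poly j))`_0)%:P) :> R.
    rewrite mulr_sumr.
    under eq_bigr => i _ do rewrite mulrCA XdvE mulrBr -[in X in _ - X]polyCM.
    rewrite sumrB -IH; congr (_ - _); rewrite -rmorph_sum; congr (_%:P).
    by rewrite IH coef_sum; apply: eq_bigr => i _; rewrite coefCM.
  rewrite !mulrDr [X in _ = _ + X + _]mulrCA h mulr1 /b.
  rewrite !coefD !coefCM !mulrDl !coefD !coefXM !coefCM mul1r /= -/(chain_const j) add0r.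
  have hj : chain_poly j = (chain_const j)%:P + 'X * dv (chain_poly j) by exact: dvE.
  rewrite !rmorphD !rmorphM /= {1 2 3}hj; ring.
have /eqP := hX; rewrite -subr_eq0 -mulrBr mulf_eq0 polyX_eq0 /= subr_eq0.
by move/eqP.
Qed.

(** The coefficients of P = p (1 + P) (1 + b P), obtained at s = 0. *)
Lemma chain_const_rec j : chain_const j.+1 =
  (1 + 'X) * chain_const j + 'X * \sum_(i < j) chain_const i * chain_const (j.-1 - i).
Proof.
rewrite /chain_const /= /b coefD coefCM !mulrDl !coefD coefXM coefCM mul1r add0r.
congr (_ + _ * _); rewrite ?mulrDl ?mul1r //.
  by rewrite coefCM.
by rewrite dv_chain_poly coef_sum; apply: eq_bigr => i _; rewrite coefCM.
Qed.

(** Coefficients of P and N, and the same numbers as constants of R.  The series with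
coefficients polD j is the sum of s^k P^k over k >= 1, that is s P / (1 - s P). *)
Definition Pcoef (j : nat) : Qb := if j is j'.+1 then chain_const j' else 0.
Definition Ncoef (i : nat) : Qb := (-1) ^+ i * Pcoef i.
Definition polP (j : nat) : R := (Pcoef j)%:P.
Definition polN (i : nat) : R := (Ncoef i)%:P.
Definition polD (j : nat) : R := if j is j'.+1 then 'X * chain_poly j' else 0.

Lemma polN0 : polN 0 = 0. Proof. by rewrite /polN /Ncoef mulr0. Qed.
Lemma polN1 : polN 1 = -1.
Proof. by rewrite /polN /Ncoef /= /chain_const /= coef1 expr1 mulr1 rmorphN rmorph1. Qed.
Lemma polP0 : polP 0 = 0. Proof. by rewrite /polP. Qed.
Lemma polP1 : polP 1 = 1. Proof. by rewrite /polP /= /chain_const coef1. Qed.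

Lemma Pcoef_rec i : (0 < i)%N ->
  Pcoef i.+1 = (1 + 'X) * Pcoef i + 'X * \sum_(k < i) Pcoef k * Pcoef (i - k).
Proof.
case: i => // i _; rewrite /= chain_const_rec big_ord_recl mul0r add0r.
congr (_ + _ * _); apply: eq_bigr => k _; rewrite /= /bump /= add1n.
by have -> : (i.+1 - k.+1 = (i.-1 - k).+1)%N by have := ltn_ord k; lia.
Qed.

Lemma polP_rec i : (0 < i)%N ->
  polP i.+1 = (1 + b) * polP i + b * \sum_(k < i) polP k * polP (i - k).
Proof.
move=> hi; rewrite /polP Pcoef_rec // rmorphD !rmorphM rmorphD rmorph1 /=.
by rewrite rmorph_sum; congr (_ + _ * _); apply: eq_bigr => k _; rewrite rmorphM.
Qed.

Lemma polN_rec i : (0 < i)%N ->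
  polN i.+1 = - ((1 + b) * polN i + b * \sum_(k < i) polN k * polN (i - k)).
Proof.
have NcE k : polN k = (-1) ^+ k * polP k by rewrite /polN /Ncoef rmorphM rmorphXn rmorphN
  rmorph1.
move=> hi; rewrite !NcE polP_rec // exprS mulN1r mulNr; congr (- _).
rewrite mulrDr [in RHS]mulrCA; congr (_ + _); rewrite mulrCA mulr_sumr; congr (_ * _).
apply: eq_bigr => k _; rewrite !NcE mulrACA -exprD subnKC //; exact: ltnW.
Qed.

(** Adding a vertex to a chain, with s = t/(1-t): the factor
(1 + s) (s + b) / s is 1/(1-t) + b/t. *)
Lemma polD_step j :
  'X * polD j.+2 = (1 + 'X) * ('X + b) * polD j.+1 - b * 'X * polP j.+1.
Proof.
have h := XdvE (chain_poly j); rewrite -/(chain_const j) in h.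
rewrite /polD /polP [Pcoef _]/= [chain_poly j.+1]/=.
have -> : 'X * ('X * (('X + 1 + b) * chain_poly j + b * dv (chain_poly j))) =
  'X * ('X * ('X + 1 + b) * chain_poly j + b * ('X * dv (chain_poly j))) by ring.
rewrite h; ring.
Qed.

(** The identity D = s P + s P D of generating series. *)
Lemma polD_conv j : 'X * \sum_(k < j) polP k.+1 * polD (j.-1 - k) = polD j - 'X * polP j.
Proof.
case: j => [|j]; first by rewrite big_ord0 polP0 !mulr0 subrr.
rewrite big_ord_recr /= subnn mulr0 addr0 /polP /= -mulrBr -XdvE dv_chain_poly;
  congr (_ * _).
rewrite mulr_sumr; apply: eq_bigr => k _.
have -> : (j - k = (j.-1 - k).+1)%N by have := ltn_ord k; lia.
by rewrite /= mulrCA.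
Qed.

(** State of a left-to-right reading of a word: i letters m, then j letters p, of the
current block have been read.  The block m^i p^j contributes N_i P_j and a factor
b to the next one, or N_i Q_j if it is the last block. *)
Fixpoint block_prod (Q : nat -> R) (i j : nat) (w : word) : R :=
  match w with
  | [::] => polN i * Q j
  | true :: w' => block_prod Q i j.+1 w'
  | false :: w' => if j is 0 then block_prod Q i.+1 0 w' else b * polN i * polP j *
    block_prod Q 1 0 w'
  end.

(** The coefficient of a word in N T Q, for Q a series in the powers of p. *)
Definition block_series Q w := block_prod Q 0 0 w.

Lemma block_prod_cat Q i j U V : last (0 < j)%N U = lp ->
  block_prod Q i j (U ++ lm :: V) = b * block_prod polP i j U * block_series Q (lm :: V).
Proof.
elim: U i j => [|[] U IH] i j /=.
- by case: j => // j _; rewrite /block_series /= !mulrA.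
- by move=> h; rewrite IH.
- case: j => [|j] h; first by rewrite IH.
  rewrite IH //; move: (polN i) (polP j.+1) (block_prod polP 1 0 U) (block_series _ _) =>
    *; ring.
Qed.

Lemma block_series_cat Q U V : last lm U = lp ->
  block_series Q (U ++ lm :: V) = b * block_series polP U * block_series Q (lm :: V).
Proof. by move=> h; apply: (@block_prod_cat Q 0 0 U V). Qed.

Lemma block_series_lp Q V : block_series Q (lp :: V) = 0.
Proof.
suff h j : block_prod Q 0 j.+1 V = 0 by exact: h.
elim: V j => [|[] V IH] j /=; first by rewrite polN0 mul0r.
  exact: IH.
by rewrite polN0 mulr0 !mul0r.
Qed.

Lemma block_prod_rcons i j U : last (0 < j)%N U = lp ->
  'X * block_prod polD i j (rcons U lp) =
  (1 + 'X) * ('X + b) * block_prod polD i j U - b * 'X * block_prod polP i j U.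
Proof.
elim: U i j => [|[] U IH] i j /=.
- by case: j => // j _; rewrite mulrCA polD_step; ring.
- by move=> h; rewrite IH.
- case: j => [|j] h; first by rewrite IH.
  rewrite mulrCA IH //;
    move: (polN i) (polP j.+1) (block_prod polD 1 0 U) (block_prod polP 1 0 U) => *; ring.
Qed.

(** The last block is the only one that changes. *)
Lemma block_series_rcons U : last lm U = lp ->
  'X * block_series polD (rcons U lp)
    = (1 + 'X) * ('X + b) * block_series polD U - b * 'X * block_series polP U.
Proof. exact: (@block_prod_rcons 0 0 U). Qed.

Lemma block_series_block Q i j : block_series Q (nseq i lm ++ nseq j lp) = polN i * Q j.
Proof.
have h i0 j0 : block_prod Q i0 j0 (nseq j lp) = polN i0 * Q (j0 + j)%N.
  by elim: j j0 => [|j IH] j0 /=; rewrite ?addn0 // IH addSnnS.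
have h2 i0 : block_prod Q i0 0 (nseq i lm ++ nseq j lp) = polN (i0 + i)%N * Q j.
  by elim: i i0 => [|i IH] i0 /=; rewrite ?h ?addn0 // IH addSnnS.
by rewrite /block_series h2.
Qed.

Fixpoint letter_removals (w : word) : seq (word * word) :=
  if w is x :: w' then ([::], w') :: [seq (x :: p.1, p.2) | p <- letter_removals w'] else
    [::].

Lemma letter_removals_cat u v : letter_removals (u ++ v) =
  [seq (p.1, p.2 ++ v) | p <- letter_removals u]
    ++ [seq (u ++ p.1, p.2) | p <- letter_removals v].
Proof.
elim: u => [|x u IH] /=; first by rewrite -[LHS]map_id; apply: eq_map => -[].
by rewrite IH map_cat -!map_comp.
Qed.

Lemma letter_removals_nseq n (a : letter) (G : word * word -> R) :
  \sum_(p <- letter_removals (nseq n a)) G p = \sum_(k < n) G (nseq k a, nseq (n.-1 - k) a).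
Proof.
elim: n G => [|n IH] G /=; first by rewrite big_nil big_ord0.
rewrite big_cons big_map IH big_ord_recl /= subn0; congr (_ + _).
apply: eq_bigr => k _ /=; rewrite /bump /= add1n.
by have -> : (n - k.+1 = n.-1 - k)%N by lia.
Qed.

(** The product * of two canopy series: cutting a tree at a leaf turns the letter of
this leaf into a final p on the left part and an initial m on the right part. *)
Definition letter_conv Q V :=
  \sum_(p <- letter_removals V) block_series polP (rcons p.1 lp) * block_series Q
    (lm :: p.2).

(** The four terms correspond to the removed letter: inside U, last of U, first of
m V, or after it. *)
Lemma letter_conv_cat (Q : nat -> R) U V (Q0 : Q 0%N = 0) : last lm U = lp ->
  letter_conv Q (U ++ lm :: V)
    = b * letter_conv polP U * block_series Q (lm :: V)
      + block_series polP U * block_series Q (lm :: lm :: V)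
   + block_series polP (rcons U lp) * block_series Q (lm :: V)
     + b * block_series polP U * letter_conv Q (lm :: V).
Proof.
case/lastP: U => // U x; rewrite last_rcons => ->.
have hm Q' : Q' 0%N = 0 -> block_series Q' [:: lm] = 0 by rewrite /block_series /= => ->;
  rewrite mulr0.
rewrite /letter_conv letter_removals_cat big_cat !big_map /= big_cons /= -cats1 cats0.
have -> : \sum_(j <- letter_removals (U ++ [:: lp]))
     block_series polP (rcons j.1 lp) * block_series Q (lm :: j.2 ++ lm :: V) =
   \sum_(j <- letter_removals U) block_series polP (rcons j.1 lp) *
     (b * block_series polP (lm :: rcons j.2 lp) * block_series Q (lm :: V)) +
     block_series polP (rcons U lp) * block_series Q (lm :: lm :: V).
  rewrite letter_removals_cat big_cat !big_map /= big_seq1 /= cats0; congr (_ + _).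
  apply: eq_bigr => j _; rewrite -[in LHS]cats1 -cat_cons -block_series_cat ?cats1 //=.
  by rewrite last_rcons.
rewrite letter_removals_cat big_cat !big_map /= big_seq1 /= cats0 ?big_map big_cons /=.
rewrite hm ?mulr0 ?addr0 ?polP0 // block_series_lp mul0r add0r cats1 -!addrA; congr (_ + _).
  rewrite mulr_sumr mulr_suml; apply: eq_bigr => j _; rewrite /= cats1; ring.
congr (_ + (_ + _)); rewrite big_map mulr_sumr; apply: eq_bigr => j _ /=.
rewrite rcons_cat rcons_cons block_series_cat ?last_rcons //.
by move: (block_series _ _) (block_series _ _) (block_series _ _) => *; ring.
Qed.

Lemma letter_conv_block Q i j :
  letter_conv Q (nseq i lm ++ nseq j lp) =
  Q j * \sum_(k < i) polN k * polN (i - k)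
    - polN i * \sum_(k < j) polP k.+1 * Q (j.-1 - k)%N.
Proof.
rewrite /letter_conv letter_removals_cat big_cat !big_map !letter_removals_nseq mulr_sumr
  mulr_sumr -sumrN.
congr (_ + _); apply: eq_bigr => k _ /=.
  have -> : rcons (nseq k lm) lp = nseq k lm ++ nseq 1 lp by rewrite cats1.
  have -> : lm :: nseq (i.-1 - k) lm ++ nseq j lp = nseq (i - k) lm ++ nseq j lp.
    by have -> : (i - k = (i.-1 - k).+1)%N by have := ltn_ord k; lia.
  rewrite !block_series_block polP1; move: (polN _) (polN _) (Q _) => *; ring.
have -> : rcons (nseq i lm ++ nseq k lp) lp = nseq i lm ++ nseq k.+1 lp.
  by rewrite -cats1 -catA -(nseqD k 1) addn1.
have -> : lm :: nseq (j.-1 - k) lp = nseq 1 lm ++ nseq (j.-1 - k) lp by [].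
rewrite !block_series_block polN1; move: (polN _) (polP _) (Q _) => *; ring.
Qed.

Lemma nseq_prefix (a : letter) w : exists n w', w = nseq n a ++ w' /\ head (~~ a) w' = ~~ a.
Proof.
elim: w => [|x w [n [w' [-> h]]]]; first by exists 0%N, [::].
have [->|/negPf xa] := eqVneq x a; first by exists n.+1, w'.
exists 0%N, (x :: nseq n a ++ w'); split=> //=.
by case: (x) (a) xa => [] [].
Qed.

(** Induction on the number of maximal blocks m^i p^j of a word. *)
Lemma word_block_ind (P : word -> Prop) :
  (forall i j, P (nseq i.+1 lm ++ nseq j.+1 lp)) ->
  (forall i j V, last lm (lm :: V) = lp -> P (lm :: V) ->
      P ((nseq i.+1 lm ++ nseq j.+1 lp) ++ lm :: V)) ->
  forall V, last lm (lm :: V) = lp -> P (lm :: V).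
Proof.
move=> h1 h2 V; have [n] := ubnP (size V); elim: n V => // n IH V hn hl.
have [i [w [hw ho]]] := nseq_prefix lm V; rewrite hw in hl *.
case: w ho hl hw => [|x w] /=; first by rewrite cats0 (_ : last _ _ = lm) //; elim: (i).
move=> -> /=; rewrite last_cat /= => hl hw.
have [j [w' [hw' ho']]] := nseq_prefix lp w.
have -> : lm :: nseq i lm ++ (~~ lm) :: w = (nseq i.+1 lm ++ nseq j.+1 lp) ++ w'.
  by rewrite hw' /= -catA.
case: w' ho' hw' => [|y w'] /= ho' hw'; first by rewrite cats0; apply: h1.
rewrite ho'; have hl' : last lm (lm :: w') = lp.
  by move: hl; rewrite hw' ho' last_cat.
apply: h2 => //; apply: IH => //.
by move: hn; rewrite hw hw' !size_cat /= !size_cat /=; lia.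
Qed.

(** The equations of N and P cancel all terms of the two convolutions but those of a
longer block. *)
Lemma block_series_lm_block i j :
  block_series polP (nseq i.+2 lm ++ nseq j.+1 lp) =
  - block_series polP (rcons (nseq i.+1 lm ++ nseq j.+1 lp) lp)
  - b * letter_conv polP (nseq i.+1 lm ++ nseq j.+1 lp).
Proof.
have -> : rcons (nseq i.+1 lm ++ nseq j.+1 lp) lp = nseq i.+1 lm ++ nseq j.+2 lp.
  by rewrite -cats1 -catA -(nseqD j.+1 1) addn1.
rewrite letter_conv_block !block_series_block polN_rec // (polP_rec (ltn0Sn j)).
have -> : \sum_(k < j.+1) polP k * polP (j.+1 - k)
  = \sum_(k < j.+1) polP k.+1 * polP (j.+1.-1 - k).
  rewrite big_ord_recl polP0 mul0r add0r [RHS]big_ord_recr /= subnn polP0 mulr0 addr0.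
  by apply: eq_bigr => k _.
move: (polN _) (polP _) (\sum_(i < _) _) (\sum_(i < _) _) => *; ring.
Qed.

(** The case 1 v y of the equation of A.  Removing the first block of the word leaves
the same identity for the rest, plus the identity block_series_lm_block for the
removed block. *)
Lemma block_series_lm V : last lm (lm :: V) = lp ->
  - 'X * block_series polD (lm :: lm :: V) =
  b * (1 + 'X) * block_series polD (lm :: V)
    + 'X * block_series polD (lm :: V) - b * 'X * block_series polP (lm :: V)
   + b * 'X * letter_conv polD (lm :: V).
Proof.
move: V; apply: (word_block_ind (P := fun W => - 'X * block_series polD (lm :: W) =
  b * (1 + 'X) * block_series polD W
    + 'X * block_series polD W - b * 'X * block_series polP W
      + b * 'X * letter_conv polD W)).
  move=> i j.
  have -> : lm :: nseq i.+1 lm ++ nseq j.+1 lp = nseq i.+2 lm ++ nseq j.+1 lp by [].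
  rewrite letter_conv_block !block_series_block polN_rec //.
  have := polD_conv j.+1.
  move: (polN _) (polP _) (polD _) (\sum_(k < i.+1) _) (\sum_(k < j.+1) _) =>
    n p d s1 s2 hs.
  have -> : b * 'X * (d * s1 - n * s2) = b * 'X * d * s1 - b * n * ('X * s2) by ring.
  rewrite hs; ring.
move=> i j V hV IH; set U := nseq i.+1 lm ++ nseq j.+1 lp.
have hU : last lm U = lp by rewrite /U last_cat /=; elim: (j).
have hU' : last lm (lm :: U) = lp by [].
rewrite -cat_cons letter_conv_cat // !block_series_cat //.
have := block_series_lm_block i j; rewrite -/U.
have -> : nseq i.+2 lm ++ nseq j.+1 lp = lm :: U by [].
move: IH; move: (letter_conv _ _) (letter_conv _ _) (block_series polP (lm :: U))
  (block_series polP U) (block_series polP (rcons U _))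
  (block_series polD (lm :: V)) (block_series polD [:: lm, lm & V])
    (block_series polP (lm :: V)).
move=> c2 c1 h1 h2 h3 h4 h5 h6 IH ->.
(* Isolates the terms of the induction hypothesis. *)
have -> : b * 'X * (b * c2 * h4 + h2 * h5 + h3 * h4 + b * h2 * c1) =
  b * h2 * (b * 'X * c1) - b * h2 * (- 'X * h5) + b * 'X * (b * c2 + h3) * h4 by ring.
rewrite IH; ring.
Qed.

(** * The equation of A and its solution on canopies *)

Definition coef1_fun (A : pbt -> R) (z : pbt) : R :=
  if is_leaf z then 0 else ((A z)`_1)%:P.

(** The equation
  s A = s (1 + s) A v 1 + b (1 + s) (A v 1 - 1 v A)
        - s (1 v A + b (F v A - 1 v (F * A)))
outside degree 0, with F the coefficient of s in A.  The last line is G(0) < A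
for G(0) = Y + b (F v 1 - 1 v F). *)
Definition tree_eq (A : pbt -> R) := forall z1 z2,
  'X * A (Vee z1 z2) = 'X * (1 + 'X) * (A z1 * (is_leaf z2)%:R)
   + b * (1 + 'X) * (A z1 * (is_leaf z2)%:R - (is_leaf z1)%:R * A z2)
   - 'X * ((is_leaf z1)%:R * A z2
           + b * (coef1_fun A z1 * A z2 - (is_leaf z1)%:R * star_fun (coef1_fun A) A z2)).

(** The right-hand side involves strict subtrees only, and s is not a zero divisor. *)
Lemma tree_eq_unique A A' :
  A Leaf = A' Leaf -> tree_eq A -> tree_eq A' -> forall z, A z = A' z.
Proof.
move=> h0 h h' z; have [n] := ubnP (inner z); elim: n z => // n IH [|z1 z2] //= hn.
have hF y : (inner y < n)%N -> coef1_fun A y = coef1_fun A' y by move=> hy;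
  rewrite /coef1_fun IH.
have : 'X * (A (Vee z1 z2) - A' (Vee z1 z2)) = 0.
  rewrite mulrBr h h' (IH z1) ?(IH z2) ?hF; try lia.
  rewrite (_ : star_fun (coef1_fun A) A z2 = star_fun (coef1_fun A') A' z2) ?subrr //.
  by apply: eq_star => -[x y] /inner_coproduct /= hxy; rewrite hF ?IH //; lia.
by move/eqP; rewrite mulf_eq0 polyX_eq0 /= subr_eq0 => /eqP.
Qed.

(** The entries of the coproduct are the cuts of z along the path from the root to a
leaf; this leaf becomes the last leaf of the left part, hence a right child, and
the first leaf of the right part, hence a left child.  The exceptions are the
two ends of z, where one part is the trivial tree. *)
Lemma leaves_coproduct d d' e z :
  [seq (leaves d x.1, leaves d' x.2) | x <- coproduct z] =
  [seq (if p.1 is [::] then [:: d] else rcons p.1 lp,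
        if p.2 is [::] then [:: d'] else lm :: p.2) | p <- letter_removals (leaves e z)].
Proof.
elim: z d d' e => [|z1 IH1 z2 IH2] d d' e //=.
have nonnil c z : leaves c z <> [::].
  by elim: z c => //= y1 h1 y2 h2 c; case: (leaves lm y1) (h1 lm).
rewrite letter_removals_cat !map_cat -!map_comp; congr (_ ++ _).
  have {IH1} IH1 := IH1 d lm lm.
  have -> : [seq (leaves d x.1, leaves lm x.2 ++ leaves lp z2) | x <- coproduct z1] =
    [seq (x.1, x.2 ++ leaves lp z2) | x <-
      [seq (leaves d x.1, leaves lm x.2) | x <- coproduct z1]].
    by rewrite -map_comp.
  rewrite IH1 -map_comp; apply: eq_map => -[u v] /=; congr (_, _).
  by case: v => [|y v] /=; case: (leaves lp z2) (nonnil lp z2).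
have -> : [seq (leaves lm z1 ++ leaves lp x.1, leaves d' x.2) | x <- coproduct z2] =
  [seq (leaves lm z1 ++ x.1, x.2) | x <-
    [seq (leaves lp x.1, leaves d' x.2) | x <- coproduct z2]].
  by rewrite -map_comp.
rewrite (IH2 lp d' lp) -map_comp; apply: eq_map => -[u v] /=; congr (_, _).
case hz: (leaves lm z1) (nonnil lm z1) => [|y w] //= _.
by case: u => [|y' u]; rewrite /= ?cats0 ?cats1 // -cat_rcons -rcons_cat cat_rcons.
Qed.

Lemma leaves_shape d z : ~~ is_leaf z -> exists w, leaves d z = lm :: rcons w lp.
Proof.
case: z => // z1 z2 _ /=.
have hl z : exists w, leaves lm z = lm :: w.
  by elim: z => [|x [w hw] y _] /=; [exists [::] | rewrite hw; eexists].
have hr z : exists w, leaves lp z = rcons w lp.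
  elim: z => [|x _ y [w hw]] /=; first by exists [::].
  by rewrite hw -rcons_cat; eexists.
have [w ->] := hl z1; have [w' ->] := hr z2.
by exists (w ++ w'); rewrite rcons_cat.
Qed.

Lemma leaves_any d d' z : ~~ is_leaf z -> leaves d z = leaves d' z.
Proof. by case: z. Qed.

Lemma full_canopyE d z : ~~ is_leaf z -> full_canopy z = leaves d z.
Proof.
move=> hz; have [w hw] := leaves_shape d hz; rewrite hw /full_canopy /canopy.
rewrite (leaves_any lm d) // hw /= size_rcons /=.
by rewrite -[in take _ _]cats1 take_size_cat.
Qed.

(** The solution 1 - N T (sum of s^k P^k over k >= 1).  For the trivial tree, the word
m has coefficient 0. *)
Definition canopy_sol (z : pbt) : R := (is_leaf z)%:R - block_series polD (leaves lm z).

(** Only the last block depends on s, through D = s P + O(s^2). *)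
Lemma block_prod_coef1 i j w : ((block_prod polD i j w)`_1)%:P = block_prod polP i j w.
Proof.
elim: w i j => [|[] w IH] i j /=.
- rewrite /polN coefCM rmorphM; congr (_ * _); rewrite /polD /polP; case: j => [|j] /=.
    by rewrite coef0.
  by rewrite coefXM.
- exact: IH.
- case: j => [|j]; first exact: IH.
  rewrite -(IH 1%N 0%N) /b /polN /polP -!mulrA !coefCM.
  by rewrite !rmorphM.
Qed.

Lemma coef1_canopy_sol z : coef1_fun canopy_sol z = - block_series polP (leaves lm z).
Proof.
rewrite /coef1_fun /canopy_sol; case: z => [|z1 z2] /=; last first.
  by rewrite sub0r coefN polyCN /block_series block_prod_coef1.
by rewrite /block_series /= polP0 mulr0 oppr0.
Qed.

Lemma star_coef1_canopy_sol z : ~~ is_leaf z ->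
  star_fun (coef1_fun canopy_sol) canopy_sol z
    = - block_series polP (leaves lm z) + letter_conv polD (leaves lm z).
Proof.
move=> hz; rewrite /canopy_sol starDr star_is_leaf coef1_canopy_sol; congr (_ + _).
rewrite /star_fun; under eq_bigr => x _ do rewrite coef1_canopy_sol mulrNN.
have := leaves_coproduct lm lm lm z.
move/(congr1 (fun s => \sum_(x <- s) block_series polP x.1 * block_series polD x.2));
  rewrite !big_map /= => ->.
apply: eq_bigr => -[u v] _ /=; congr (_ * _); last by case: v.
by case: u => //=; rewrite block_series_lp /block_series /= polP0 mulr0.
Qed.

(** The full canopy of x v y is the concatenation of those of x and y, a trivial tree
counting for the single letter m on the left and p on the right.  The four cases
are then the value at m p, block_series_lm, block_series_rcons and
block_series_cat. *)
Lemma canopy_sol_tree_eq : tree_eq canopy_sol.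
Proof.
move=> z1 z2; rewrite coef1_canopy_sol.
have Hleaf Q : Q 0%N = 0 -> block_series Q [:: lm] = 0 by rewrite /block_series /= => ->;
  rewrite mulr0.
have A1 z : ~~ is_leaf z -> canopy_sol z = - block_series polD (leaves lm z).
  by rewrite /canopy_sol => /negPf ->; rewrite sub0r.
have A0 : canopy_sol Leaf = 1 by rewrite /canopy_sol /= Hleaf ?subr0.
case: (boolP (is_leaf z1)) => h1; case: (boolP (is_leaf z2)) => h2.
- case: z1 z2 h1 h2 => // -[] // _ _.
  rewrite star_leaf A0 (A1 (Vee _ _)) // Hleaf ?polP0 // coef1_canopy_sol Hleaf ?polP0 //=.
  rewrite /block_series /= polN1 /polD /=; ring.
- case: z1 h1 => // _; rewrite star_coef1_canopy_sol // Hleaf ?polP0 // A0 !A1 //=.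
  rewrite (leaves_any lp lm h2).
  have [w hw] := leaves_shape lm h2; rewrite hw.
  have := @block_series_lm (rcons w lp); rewrite /= last_rcons => /(_ erefl).
  move: (letter_conv _ _) (block_series _ _) (block_series _ _) (block_series _ _) =>
    c x y t h.
  rewrite mulrN -mulNr h; ring.
- case: z2 h2 => // _; rewrite A0 !A1 //= .
  have [w hw] := leaves_shape lm h1; rewrite cats1 mulrN block_series_rcons ?hw; last first.
    by rewrite /= last_rcons.
  move: (block_series polD _) (block_series polP _) (star_fun _ _ _) => *; ring.
- rewrite !A1 //= (leaves_any lp lm h2) /=.
  have [w hw] := leaves_shape lm h1; have [w' hw'] := leaves_shape lm h2.
  rewrite hw hw' block_series_cat /= ?last_rcons //.
  move: (block_series polD _) (block_series polP _) (star_fun _ _ _) => *; ring.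
Qed.

(** Elimination of f and X: the hypotheses are those satisfied by the images of the
series of connected flows. *)
Section Solve.
Variables (f g X : pbt -> R).
Hypotheses (der_f : forall z, deg_der f z = g z + prelie_fun f g z).
Hypotheses (der_X : forall z, deg_der X z = X z + prelie_fun X g z).
Hypotheses (X1 : X Ytree = 1) (f0 : f Leaf = 0).
Hypotheses (f_s : forall z, (f z)`_0 = 0).
Let F z := ((f z)`_1)%:P : R.
Let G z := deltaY z + b * (veeL F z - veeR F z).
Hypotheses (fX : forall z,
  'X * (f z + G z) = 'X * (1 + 'X) * X z + b * (1 + 'X) * (X z - deltaY z)).

Lemma solve_F z : ((f z)`_1)%:P = - block_series polP (leaves lm z).
Proof.
have [A [A0 der_A]] := logder_exists (logder_leaf der_f).
have XA := X_prec_A der_f der_X X1 A0 der_A.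
have fA := A_fixpoint der_f A0 der_A.
(* A = 1 + f < A and f = O(s) give A = 1 + s F + O(s^2). *)
have A_s z' : (A z')`_0 = (is_leaf z')%:R.
  rewrite fA; case: z' => [|z1 z2] /=; first by rewrite addr0 coef1.
  rewrite add0r /star_fun coef_sum big1 // => x _.
  by rewrite coef0M f_s mul0r.
have FE : forall z', coef1_fun A z' = F z'.
  case=> [|z1 z2]; rewrite /coef1_fun /F /=; first by rewrite f0 coef0.
  congr (_%:P); rewrite fA add0r /= /star_fun coef_sum.
  have := star_is_leaf (fun x => ((f (Vee z1 x))`_1)%:P) z2.
  rewrite /star_fun => /(congr1 (fun p : R => p`_0)); rewrite coef_sum coefC /= => <-.
  apply: eq_bigr => x _; rewrite coef0M coefC /= coefM big_ord_recl big_ord1 /=.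
  by rewrite f_s mul0r add0r A_s; case: is_leaf; rewrite ?coef1 ?coef0.
(* The relation fX, multiplied on the right by < A. *)
have TE : tree_eq A.
  move=> z1 z2; pose S h := star_fun (fun x => h (Vee z1 x)) A z2.
  have dY x : deltaY (Vee z1 x) = (is_leaf z1)%:R * (is_leaf x)%:R.
    by rewrite /deltaY; case: z1 x {S} => [|? ?] [|? ?] //=; rewrite ?mulr1 ?mul0r ?mulr0.
  have SX : S X = A z1 * (is_leaf z2)%:R by rewrite -[LHS]/(prec_fun X A (Vee z1 z2)) XA.
  have Sf : S f = A (Vee z1 z2) by rewrite [RHS]fA add0r.
  have SZ (c : R) h : star_fun (fun x => c * h x) A z2 = c * star_fun h A z2.
    by rewrite /star_fun mulr_sumr; apply: eq_bigr => x _; rewrite mulrA.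
  have Sd : S deltaY = (is_leaf z1)%:R * A z2.
    by rewrite -[in RHS](star_leaf_is A) -SZ; apply: eq_star => x _; rewrite dY.
  have SG : S G = (is_leaf z1)%:R * A z2
           + b * (F z1 * A z2 - (is_leaf z1)%:R * star_fun F A z2).
    rewrite -Sd -[in X in b * (X - _)](star_leaf_is A) -!SZ -starBl -SZ -starDl.
    by apply: eq_star => x _.
  have : 'X * (S f + S G) = 'X * (1 + 'X) * S X + b * (1 + 'X) * (S X - S deltaY).
    by rewrite -starDl -starBl -!SZ -starDl; apply: eq_star => x _; rewrite fX.
  rewrite Sf SG SX Sd FE.
  rewrite (_ : star_fun (coef1_fun A) A z2 = star_fun F A z2);
    last by apply: eq_star => x _; rewrite FE.
  by rewrite mulrDr => /(canRL (addrK _)).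
rewrite -[LHS]FE -coef1_canopy_sol.
have hA := tree_eq_unique _ TE canopy_sol_tree_eq.
rewrite /coef1_fun hA // A0.
by rewrite /canopy_sol /block_series /= mulr0 subr0.
Qed.
End Solve.

Local Close Scope ring_scope.

(** * Permanents, grafting and cutting an edge *)

Section Permanent.
Variables (T : eqType) (w : T -> T -> nat).

Fixpoint permanent (s us : seq T) : nat :=
  match s with
  | [::] => us == [::]
  | x :: s' => \sum_(y <- us) w x y * permanent s' (rem y us)
  end.
End Permanent.

Section PermanentTheory.
Variables (T : eqType) (w : T -> T -> nat).
Notation permanent := (permanent w).

Lemma perm_rem (x : T) s s' : perm_eq s s' -> perm_eq (rem x s) (rem x s').
Proof.
move=> h; case: (boolP (x \in s)) => hx.
  rewrite -(perm_cons x) -(permPl (perm_to_rem hx)) (permPl h).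
  by apply: perm_to_rem; rewrite -(perm_mem h).
by rewrite !rem_id // -(perm_mem h).
Qed.

Lemma permanent_permr s us us' : perm_eq us us' -> permanent s us = permanent s us'.
Proof.
elim: s us us' => [|x s IH] us us' h /=; first by rewrite -!size_eq0 (perm_size h).
rewrite (perm_big _ h) /=; apply: eq_bigr => y _.
by rewrite (IH _ _ (perm_rem y h)).
Qed.

Lemma sum_rem (us : seq T) y (G : T -> nat) : y \in us ->
  \sum_(z <- us) G z = G y + \sum_(z <- rem y us) G z.
Proof. by move=> hy; rewrite (perm_big _ (perm_to_rem hy)) big_cons. Qed.

(** Both sides sum G over the ordered pairs of entries at distinct positions. *)
Lemma sum_rem2 (us : seq T) (G : T -> T -> nat) :
  \sum_(y <- us) \sum_(z <- rem y us) G y z = \sum_(z <- us) \sum_(y <- rem z us) G y z.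
Proof.
apply/eqP; rewrite -(eqn_add2l (\sum_(y <- us) G y y)) -!big_split /=; apply/eqP.
rewrite !big_seq; under eq_bigr => y hy do rewrite -(sum_rem _ hy).
under [RHS]eq_bigr => y hy do rewrite -(sum_rem (fun z => G z y) hy).
by rewrite -!big_seq exchange_big.
Qed.

Lemma perm_remC (x y : T) s : perm_eq (rem x (rem y s)) (rem y (rem x s)).
Proof.
have [-> //|hxy] := eqVneq x y.
apply/permP => a; rewrite !count_rem.
have hm (u v : T) : u != v -> (u \in rem v s) = (u \in s).
  elim: s => //= c s IH huv; case: eqVneq => [->|hcv]; rewrite ?inE ?IH //.
  by rewrite (negPf huv).
by rewrite !hm // 1?eq_sym // subnAC.
Qed.

Lemma permanent_swap x1 x2 s us :
  permanent [:: x1, x2 & s] us = permanent [:: x2, x1 & s] us.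
Proof.
rewrite /=; under eq_bigr do rewrite big_distrr /=.
rewrite sum_rem2; apply: eq_bigr => y _; rewrite big_distrr /=.
apply: eq_bigr => z _; rewrite mulnCA; congr (_ * (_ * _)).
exact/permanent_permr/perm_remC.
Qed.

Lemma permanent_cons_rem x s us : x \in s -> permanent (x :: rem x s) us = permanent s us.
Proof.
elim: s us => // z s IH us; rewrite inE; have [-> _|hxz] := eqVneq x z.
  by rewrite [rem _ _]/= eqxx.
move=> /= hx; rewrite -/(permanent (x :: rem x (z :: s)) us) [rem _ _]/= eq_sym (negPf hxz).
by rewrite permanent_swap [LHS]/=; apply: eq_bigr => y _; rewrite -IH.
Qed.

Lemma permanent_perml s s' us : perm_eq s s' -> permanent s us = permanent s' us.
Proof.
elim: s s' us => [|x s IH] s' us h; first by move: (perm_size h) => /esym/size0nil ->.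
have hx : x \in s' by rewrite -(perm_mem h) mem_head.
rewrite -(permanent_cons_rem us hx) [LHS]/= [RHS]/=; apply: eq_bigr => y _.
rewrite (IH (rem x s')) // -(perm_cons x) (permPl h); exact: perm_to_rem.
Qed.

(** Expansion along a column; the definition expands along a row. *)
Lemma permanent_col s y us :
  permanent s (y :: us) = \sum_(x <- s) w x y * permanent (rem x s) us.
Proof.
elim: s us => [|x s IH] us; first by rewrite big_nil.
rewrite big_cons [rem x _]/= eqxx [LHS]/= big_cons [rem y _]/= eqxx; congr (_ + _).
transitivity (\sum_(z <- us) w x z * \sum_(x' <- s) w x' y * permanent (rem x' s)
  (rem z us)).
  rewrite big_seq [RHS]big_seq; apply: eq_bigr => z hz; rewrite -IH; congr (_ * _).
  apply: permanent_permr; rewrite /=; case: eqVneq => [->|//]; exact: perm_to_rem.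
under eq_bigr do rewrite big_distrr /=.
rewrite exchange_big /= big_seq [RHS]big_seq; apply: eq_bigr => x' hx'.
have -> : permanent (rem x' (x :: s)) us = permanent (x :: rem x' s) us.
  apply: permanent_perml; rewrite /=; case: eqVneq => [->|//]; exact: perm_to_rem.
by rewrite /= big_distrr /=; apply: eq_bigr => z _; rewrite mulnCA.
Qed.

End PermanentTheory.

(** An isomorphism matches the branches of the roots bijectively, and consists of
isomorphisms between matched branches. *)
Fixpoint niso (t u : ptree) : nat :=
  let: PNode s := t in let: PNode us := u in permanent niso s us.

Lemma ptree_nest_ind (P : ptree -> Prop) :
  (forall s, (forall x, x \in s -> P x) -> P (PNode s)) -> forall t, P t.
Proof.
move=> h; fix IH 1 => -[s]; apply: h.
elim: s => [x|y s IHs x]; rewrite inE; first discriminate.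
by case/predU1P=> [->|]; [exact: (IH y) | exact: IHs].
Qed.

Fixpoint psize (t : ptree) : nat :=
  let: PNode s := t in (sumn (map psize s)).+1.

(** The ways of cutting one edge: the component of the root, up to the order of its
branches, and the other component. *)
Fixpoint cuts (t : ptree) : seq (ptree * ptree) :=
  let: PNode s := t in
  flatten [seq (PNode (rem x s), x) ::
               [seq (PNode (p.1 :: rem x s), p.2) | p <- cuts x] | x <- s].

Lemma sum_cuts (M : nmodType) s (F : ptree * ptree -> M) :
  (\sum_(p <- cuts (PNode s)) F p =
   \sum_(x <- s) (F (PNode (rem x s), x) +
     \sum_(p <- cuts x) F (PNode (p.1 :: rem x s), p.2)))%R.
Proof.
rewrite /= big_flatten /= big_map; apply: eq_bigr => x _.
by rewrite big_cons big_map.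
Qed.

Lemma vertices_PNode s : vertices (PNode s) =
  [::] :: flatten [seq map (cons i) (vertices (nth (PNode [::]) s i)) | i <- iota 0
    (size s)].
Proof.
rewrite /= size_map; congr (_ :: flatten _); apply/eq_in_map => i.
by rewrite mem_iota => /andP[_ hi]; rewrite (nth_map (PNode [::])).
Qed.

Lemma sum_vertices (M : nmodType) s (F : seq nat -> M) :
  (\sum_(v <- vertices (PNode s)) F v = F [::] +
   \sum_(i < size s) \sum_(v <- vertices (nth (PNode [::]) s i)) F (nat_of_ord i :: v))%R.
Proof.
rewrite vertices_PNode big_cons big_flatten /= big_map; congr (_ + _)%R.
rewrite (_ : iota 0 (size s) = index_iota 0 (size s)) ?big_mkord; last first.
  by rewrite /index_iota subn0.
by apply: eq_bigr => i _; rewrite big_map.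
Qed.

Lemma perm_set_nth (T : eqType) (d d' : T) s k y : k < size s ->
  perm_eq (set_nth d' s k y) (y :: rem (nth d s k) s).
Proof.
move=> hk; rewrite set_nthE hk -cat1s perm_catCA perm_cons.
rewrite -(perm_cons (nth d s k)).
apply: perm_trans (perm_to_rem (mem_nth d hk)).
have e : s = take k s ++ nth d s k :: drop k.+1 s by rewrite -drop_nth // cat_take_drop.
rewrite [X in perm_eq _ X]e; exact: (permEl (perm_catCA [:: nth d s k] _ _)).
Qed.

(** An isomorphism from a grafting of T on S to U maps the new edge to an edge of U;
cutting it leaves an isomorphism from S and one from T.  In the induction, grafting
at the root is a row expansion along T, and grafting inside a branch of S is a
row expansion along this branch followed by a column expansion. *)
Lemma graft_cuts S T U :
  \sum_(v <- vertices S) niso (graft v S T) U =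
  \sum_(p <- cuts U) niso S p.1 * niso T p.2.
Proof.
elim/ptree_nest_ind: S U => s IH [us].
rewrite sum_vertices sum_cuts big_split /=; congr (_ + _).
  rewrite (@permanent_perml _ _ _ (T :: s)) ?perm_rcons //=.
  by apply: eq_bigr => y _; rewrite mulnC.
transitivity (\sum_(x <- s) \sum_(y <- us) \sum_(q <- cuts y)
    niso x q.1 * niso T q.2 * permanent niso (rem x s) (rem y us)).
  rewrite [RHS](big_nth (PNode [::])) big_mkord; apply: eq_bigr => i _.
  set x := nth _ s i; have hx : x \in s by apply: mem_nth.
  transitivity (\sum_(v <- vertices x) \sum_(y <- us)
     niso (graft v x T) y * permanent niso (rem x s) (rem y us)).
    apply: eq_bigr => v _; rewrite (@permanent_perml _ _ _ (graft v x T :: rem x s)) //.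
    by rewrite /x (set_nth_default (PNode [::])) //; apply: perm_set_nth.
  rewrite exchange_big /=; apply: eq_bigr => y _.
  by rewrite -big_distrl /= IH // big_distrl.
rewrite exchange_big /=; apply: eq_bigr => y _; rewrite exchange_big /=.
apply: eq_bigr => q _; rewrite permanent_col mulnC big_distrr /=.
by apply: eq_bigr => x _; rewrite mulnCA mulnA.
Qed.

(** * Counting the isomorphisms of planar representatives *)

Notation vpath := (seq nat).
Notation subtree s i := (nth (PNode [::]) s i).

Lemma mem_vertices_cons s i p :
  (i :: p \in vertices (PNode s)) = (i < size s) && (p \in vertices (subtree s i)).
Proof.
rewrite vertices_PNode inE /=; apply/flatten_mapP/andP.
  by case=> k; rewrite mem_iota => /andP[_ hk] /mapP[q hq [-> ->]].
case=> hi hp; exists i; first by rewrite mem_iota.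
by apply/mapP; exists p.
Qed.

Lemma mem_vertices_nil t : [::] \in vertices t.
Proof. exact: root_in. Qed.

Lemma mem_vertices_prefix t p k : rcons p k \in vertices t -> p \in vertices t.
Proof.
elim: p t => [|i p IH] [s]; first by rewrite mem_vertices_nil.
by rewrite rcons_cons !mem_vertices_cons => /andP[-> /IH].
Qed.

Lemma uniq_vertices t : uniq (vertices t).
Proof.
elim/ptree_nest_ind: t => s IH; rewrite vertices_PNode /=; apply/andP; split.
  by apply/negP => /flatten_mapP[i _ /mapP[]].
apply: (allpairs_uniq_dep (f := fun i p => i :: p)); first exact: iota_uniq.
  by move=> i; rewrite mem_iota => /andP[_ hi]; apply: IH; apply: mem_nth.
by move=> [i p] [j q] /= _ _ [-> ->].
Qed.

Lemma size_vertices t : size (vertices t) = psize t.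
Proof.
elim/ptree_nest_ind: t => s IH; rewrite vertices_PNode /=; congr _.+1.
rewrite size_flatten /shape -map_comp.
congr sumn; apply: (@eq_from_nth _ 0); first by rewrite !size_map size_iota.
move=> i; rewrite size_map size_iota => hi.
rewrite (nth_map 0) ?size_iota // (nth_map (PNode [::])) //= size_map nth_iota // add0n.
by apply: IH; apply: mem_nth.
Qed.

Section ForestValues.
Variable V : Type.

Definition forest_values (hs : nat -> vpath -> V) (s : seq ptree) : seq V :=
  flatten [seq map (hs i) (vertices (subtree s i)) | i <- iota 0 (size s)].

Lemma forest_values_cons hs x s : forest_values hs (x :: s) =
  map (hs 0) (vertices x) ++ forest_values (fun i => hs i.+1) s.
Proof.
rewrite /forest_values /=; congr (_ ++ flatten _).
by rewrite -[1]addn0 iotaDl -map_comp.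
Qed.

Lemma map_vertices (h : vpath -> V) s :
  map h (vertices (PNode s)) = h [::] :: forest_values (fun i p => h (i :: p)) s.
Proof.
rewrite vertices_PNode /= map_flatten -map_comp; congr (_ :: flatten _).
by apply: eq_map => i /=; rewrite -map_comp.
Qed.
End ForestValues.

Section Isos.
Variable W : ptree -> ptree -> seq (seq vpath).
Variable us : seq ptree.

(** J lists the branches of the target that are still free. *)
Fixpoint forest_isos (s : seq ptree) (J : seq nat) : seq (seq vpath) :=
  match s with
  | [::] => if J is [::] then [:: [::]] else [::]
  | x :: s' =>
    flatten [seq [seq map (cons j) p.1 ++ p.2
       | p <- [seq (l, l') | l <- W x (subtree us j), l' <- forest_isos s' (rem j J)]]
            | j <- J]
  end.
End Isos.

(** The isomorphisms from t to u, each given by its list of values on vertices t.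
Lists avoid the dependent types of functions on the vertices of the branches. *)
Fixpoint iso_lists (t u : ptree) : seq (seq vpath) :=
  let: PNode s := t in let: PNode us := u in
  map (cons [::]) (forest_isos iso_lists us s (iota 0 (size us))).

Lemma perm_map_rem (T1 T2 : eqType) (f : T1 -> T2) x s : x \in s ->
  perm_eq (map f (rem x s)) (rem (f x) (map f s)).
Proof.
move=> hx; rewrite -(perm_cons (f x)) -map_cons.
apply: perm_trans (perm_to_rem (map_f f hx)).
by rewrite perm_sym; apply/perm_map/perm_to_rem.
Qed.

Lemma size_iso_lists t u : size (iso_lists t u) = niso t u.
Proof.
elim/ptree_nest_ind: t u => s IH [us]; rewrite /= size_map.
have {3}-> : us = map (fun j => subtree us j) (iota 0 (size us)).
  by rewrite -/(mkseq _ _) mkseq_nth.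
elim: s (iota _ _) IH => [|x s IHs] J IH; first by case: J {IH} => [|? ?] /=.
rewrite /= size_flatten /shape sumnE !big_map !big_seq.
apply: eq_bigr => j hj; rewrite size_map size_allpairs IH ?mem_head //; congr (_ * _).
rewrite IHs; last by move=> y hy; apply: IH; rewrite inE hy orbT.
exact/permanent_permr/perm_map_rem.
Qed.

Lemma mem_iso_lists_size t u l : l \in iso_lists t u -> size l = psize t.
Proof.
elim/ptree_nest_ind: t u l => s IH [us] l /= /mapP[l0 hl0 -> /=]; congr _.+1.
elim: s (iota _ _) IH l0 hl0 => [|x s IHs] J IH l0 /=.
  by case: J => //; rewrite inE => /eqP ->.
case/flatten_mapP => j _ /mapP[p /allpairsP[[l1 l2] [h1 h2 -> ->]]] /=.
rewrite size_cat size_map; congr (_ + _); first by apply: IH h1; rewrite mem_head.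
by apply: IHs h2 => y hy; apply: IH; rewrite inE hy orbT.
Qed.

Lemma uniq_iso_lists t u : uniq (iso_lists t u).
Proof.
elim/ptree_nest_ind: t u => s IH [us] /=.
rewrite map_inj_uniq; last by move=> ? ? [].
elim: s (iota _ _) (iota_uniq 0 (size us)) IH => [|x s IHs] J hJ IH /=; first by case: J hJ.
apply: (allpairs_uniq_dep (f := fun j p => map (cons j) p.1 ++ p.2)) => //.
  move=> j hj; apply: allpairs_uniq.
  - by apply: IH; rewrite mem_head.
  - by apply: IHs; [rewrite rem_uniq | move=> y hy; apply: IH; rewrite inE hy orbT].
  - by move=> [? ?] [? ?] _ _ [-> ->].
move=> a c /allpairsPdep[j [p [_ hp ->]]] /allpairsPdep[j' [q [_ hq ->]]] /=.
case/allpairsP: hp => -[l1 l1'] [/= h1 _ ->]; case/allpairsP: hq => -[l2 l2'] [/= h2 _ ->].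
have [h1s h2s] := (mem_iso_lists_size h1, mem_iso_lists_size h2).
move/eqP; rewrite eqseq_cat ?size_map ?h1s ?h2s // => /andP[/eqP h12 /eqP ->].
have jj : j = j' by case: (l1) (l2) h1s h2s h12 => [|? ?] [|? ?]; case: (x) => // ? _ _ [].
by subst j'; move: h12 => /inj_map -> // ? ? [].
Qed.

(** The conditions of is_iso for a map of paths.  Preservation of children and
injectivity imply that the relation child is also reflected. *)
Definition isoP t u (h : vpath -> vpath) : Prop :=
  [/\ h [::] = [::],
      forall p i, rcons p i \in vertices t -> exists j, h (rcons p i) = rcons (h p) j,
      {in vertices t &, injective h},
      forall p, p \in vertices t -> h p \in vertices u &
      forall q, q \in vertices u -> exists2 p, p \in vertices t & h p = q].

Lemma isoP_size t u h p : isoP t u h -> p \in vertices t -> size (h p) = size p.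
Proof.
move=> [h0 hc _ _ _]; elim/last_ind: p => [|p i IH] hp; first by rewrite h0.
by have [j ->] := hc _ _ hp; rewrite !size_rcons IH // (mem_vertices_prefix hp).
Qed.

Lemma isoP_eq t u h h' : {in vertices t, h =1 h'} -> isoP t u h -> isoP t u h'.
Proof.
move=> e [h0 hc hi ho hs]; split.
- by rewrite -e ?mem_vertices_nil.
- move=> p i hp; have [j hj] := hc _ _ hp; exists j.
  by rewrite -!e // (mem_vertices_prefix hp).
- by move=> p q hp hq; rewrite -!e //; apply: hi.
- by move=> p hp; rewrite -e // ho.
- by move=> q /hs[p hp <-]; exists p => //; rewrite e.
Qed.

Definition branch_head (h : vpath -> vpath) i : nat := head 0 (h [:: i]).
Definition branch_map (h : vpath -> vpath) i p : vpath := behead (h (i :: p)).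

(** The image of the vertex i of depth 1 is a vertex of depth 1, and its descendants
go to the descendants of this image; so h is a permutation of the branches with an
isomorphism on each branch. *)
Lemma isoP_PNode s us h :
  isoP (PNode s) (PNode us) h <->
  [/\ h [::] = [::],
      perm_eq (mkseq (branch_head h) (size s)) (iota 0 (size us)),
      forall i p, i < size s -> p \in vertices (subtree s i) ->
         h (i :: p) = branch_head h i :: branch_map h i p &
      forall i, i < size s ->
        isoP (subtree s i) (subtree us (branch_head h i)) (branch_map h i)].
Proof.
split.
  move=> H; have [h0 hc hi ho hs] := H.
  have hV i p : i < size s -> p \in vertices (subtree s i) -> i :: p \in vertices (PNode s).
    by rewrite mem_vertices_cons => -> ->.
  have hE i p : i < size s -> p \in vertices (subtree s i) ->
       h (i :: p) = branch_head h i :: branch_map h i p.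
    move=> hs' hp; rewrite /branch_map.
    suff [w ->] : exists w, h (i :: p) = branch_head h i :: w by [].
    elim/last_ind: p hp => [|p k IH] hp.
      have [j hj] := hc [::] i (hV _ _ hs' hp).
      by exists [::]; rewrite /branch_head hj h0.
    have [w hw] := IH (mem_vertices_prefix hp).
    by have [j hj] := hc (i :: p) k (hV _ _ hs' hp); exists (rcons w j); rewrite hj hw.
  have hbn i : i < size s -> h [:: i] = [:: branch_head h i].
    move=> hs'; have := isoP_size H (hV i [::] hs' (mem_vertices_nil _)).
    by rewrite hE ?mem_vertices_nil //=; case: branch_map.
  have bi i j : i < size s -> j < size s -> branch_head h i = branch_head h j -> i = j.
    move=> hsi hsj e; suff [] : [:: i] = [:: j] by [].
    by apply: hi; rewrite ?hV ?mem_vertices_nil // !hbn // e.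
  split=> //.
    apply: uniq_perm; rewrite ?iota_uniq ?/mkseq ?map_inj_in_uniq ?iota_uniq //.
      by move=> i j; rewrite !mem_iota => /andP[_ hsi] /andP[_ hsj]; apply: bi.
    move=> k; apply/mapP/idP => [[i] + ->|].
      rewrite !mem_iota /= !add0n => hsi.
      by have := ho _ (hV i [::] hsi (mem_vertices_nil _));
        rewrite hbn // mem_vertices_cons => /andP[].
    rewrite mem_iota add0n /= => hk.
    have [|p hp e] := hs [:: k]; first by rewrite mem_vertices_cons hk mem_vertices_nil.
    have := isoP_size H hp; rewrite e; case: p hp e => [|i [|]] //= hp e _.
    move: hp; rewrite mem_vertices_cons => /andP[hsi _]; exists i;
      first by rewrite mem_iota.
    by rewrite /branch_head e.
  move=> i hsi; split.
  - by rewrite /branch_map hbn.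
  - move=> p k hp; have [j hj] := hc (i :: p) k (hV _ _ hsi hp); exists j.
    rewrite /branch_map -rcons_cons hj hE // ?(mem_vertices_prefix hp) //.
  - move=> p q hp hq e; suff [] : i :: p = i :: q by [].
    by apply: hi; rewrite ?hV // !hE // e.
  - move=> p hp; have := ho _ (hV i p hsi hp).
    by rewrite hE // mem_vertices_cons => /andP[].
  - move=> q hq; have hk : branch_head h i < size us.
      have := ho _ (hV i [::] hsi (mem_vertices_nil _)).
      by rewrite hbn // mem_vertices_cons => /andP[].
    have [|[|j p] hp e] := hs (branch_head h i :: q); first by rewrite mem_vertices_cons hk.
      by rewrite h0 in e.
    move: hp; rewrite mem_vertices_cons => /andP[hsj hp].
    rewrite hE // in e; case: e => /bi e <-; rewrite e // in hp *.
    by exists p.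
case=> h0 hperm hE hI.
have hsz : size s = size us by have := perm_size hperm; rewrite size_mkseq size_iota.
have bu i : i < size s -> branch_head h i < size us.
  move=> hi; have : branch_head h i \in iota 0 (size us).
    by rewrite -(perm_mem hperm); apply: map_f; rewrite mem_iota.
  by rewrite mem_iota.
have bi i j : i < size s -> j < size s -> branch_head h i = branch_head h j -> i = j.
  move=> hi hj e; have : uniq (mkseq (branch_head h) (size s)).
    by rewrite (perm_uniq hperm) iota_uniq.
  have := @nth_uniq _ 0 (mkseq (branch_head h) (size s)) i j.
  rewrite size_mkseq => hu /(hu hi hj).
  by rewrite !nth_mkseq // e eqxx => /esym/eqP.
split=> //.
- move=> [|i p] k; rewrite ?rcons_cons mem_vertices_cons => /andP[hi hp].
    exists (branch_head h k); rewrite h0 /= hE ?mem_vertices_nil //.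
    by have [-> _ _ _ _] := hI _ hi.
  have [_ /(_ _ _ hp)[j hj] _ _ _] := hI _ hi.
  by exists j; rewrite !hE ?(mem_vertices_prefix hp) // hj.
- move=> [|i p] [|j q] //; rewrite ?mem_vertices_cons ?h0.
  + by move=> _ /andP[hj hq]; rewrite hE.
  + by move=> /andP[hi hp] _; rewrite hE.
  move=> /andP[hi hp] /andP[hj hq]; rewrite !hE // => -[/bi e]; rewrite -e // in hq * => e'.
  by have [_ _ /(_ p q hp hq e') -> _ _] := hI _ hi.
- move=> [|i p]; rewrite ?h0 ?mem_vertices_nil // mem_vertices_cons => /andP[hi hp].
  rewrite hE // mem_vertices_cons bu //=.
  by have [_ _ _ ho _] := hI _ hi; apply: ho.
- move=> [|k q]; first by exists [::]; rewrite ?mem_vertices_nil.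
  rewrite mem_vertices_cons => /andP[hk hq].
  have : k \in mkseq (branch_head h) (size s) by rewrite (perm_mem hperm) mem_iota.
  case/mapP => i; rewrite mem_iota add0n => /= hi ek; rewrite ek in hq *.
  have [_ _ _ _ /(_ q hq)[p hp <-]] := hI _ hi.
  by exists (i :: p); rewrite ?mem_vertices_cons ?hi // hE.
Qed.

Lemma mem_forest_isos W us s J (hs : nat -> vpath -> vpath) :
  (forall x u l, x \in s -> l \in W x u -> size l = psize x) ->
  forest_values hs s \in forest_isos W us s J <->
  perm_eq (mkseq (fun i => head 0 (hs i [::])) (size s)) J /\
  forall i, i < size s ->
    (forall p, p \in vertices (subtree s i) ->
      hs i p = head 0 (hs i [::]) :: behead (hs i p)) /\
    map (fun p => behead (hs i p)) (vertices (subtree s i))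
      \in W (subtree s i) (subtree us (head 0 (hs i [::]))).
Proof.
elim: s J hs => [|x s IH] J hs hW.
  split; first by case: J => // _; split.
  by case=> + _; case: J => // a J /perm_size.
have hW' : forall y u l, y \in s -> l \in W y u -> size l = psize y.
  by move=> y u l hy; apply: hW; rewrite inE hy orbT.
rewrite forest_values_cons [forest_isos _ _ _ _]/=.
have hm : mkseq (fun i => head 0 (hs i [::])) (size s).+1 =
    head 0 (hs 0 [::]) :: mkseq (fun i => head 0 (hs i.+1 [::])) (size s).
  by rewrite /mkseq /= -[1]addn0 iotaDl -map_comp.
have vx : exists vs, vertices x = [::] :: vs by case: (x) => ?; rewrite vertices_PNode;
  eexists.
split.
  case/flatten_mapP => j hj /mapP[p /allpairsP[[l l'] [/= h1 h2 ->]]] /= /eqP.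
  rewrite eqseq_cat ?size_map ?size_vertices ?(hW _ _ _ _ h1) ?mem_head //.
  case/andP => /eqP e1 /eqP e2; rewrite -e2 in h2.
  have [hp hr] := (IH _ (fun i => hs i.+1) hW').1 h2.
  have hj0 : forall p, p \in vertices x -> hs 0 p = j :: behead (hs 0 p).
    by move=> q /(map_f (hs 0)); rewrite e1 => /mapP[r _ ->].
  have ej : j = head 0 (hs 0 [::]) by rewrite hj0 ?mem_vertices_nil.
  split; first by rewrite hm -ej (permPr (perm_to_rem hj)) perm_cons.
  move=> [|i] hi; last exact: hr.
  rewrite /= -ej; split=> //.
  suff -> : map (fun p => behead (hs 0 p)) (vertices x) = l by [].
  by rewrite (map_comp behead (hs 0)) e1 -map_comp map_id.
rewrite hm => -[hp hr]; have [h1 h2] := hr 0 (ltn0Sn _).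
have hj : head 0 (hs 0 [::]) \in J by rewrite -(perm_mem hp) mem_head.
apply/flatten_mapP; exists (head 0 (hs 0 [::])) => //.
apply/mapP; exists (map (fun p => behead (hs 0 p)) (vertices x),
  forest_values (fun i => hs i.+1) s).
  apply/allpairsP; exists
    (map (fun p => behead (hs 0 p)) (vertices x), forest_values (fun i => hs i.+1) s).
  split=> //=; apply/IH => //; split; last by move=> i hi; apply: (hr i.+1).
  by rewrite -(perm_cons (head 0 (hs 0 [::]))) (permPl hp) perm_to_rem.
by rewrite /= -map_comp; congr (_ ++ _); apply/eq_in_map => p hp' /=; apply: h1.
Qed.

Lemma mem_iso_lists t u h : map h (vertices t) \in iso_lists t u <-> isoP t u h.
Proof.
elim/ptree_nest_ind: t u h => s IH [us] h; rewrite isoP_PNode map_vertices.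
have hm : h [::] :: forest_values (fun i p => h (i :: p)) s \in iso_lists (PNode s)
  (PNode us) <->
   h [::] = [::] /\ forest_values (fun i p => h (i :: p)) s \in forest_isos iso_lists us
     s (iota 0 (size us)).
  split; first by move=> /mapP[l hl [-> ->]].
  by case=> -> hl; apply: map_f.
rewrite hm mem_forest_isos; last by move=> x u l _; apply: mem_iso_lists_size.
split=> [[h0 [hp hr]]|[h0 hp he hr]].
  split=> // i; first by move=> p hi hp'; have [+ _] := hr i hi; apply.
  by move=> hi; apply/(IH _ (mem_nth _ hi)); have [_] := hr i hi.
split=> //; split=> // i hi; split; first by move=> p; apply: he.
by apply/(IH _ (mem_nth _ hi)); apply: hr.
Qed.

Section IsoPaths.
Variables t u : ptree.

Definition pathfun V (d : V) (f : vertex t -> V) (p : vpath) : V :=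
  if insub p is Some v then f v else d.

Lemma pathfunE V (d : V) f (v : vertex t) : pathfun d f (ssval v) = f v.
Proof. by rewrite /pathfun valK. Qed.

Lemma vertexP p : p \in vertices t -> exists v : vertex t, p = ssval v.
Proof. by move=> hp; exists (SeqSub hp). Qed.

Lemma is_isoP (f : {ffun vertex t -> vertex u}) :
  is_iso f <-> isoP t u (pathfun [::] (fun v => ssval (f v))).
Proof.
set h := pathfun _ _.
have hE (v : vertex t) : h (ssval v) = ssval (f v) by rewrite /h pathfunE.
split.
  case/and4P => /injectiveP fi /forallP fs /eqP fr /forallP fc; split.
  - by have := hE (rootv t); rewrite /= => ->; rewrite fr.
  - move=> p i hp; have [v hpv] := vertexP (mem_vertices_prefix hp).
    have [w hpw] := vertexP hp.
    have /forallP/(_ v)/eqP := fc w; rewrite /child -hpw -hpv last_rcons eqxx => /eqP.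
    by move=> e; rewrite hpw hpv !hE e; eexists.
  - by move=> p q /vertexP[v ->] /vertexP[w ->]; rewrite !hE => /val_inj/fi ->.
  - by move=> p /vertexP[v ->]; rewrite hE; apply: valP.
  - move=> q hq; have /codomP[v hv] := fs (SeqSub hq).
    by exists (ssval v); rewrite ?(valP v) // hE -hv.
move=> H; have [h0 hc hi ho hs] := H; apply/and4P; split.
- apply/injectiveP => v w e; apply: val_inj; apply: hi; rewrite ?(valP v) ?(valP w) //.
  by rewrite !hE e.
- apply/forallP => y; have [p /vertexP[v ->] e] := hs _ (valP y).
  by apply/codomP; exists v; apply: val_inj; rewrite -e hE.
- by apply/eqP; apply: val_inj; rewrite -[LHS]hE /= h0.
apply/forallP => w; apply/forallP => v; apply/eqP; rewrite /child -!hE.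
have pr (p q : vpath) k : p = rcons q k -> p == rcons q (last 0 p).
  by move=> ->; rewrite last_rcons.
apply/idP/idP => [/eqP e|/eqP e].
  case/lastP ew : (ssval w) => [|p k].
    by move: e; rewrite ew h0; case: (h (ssval v)).
  have hp : rcons p k \in vertices t by rewrite -ew; apply: (valP w).
  have [j hj] := hc _ _ hp; move: e; rewrite ew hj => /rcons_inj[e _].
  rewrite last_rcons.
  by rewrite (hi _ _ (mem_vertices_prefix hp) (valP v) e).
have hw : rcons (ssval v) (last 0 (ssval w)) \in vertices t by rewrite -e; apply: (valP w).
by have [j hj] := hc _ _ hw; rewrite e hj; apply: pr.
Qed.

Lemma values_ext V (h h' : vpath -> V) :
  map h (vertices t) = map h' (vertices t) -> {in vertices t, h =1 h'}.
Proof. by move/eq_in_map. Qed.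

(** The lists of length psize t are exactly the lists of values on vertices t. *)
Lemma values_surj V (d : V) (l : seq V) : size l = psize t ->
  map (fun p => nth d l (index p (vertices t))) (vertices t) = l.
Proof.
move=> hl; apply: (@eq_from_nth _ d); rewrite size_map size_vertices // => i hi.
rewrite (nth_map [::]) ?size_vertices // index_uniq ?uniq_vertices //.
by rewrite size_vertices.
Qed.

Lemma card_isos : #|[set f : {ffun vertex t -> vertex u} | is_iso f]| = niso t u.
Proof.
pose enc (f : {ffun vertex t -> vertex u}) := map (pathfun [::] (fun v => ssval (f v)))
  (vertices t).
have encI : injective enc.
  move=> f g /values_ext e; apply/ffunP => v; apply: val_inj.
  by have := e _ (valP v); rewrite !pathfunE.
rewrite -size_iso_lists cardE -(size_map enc); apply/perm_size/uniq_perm.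
- by rewrite map_inj_uniq ?enum_uniq.
- exact: uniq_iso_lists.
move=> l; apply/mapP/idP => [[f]|hl].
  by rewrite mem_enum inE => /is_isoP H ->; apply/mem_iso_lists.
set h := fun p => nth [::] l (index p (vertices t)).
have el : map h (vertices t) = l by apply: values_surj; apply: mem_iso_lists_size hl.
have H : isoP t u h by apply/mem_iso_lists; rewrite el.
have [_ _ _ ho _] := H.
pose f := [ffun v : vertex t => SeqSub (ho _ (valP v))].
have ef : {in vertices t, h =1 pathfun [::] (fun v => ssval (f v))}.
  by move=> p /vertexP[v ->]; rewrite pathfunE ffunE.
exists f; last by rewrite /enc -el; apply/eq_in_map.
by rewrite mem_enum inE; apply/is_isoP; apply: isoP_eq H.
Qed.

End IsoPaths.

(** * Enumeration of flows *)

Section FlowLists.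
Variable lo : nat.

Section Forest.
Variable W : ptree -> nat -> seq (seq (bool * nat)).

(** k is the rate at the root of the first tree and q the total rate. *)
Fixpoint forest_flows (s : seq ptree) (q : nat) : seq (seq (bool * nat)) :=
  match s with
  | [::] => if q is 0 then [:: [::]] else [::]
  | x :: s' =>
    flatten [seq [seq p.1 ++ p.2
       | p <- [seq (l, l') | l <- W x k, l' <- forest_flows s' (q - k)]]
            | k <- iota lo (q.+1 - lo)]
  end.
End Forest.

(** The flows on t of rate r at the root whose other rates are at least lo, each given
by its list of pairs (is v an output, m v).  With q the total rate of the branches,
a root that is not an output has input r - q, and an output root needs q = r + 1. *)
Fixpoint flow_lists (t : ptree) (r : nat) : seq (seq (bool * nat)) :=
  let: PNode s := t in
  flatten [seq map (cons (false, r - q)) (forest_flows flow_lists s q) | q <- iota 0 r.+1]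
  ++ map (cons (true, 0)) (forest_flows flow_lists s r.+1).

Lemma mem_flow_lists_size t r l : l \in flow_lists t r -> size l = psize t.
Proof.
elim/ptree_nest_ind: t r l => s IH r l.
have hF q l' : l' \in forest_flows flow_lists s q -> size l' = sumn (map psize s).
  elim: s IH q l' => [|x s IHs] IH q l' /=; first by case: q; rewrite !inE => // /eqP ->.
  case/flatten_mapP => k _ /mapP[p /allpairsP[[l1 l2] [/= h1 h2 ->]]] ->.
  rewrite size_cat /= (IH _ _ _ _ h1) ?mem_head //; congr (_ + _).
  by apply: IHs h2 => y hy; apply: IH; rewrite inE hy orbT.
rewrite mem_cat => /orP[/flatten_mapP[q _]|] /mapP[l' /hF hl ->] /=; by rewrite hl.
Qed.

(** The rates are determined by the flow. *)
Lemma flow_lists_rate t r r' l : l \in flow_lists t r -> l \in flow_lists t r' -> r = r'.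
Proof.
elim/ptree_nest_ind: t r r' l => s IH r r' l.
have hF q q' l' : l' \in forest_flows flow_lists s q ->
  l' \in forest_flows flow_lists s q' -> q = q'.
  elim: s IH q q' l' => [|x s IHs] IH q q' l' /=.
    by case: q q' => [|q] [|q']; rewrite ?in_nil.
  case/flatten_mapP => k hk /mapP[p /allpairsP[[l1 l2] [/= h1 h2 -> ->]]].
  case/flatten_mapP => k' hk' /mapP[p' /allpairsP[[l1' l2'] [/= h1' h2' -> /=]]] /eqP.
  rewrite eqseq_cat ?(mem_flow_lists_size h1) ?(mem_flow_lists_size h1') // =>
    /andP[/eqP e1 /eqP e2].
  rewrite -e1 in h1'; rewrite -e2 in h2'.
  have ek : k = k' by apply: IH h1 h1'; rewrite mem_head.
  have : q - k = q' - k'.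
    by apply: IHs h2 h2' => y hy; apply: IH; rewrite inE hy orbT.
  by move: hk hk'; rewrite !mem_iota -ek; lia.
have mE q : l \in flow_lists (PNode s) q -> exists x, exists l', l = x :: l' /\
    exists2 k, l' \in forest_flows flow_lists s k & (if x.1 then k = q.+1 else x.2 + k = q).
  rewrite mem_cat => /orP[/flatten_mapP[k hk]|] /mapP[l' hl ->].
    exists (false, q - k), l'; split=> //; exists k => //=.
    by move: hk; rewrite mem_iota; lia.
  by exists (true, 0), l'; split=> //; exists q.+1.
move=> h1 h2; have [[o m] [l' [e [k hk hx]]]] := mE _ h1.
have [x' [l'' [e' [k' hk' hx']]]] := mE _ h2.
rewrite e in e'; case: e' => ex el; rewrite -el in hk'; rewrite -ex in hx'.
have := hF _ _ _ hk hk'.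
by move: hx hx' => /=; case: (o); lia.
Qed.

Lemma uniq_flow_lists t r : uniq (flow_lists t r).
Proof.
elim/ptree_nest_ind: t r => s IH r.
have hF q : uniq (forest_flows flow_lists s q).
  elim: s IH q => [|x s IHs] IH q /=; first by case: q.
  apply: (allpairs_uniq_dep (f := fun k p => p.1 ++ p.2)); first exact: iota_uniq.
    move=> k _; apply: allpairs_uniq.
    - by apply: IH; rewrite mem_head.
    - by apply: IHs => y hy; apply: IH; rewrite inE hy orbT.
    - by move=> [? ?] [? ?] _ _ [-> ->].
  move=> a c /allpairsPdep[k [p [_ hp ->]]] /allpairsPdep[k' [p' [_ hp' ->]]] /=.
  case/allpairsP: hp => -[l1 l1'] [/= h1 _ ->];
    case/allpairsP: hp' => -[l2 l2'] [/= h2 _ ->].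
  have [h1s h2s] := (mem_flow_lists_size h1, mem_flow_lists_size h2).
  move/eqP; rewrite eqseq_cat ?h1s ?h2s //= => /andP[/eqP h12 /eqP ->].
  by rewrite -h12 in h2 *; rewrite (flow_lists_rate h1 h2).
rewrite /flow_lists -/flow_lists cat_uniq; apply/and3P; split.
- apply: (allpairs_uniq_dep (f := fun q l => (false, r - q) :: l)); first exact: iota_uniq.
    by move=> q _; apply: hF.
  move=> a c /allpairsPdep[k [p [hk _ ->]]] /allpairsPdep[k' [p' [hk' _ ->]]] /= [e ->].
  suff -> : k = k' by [].
  by move: hk hk'; rewrite !mem_iota; lia.
- by apply/hasPn => l /mapP[l' _ ->]; apply/negP => /flatten_mapP[q _ /mapP[]].
- by rewrite map_inj_uniq // => ? ? [].
Qed.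

Definition childp (w p : vpath) : bool := w == rcons p (last 0 w).

(** rho is the function of the rates of the flow h. *)
Definition flow_spec t (h : vpath -> bool * nat) (rho : vpath -> nat) : Prop :=
  forall p, p \in vertices t ->
  [/\ (h p).1 -> (h p).2 = 0,
      rho p + (h p).1 = (h p).2 + \sum_(w <- vertices t | childp w p) rho w &
      p != [::] -> lo <= rho p].

Lemma sum_vertices_root t (F : vpath -> nat) :
  \sum_(v <- vertices t | v == [::]) F v = F [::].
Proof.
case: t => s; rewrite big_mkcond sum_vertices eqxx big1 ?addr0 // => i _.
by rewrite big1.
Qed.

Lemma sum_child_root s (F : vpath -> nat) :
  \sum_(w <- vertices (PNode s) | childp w [::]) F w
    = \sum_(i < size s) F [:: nat_of_ord i].
Proof.
rewrite big_mkcond sum_vertices /= add0r; apply: eq_bigr => i _.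
rewrite -(sum_vertices_root (subtree s i) (fun v => F (nat_of_ord i :: v))) big_mkcond
  [RHS]big_mkcond.
apply: eq_bigr => v _; rewrite /childp /= eqseq_cons.
by case: v => [|a v]; rewrite ?eqxx //= andbF.
Qed.

Lemma sum_child_sub s i p (F : vpath -> nat) : i < size s ->
  \sum_(w <- vertices (PNode s) | childp w (i :: p)) F w =
  \sum_(w <- vertices (subtree s i) | childp w p) F (i :: w).
Proof.
move=> hi; rewrite big_mkcond sum_vertices /= add0r (bigD1 (Ordinal hi)) //=.
rewrite [X in (_ + X)%R = _]big1 ?addr0.
  rewrite [RHS]big_mkcond; apply: eq_bigr => v _; rewrite /childp /= eqseq_cons eqxx /=.
  by case: v => //=; case: p.
move=> j hj; rewrite big1 // => v _; rewrite /childp eqseq_cons.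
by case: eqP => // e; case/eqP: hj; apply: val_inj.
Qed.

Lemma flow_spec_PNode s h rho :
  flow_spec (PNode s) h rho <->
  [/\ (h [::]).1 -> (h [::]).2 = 0,
      rho [::] + (h [::]).1 = (h [::]).2 + \sum_(i < size s) rho [:: nat_of_ord i] &
      forall i, i < size s -> lo <= rho [:: i] /\
         flow_spec (subtree s i) (fun p => h (i :: p)) (fun p => rho (i :: p))].
Proof.
split=> [H|[h1 h2 hr] [|i p]].
  split.
  - by have [] := H _ (mem_vertices_nil _).
  - by have [_ + _] := H _ (mem_vertices_nil _); rewrite sum_child_root.
  - move=> i hi; split.
      have [|_ _ ] := H [:: i]; last by apply.
      by rewrite mem_vertices_cons hi mem_vertices_nil.
    move=> p hp; have [|e1 e2 e3] := H (i :: p); first by rewrite mem_vertices_cons hi.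
    by split=> //; [rewrite e2 sum_child_sub | move=> _; apply: e3].
- by move=> _; split=> //; rewrite sum_child_root.
rewrite mem_vertices_cons => /andP[hi hp]; have [hl /(_ p hp)[e1 e2 e3]] := hr i hi.
split=> //; first by rewrite sum_child_sub.
by move=> _; case: (p) e3 => // a p' ; apply.
Qed.

Lemma mem_forest_flows s q (hs : nat -> vpath -> bool * nat) :
  (forall x r h, x \in s ->
     map h (vertices x) \in flow_lists x r <-> exists2 rho, flow_spec x h rho & rho [::]
       = r) ->
  forest_values hs s \in forest_flows flow_lists s q <->
  exists2 rs : nat -> vpath -> nat,
    forall i, i < size s -> lo <= rs i [::] /\ flow_spec (subtree s i) (hs i) (rs i) &
    \sum_(i < size s) rs i [::] = q.
Proof.
elim: s q hs => [|x s IH] q hs hx.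
  split; last by case=> rs _; rewrite big_ord0 => <-.
  by case: q => // _; exists (fun _ _ => 0) => //; rewrite big_ord0.
have {}IH := IH _ _ (fun y r h hy => hx y r h (mem_behead (s := x :: s) hy)).
rewrite forest_values_cons /=; split.
  case/flatten_mapP => k hk /mapP[p /allpairsP[[l1 l2] [/= h1 h2 ->]]] /= /eqP.
  rewrite eqseq_cat ?size_map ?size_vertices ?(mem_flow_lists_size h1) // =>
    /andP[/eqP e1 /eqP e2].
  rewrite -e1 in h1; rewrite -e2 in h2.
  have [rho hrho er] := (hx x _ _ (mem_head _ _)).1 h1.
  have [rs hrs es] := (IH _ _).1 h2.
  exists (fun i => if i is i'.+1 then rs i' else rho).
    move=> [|i] hi; last exact: hrs.
    by split=> //; rewrite er; move: hk; rewrite mem_iota; case/andP.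
  rewrite big_ord_recl /= er es; move: hk; rewrite mem_iota; lia.
case=> rs hrs; rewrite big_ord_recl /= => es.
have [hl0 hf0] := hrs 0 (ltn0Sn _).
apply/flatten_mapP; exists (rs 0 [::]); first by rewrite mem_iota; lia.
apply/mapP; exists (map (hs 0) (vertices x), forest_values (fun i => hs i.+1) s) => //.
apply/allpairsP; exists (map (hs 0) (vertices x), forest_values (fun i => hs i.+1) s).
split=> //=; first by apply/hx; [exact: mem_head | exists (rs 0)].
by apply/IH; exists (fun i => rs i.+1);
  [move=> i hi; apply: (hrs i.+1) | rewrite -es addKn].
Qed.

Lemma mem_flow_lists t r h :
  map h (vertices t) \in flow_lists t r <-> exists2 rho, flow_spec t h rho & rho [::] = r.
Proof.
elim/ptree_nest_ind: t r h => s IH r h.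
have hF q := @mem_forest_flows s q (fun i p => h (i :: p)) (fun x r h hx => IH x hx r h).
rewrite map_vertices; split.
  rewrite mem_cat => H.
  have [e1 [q /hF[rs hrs es] e2]] : ((h [::]).1 -> (h [::]).2 = 0) /\
    exists2 q, forest_values (fun i p => h (i :: p)) s \in forest_flows flow_lists s q &
       r + (h [::]).1 = (h [::]).2 + q.
    case/orP: H => [/flatten_mapP[q hq]|] /mapP[l hl [-> ->]]; split=> //.
      by exists q => //=; move: hq; rewrite mem_iota; lia.
    by exists r.+1 => //=; rewrite addn1.
  exists (fun p => if p is i :: p' then rs i p' else r) => //.
  by apply/flow_spec_PNode; split=> //; rewrite e2 -es.
case=> rho /flow_spec_PNode[e1 e2 hr] er; rewrite er in e2.
have hq : forest_values (fun i p => h (i :: p)) s \in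
    forest_flows flow_lists s (\sum_(i < size s) rho [:: nat_of_ord i]).
  by apply/hF; exists (fun i p => rho (i :: p)).
move: (\sum_(i < size s) rho [:: nat_of_ord i]) e2 hq => S e2 hq.
rewrite mem_cat; apply/orP; case hh : (h [::]) => [[] m]; rewrite hh /= in e1 e2.
  right; rewrite e1 //; apply: map_f; rewrite e1 // in e2.
  by rewrite add0n addn1 in e2; rewrite e2.
left; apply/flatten_mapP; exists S; first by rewrite mem_iota; lia.
apply/mapP; exists (forest_values (fun i p => h (i :: p)) s) => //.
by congr ((_, _) :: _); lia.
Qed.

Local Open Scope ring_scope.

Definition gf_list (L : seq (seq (bool * nat))) : Qb :=
  \sum_(l <- L) 'X^(count fst l).

Definition flow_gf t r : Qb := gf_list (flow_lists t r).
Definition forest_gf s q : Qb := gf_list (forest_flows flow_lists s q).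

Lemma flow_gf_PNode s r :
  flow_gf (PNode s) r = \sum_(q < r.+1) forest_gf s q + 'X * forest_gf s r.+1.
Proof.
rewrite /flow_gf /gf_list /flow_lists -/flow_lists big_cat big_flatten big_map;
  congr (_ + _).
  rewrite -(big_mkord xpredT (fun q => forest_gf s q)) /index_iota subn0;
    apply: eq_bigr => q _.
  by rewrite big_map.
by rewrite big_map mulr_sumr; apply: eq_bigr => l _; rewrite /= add1n exprS.
Qed.

Lemma forest_gf_nil q : forest_gf [::] q = (q == 0%N)%:R.
Proof. by rewrite /forest_gf /gf_list; case: q => [|q]; rewrite ?big_nil // big_seq1. Qed.

Lemma forest_gf_cons x s q :
  forest_gf (x :: s) q = \sum_(k <- iota lo (q.+1 - lo)) flow_gf x k * forest_gf s (q - k).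
Proof.
rewrite /forest_gf /gf_list /= big_flatten /= big_map; apply: eq_bigr => k _.
rewrite big_map big_allpairs /= mulr_suml; apply: eq_bigr => l _.
rewrite mulr_sumr; apply: eq_bigr => l' _.
by rewrite count_cat exprD.
Qed.

Section SizeGf.
Variable t : ptree.

Lemma sum_vertex (M : nmodType) (P : pred vpath) (F : vpath -> M) :
  \sum_(w : vertex t | P (ssval w)) F (ssval w) = \sum_(w <- vertices t | P w) F w.
Proof.
rewrite -(big_map (@ssval _ _) P F); apply: perm_big; apply: uniq_perm.
- by rewrite map_inj_uniq ?index_enum_uniq //; exact: val_inj.
- exact: uniq_vertices.
move=> p; apply/mapP/idP => [[w _ ->]|/vertexP[w ->]]; first exact: (valP w).
by exists w => //; rewrite mem_index_enum.
Qed.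

Definition flow_fun (f : flow_data t) : vpath -> bool * nat :=
  pathfun (false, 0%N) (fun v : vertex t => (v \in f.1, f.2 v)).

(** The rates being nonnegative, they can be taken in nat. *)
Lemma flowsP (f : flow_data t) (Q : (vertex t -> int) -> Prop) :
  (forall r : vertex t -> int, (forall v, 0 <= r v) ->
     Q r <-> r (rootv t) = 0 /\ forall v, v != rootv t -> lo%:Z <= r v) ->
  flows Q f <-> exists2 rho, flow_spec t (flow_fun f) rho & rho [::] = 0%N.
Proof.
move=> hQ; split.
  case=> hO [r [hr r0 /(hQ r r0)[rr rl]]].
  pose rho := pathfun 0%N (fun v => `|r v|%N).
  have rhoE v : (rho (ssval v))%:Z = r v by rewrite /rho pathfunE gez0_abs.
  exists rho; last first.
    by have := rhoE (rootv t); rewrite rr /= => -[].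
  move=> p /vertexP[v ->]; rewrite /flow_fun pathfunE /=; split; first exact: hO.
    apply/eqP; rewrite -eqz_nat !PoszD rhoE hr addrAC subrK; apply/eqP; congr (_ + _).
    rewrite -natz natr_sum -(sum_vertex (childp^~ (ssval v)) (fun p => (rho p)%:R : int)).
    by apply: eq_bigr => w _; rewrite natz rhoE.
  move=> hv; rewrite -lez_nat rhoE; apply: rl.
  by apply: contraNneq hv => ->.
case=> rho hf h0; split.
  move=> v hv; have [+ _ _] := hf _ (valP v).
  by rewrite /flow_fun pathfunE /= hv => ->.
exists (fun v => (rho (ssval v))%:Z); split=> //.
  move=> v; have [_ + _] := hf _ (valP v); rewrite /flow_fun pathfunE /= => /(congr1 Posz).
  rewrite !PoszD => /(canRL (addrK _)) ->; rewrite addrAC; congr (_ + _).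
  rewrite -natz natr_sum -(sum_vertex (childp^~ (ssval v)) (fun p => (rho p)%:R : int)).
  by apply: eq_bigr => w _; rewrite natz.
apply/hQ => //; split; first by rewrite /= h0.
move=> v hv; have [_ _ h] := hf _ (valP v); rewrite lez_nat; apply: h.
by apply: contraNneq hv => e; apply/eqP; apply: val_inj.
Qed.

Lemma size_gfE (A : set (flow_data t)) :
  (forall f, A f <-> exists2 rho, flow_spec t (flow_fun f) rho & rho [::] = 0%N) ->
  size_gf A = flow_gf t 0.
Proof.
move=> hA; pose enc f := map (flow_fun f) (vertices t).
pose dec (l : seq (bool * nat)) : flow_data t :=
  let x v := nth (false, 0%N) l (index (ssval v) (vertices t)) in
  ([set v | (x v).1]%SET, [ffun v => (x v).2]).
have encK : cancel enc dec.
  move=> [O m]; rewrite /enc /dec; congr (_, _).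
    apply/setP => v; rewrite inE (nth_map [::]) ?index_mem ?(valP v) //.
    by rewrite nth_index ?(valP v) // /flow_fun pathfunE.
  apply/ffunP => v; rewrite ffunE (nth_map [::]) ?index_mem ?(valP v) //.
  by rewrite nth_index ?(valP v) // /flow_fun pathfunE.
have decK l : size l = psize t -> enc (dec l) = l.
  move=> hl; rewrite -[RHS](values_surj (t := t) (false, 0%N) hl).
  apply/eq_in_map => p /vertexP[v ->]; rewrite /flow_fun pathfunE /= inE ffunE.
  by case: nth.
have -> : A = [set` [seq dec l | l <- flow_lists t 0]]%classic.
  apply/seteqP; split=> f /=.
    move=> /hA /mem_flow_lists hf; rewrite -(encK f); exact: map_f.
  case/mapP => l hl ->; apply/hA/mem_flow_lists; rewrite -/(enc _) decK //.
  exact: mem_flow_lists_size hl.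
rewrite /size_gf -fsbig_seq /=; last first.
  rewrite map_inj_in_uniq ?uniq_flow_lists // =>
    l l' /mem_flow_lists_size hl /mem_flow_lists_size hl'.
  by move=> /(congr1 enc); rewrite !decK.
rewrite big_map /flow_gf /gf_list big_seq [RHS]big_seq; apply: eq_bigr => l hl.
congr ('X^ _); rewrite -{2}(decK l (mem_flow_lists_size hl)) /enc count_map.
rewrite -sum1_card -sum1_count.
rewrite -(sum_vertex (preim (flow_fun (dec l)) fst) (fun=> 1%N)).
by apply: eq_bigl => v; rewrite /= /flow_fun pathfunE.
Qed.

End SizeGf.
End FlowLists.

Local Open Scope ring_scope.

Lemma closed_flows_gf t : size_gf (closed_flows t) = flow_gf 0 t 0.
Proof.
apply: size_gfE => f; apply: flowsP => r r0; split=> [|[]//]; split=> //.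
Qed.

Lemma closed_connected_flows_gf t : size_gf (closed_connected_flows t) = flow_gf 1 t 0.
Proof. by apply: size_gfE => f; apply: flowsP => r r0. Qed.

(** * Generating polynomials of connected flows *)

(** The coefficient of t^r in p(t/(1-t)) / (1-t). *)
Definition lam (r : nat) (p : R) : Qb := \sum_(i < r.+1) 'C(r, i)%:R * p`_i.

Lemma lam_wide n r p : (r < n)%N -> lam r p = \sum_(i < n) 'C(r, i)%:R * p`_i.
Proof.
move=> hr; rewrite /lam (big_ord_widen n (fun i => 'C(r, i)%:R * p`_i)) // big_mkcond.
apply: eq_bigr => i _; case: ltnP => // hi.
by rewrite bin_small ?mul0r //.
Qed.

Lemma lam0 p : lam 0 p = p`_0.
Proof. by rewrite /lam big_ord1 bin0 mul1r. Qed.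

(** Pascal's rule. *)
Lemma lamS r p : lam r.+1 p = lam r p + lam r (dv p).
Proof.
rewrite (@lam_wide r.+2) // (@lam_wide r.+2 r p) // big_ord_recl [in RHS]big_ord_recl.
rewrite !bin0 -addrA; congr (_ + _); rewrite /lam -big_split; apply: eq_bigr => i _ /=.
by rewrite /bump /= add1n binS natrD mulrDl coef_drop_poly addn1.
Qed.

Lemma lamD r p q : lam r (p + q) = lam r p + lam r q.
Proof. by rewrite /lam -big_split; apply: eq_bigr => i _; rewrite coefD mulrDr. Qed.

Lemma lamZ r (c : Qb) p : lam r (c%:P * p) = c * lam r p.
Proof. by rewrite /lam mulr_sumr; apply: eq_bigr => i _; rewrite coefCM mulrCA. Qed.

Lemma lamC r (c : Qb) : lam r c%:P = c.
Proof.
rewrite /lam big_ord_recl bin0 mul1r coefC eqxx big1 ?addr0 // => i _.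
by rewrite coefC mulr0.
Qed.

Lemma dvX (p : R) : dv ('X * p) = p.
Proof. by apply/polyP => i; rewrite coef_drop_poly coefXM addn1. Qed.

Lemma dv1 : dv (1 : R) = 0.
Proof. by apply/polyP => i; rewrite coef_drop_poly coef1 coef0 addn1. Qed.

Lemma dvD (p q : R) : dv (p + q) = dv p + dv q.
Proof. exact: linearD. Qed.

Lemma dvCM (c : Qb) (p : R) : dv (c%:P * p) = c%:P * dv p.
Proof. by apply/polyP => i; rewrite !(coef_drop_poly, coefCM). Qed.

Lemma lam_X r p : lam r ('X * p) = \sum_(q < r) lam q p.
Proof.
elim: r => [|r IH]; first by rewrite lam0 coefXM big_ord0.
by rewrite lamS IH dvX big_ord_recr.
Qed.

(** The coefficient of t^r in p(t/(1-t)). *)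
Definition theta (r : nat) (p : R) : Qb := if r is r'.+1 then lam r' (dv p) else p`_0.

Lemma theta_sum r p : \sum_(q < r.+1) theta q p = lam r p.
Proof.
by rewrite big_ord_recl [in RHS](dvE p) lamD lamC lam_X.
Qed.

Lemma theta_1X r p : theta r ((1 + 'X) * p) = lam r p.
Proof.
case: r => [|r] /=; first by rewrite lam0 mulrDl mul1r coefD coefXM addr0.
by rewrite mulrDl mul1r dvD dvX lamD lamS addrC.
Qed.

(** Multiplicativity of the substitution s = t/(1-t), by induction on r: dv obeys the
twisted Leibniz rule dv (p y) = p(0) dv y + (dv p) y. *)
Lemma lam_theta r p y : \sum_(k < r.+1) lam k p * theta (r - k) y = lam r (p * y).
Proof.
elim: r p => [|r IH] p; first by rewrite big_ord1 !lam0 /= coef0M.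
rewrite big_ord_recl subn0 lam0 /= lamS.
have -> : \sum_(i < r.+1) lam (bump 0 i) p * theta (r.+1 - bump 0 i) y =
   lam r (p * y) + lam r (dv p * y).
  rewrite -!IH -big_split; apply: eq_bigr => i _.
  by rewrite /bump /= add1n subSS lamS mulrDl.
have -> : dv (p * y) = (p`_0)%:P * dv y + dv p * y.
  by rewrite {1}(dvE p) mulrDl dvD dvCM -mulrA dvX.
by rewrite lamD lamZ addrCA.
Qed.

Lemma forest_gf_single lo x q :
  forest_gf lo [:: x] q = if (lo <= q)%N then flow_gf lo x q else 0.
Proof.
rewrite forest_gf_cons; case: leqP => h; last first.
  by rewrite (_ : (q.+1 - lo = 0)%N) ?big_nil //; lia.
rewrite subSn // -addn1 iotaD big_cat /= big_seq1 subnKC // subnn forest_gf_nil mulr1.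
rewrite big_seq big1 ?add0r // => k; rewrite mem_iota => hk.
by rewrite forest_gf_nil (_ : (q - k == 0)%N = false) ?mulr0 //; lia.
Qed.

(** Adding a root multiplies by 1/(1-t) + b/t without the pole, which is the recursion
defining chain_poly. *)
Lemma flow_gf_chain n r : flow_gf 0 (chain n) r = lam r (chain_poly n).
Proof.
elim: n r => [|n IH] r.
  rewrite flow_gf_PNode forest_gf_nil mulr0 addr0 (lamC r 1) big_ord_recl forest_gf_nil.
  by rewrite big1 ?addr0 // => i _; rewrite forest_gf_nil.
rewrite flow_gf_PNode forest_gf_single IH.
under eq_bigr => q _ do rewrite forest_gf_single IH.
rewrite -lam_X !lamS dvX [chain_poly n.+1]/= !mulrDl mul1r !lamD !lamZ.
rewrite leq0n; ring.
Qed.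

Lemma ca_chain_const n : ca n.+1 = chain_const n.
Proof. by rewrite /ca closed_flows_gf flow_gf_chain lam0. Qed.

(** Multiplication by 1/(1-t) + b/t = (1 + s) (1 + b/s) without the pole at s = 0. *)
Definition add_vertex (p : R) : R := (1 + 'X) * (p + b * dv p).

Lemma theta_add_vertex r p :
  theta r (add_vertex p) = \sum_(q < r.+1) theta q p + 'X * theta r.+1 p.
Proof. by rewrite theta_1X lamD lamZ theta_sum. Qed.

(** The series X of the branches of the root, in the variable s. *)
Fixpoint branches_gf (t : ptree) : R :=
  let: PNode s := t in foldr (fun x p => 'X * dv (add_vertex (branches_gf x)) * p) 1 s.
Definition tree_gf t := add_vertex (branches_gf t).
Definition pos_gf t := 'X * dv (tree_gf t).

Lemma branches_gf_PNode s : branches_gf (PNode s) = \prod_(x <- s) pos_gf x.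
Proof. by elim: s => [|x s]; rewrite ?big_nil // big_cons => <-. Qed.

Lemma flow_gf_theta t r : flow_gf 1 t r = theta r (tree_gf t).
Proof.
elim/ptree_nest_ind: t r => s IH r.
have hF q : forest_gf 1 s q = theta q (\prod_(x <- s) pos_gf x).
  elim: s IH q => [|x s IHs] IH q.
    rewrite forest_gf_nil big_nil; case: q => [|q] /=; first by rewrite coef1.
    by rewrite dv1 -[0]polyC0 lamC.
  rewrite forest_gf_cons big_cons; case: q => [|q];
    first by rewrite big_nil /= -mulrA coefXM.
  have -> : iota 1 (q.+2 - 1) = map S (iota 0 q.+1).
    by rewrite subn1 -[1%N]addn0 iotaDl.
  rewrite big_map {1}/pos_gf -mulrA [RHS]/= dvX -lam_theta.
  rewrite -(big_mkord xpredT
    (fun k => lam k (dv (tree_gf x)) * theta (q - k) (\prod_(j <- s) pos_gf j))).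
  rewrite /index_iota subn0; apply: eq_bigr => k _.
  rewrite IH ?mem_head // IHs // => y hy; apply: IH; rewrite inE hy orbT //.
rewrite flow_gf_PNode hF (eq_bigr (fun q : 'I_r.+1 => theta q (\prod_(x <- s) pos_gf x)))
  //.
by rewrite -branches_gf_PNode -theta_add_vertex.
Qed.

Lemma flow_gf_rate0 t : flow_gf 1 t 0 = (tree_gf t)`_0.
Proof. exact: flow_gf_theta. Qed.

Lemma flow_gf_rate1 t : flow_gf 1 t 1 = (pos_gf t)`_1.
Proof. by rewrite flow_gf_theta /= lam0 /pos_gf coefXM. Qed.

Lemma tree_gf_split t : tree_gf t = ((tree_gf t)`_0)%:P + pos_gf t.
Proof. exact: dvE. Qed.

Lemma pos_gf_coef0 t : (pos_gf t)`_0 = 0.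
Proof. by rewrite coefXM. Qed.

Definition is_dot (t : ptree) : bool := if t is PNode [::] then true else false.

Lemma branches_gf_coef0 t : (branches_gf t)`_0 = (is_dot t)%:R.
Proof. by case: t => -[|x s] /=; rewrite ?coef1 // -mulrA coefXM. Qed.

(** This linear relation is what survives in Dend, where the product of the branches is
not available. *)
Lemma tree_gf_eq t : 'X * tree_gf t
  = 'X * (1 + 'X) * branches_gf t + b * (1 + 'X) * (branches_gf t - (is_dot t)%:R).
Proof.
have h := XdvE (branches_gf t); rewrite branches_gf_coef0 rmorph_nat in h.
by rewrite -h /tree_gf /add_vertex; ring.
Qed.

(** A closed connected flow has an output at the root and a single branch, of rate 1,
unless the tree is a single vertex. *)
Lemma tree_gf_coef0 t : (tree_gf t)`_0 =
  match t with PNode [::] => 1 | PNode [:: x] => 'X * (pos_gf x)`_1 | _ => 0 end.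
Proof.
have -> : (tree_gf t)`_0 = (branches_gf t)`_0 + 'X * (branches_gf t)`_1.
  by rewrite /tree_gf /add_vertex /b coef0M !coefD coef1 coefX addr0 mul1r coefCM
    coef_drop_poly.
rewrite branches_gf_coef0; case: t => -[|x [|y s]] /=.
- by rewrite coef1 mulr0 addr0.
- by rewrite mulr1 add0r.
- by rewrite add0r -!mulrA coefXM /= mulrCA coefXM mulr0.
Qed.

Lemma psize_gt0 t : (0 < psize t)%N.
Proof. by case: t. Qed.

Lemma psize_PNode s : psize (PNode s) = (\sum_(x <- s) psize x).+1.
Proof. by rewrite /= sumnE big_map. Qed.

Lemma psize_rem x s : x \in s -> (psize x + psize (PNode (rem x s)))%N = psize (PNode s).
Proof. by move=> hx; rewrite !psize_PNode (perm_big _ (perm_to_rem hx)) big_cons addnS. Qed.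

Lemma mem_cuts_size t p : p \in cuts t -> (psize p.1 + psize p.2)%N = psize t.
Proof.
elim/ptree_nest_ind: t p => s IH p /= /flatten_mapP[x hx].
have hs := psize_rem hx; rewrite inE => /predU1P[->|]; first by rewrite addnC hs.
case/mapP => -[q1 q2] hq -> /=; have := IH _ hx _ hq; rewrite /= in hs *; lia.
Qed.

(** The pre-Lie product, on coefficients that are not divided by aut. *)
Definition cut_conv (a c : ptree -> R) t := \sum_(p <- cuts t) a p.1 * c p.2.

(** The series g, computed with fuel n: the recursion goes through the components of
a cut, which are not structural subterms. *)
Fixpoint logder_gf_fuel n t : R :=
  if n is n'.+1 then (psize t)%:R * pos_gf t - cut_conv pos_gf (logder_gf_fuel n') t else 0.
Definition logder_gf t := logder_gf_fuel (psize t) t.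

Lemma eq_cut_conv a c a' c' t :
  (forall p, p \in cuts t -> a p.1 * c p.2 = a' p.1 * c' p.2) ->
    cut_conv a c t = cut_conv a' c' t.
Proof. by move=> h; rewrite /cut_conv big_seq [RHS]big_seq; apply: eq_bigr. Qed.

Lemma logder_gf_stable n n' t :
  (psize t <= n)%N -> (psize t <= n')%N -> logder_gf_fuel n t = logder_gf_fuel n' t.
Proof.
elim: n n' t => [|n IH] n' t hn hn'; first by move: (psize_gt0 t) hn; lia.
case: n' hn' => [|n'] hn' /=; first by move: (psize_gt0 t) hn'; lia.
congr (_ - _); apply: eq_cut_conv => p /mem_cuts_size hp; congr (_ * _).
by apply: IH; move: (psize_gt0 p.1) hp hn hn'; lia.
Qed.

Lemma pos_gf_leibniz t :
  (psize t)%:R * pos_gf t = logder_gf t + cut_conv pos_gf logder_gf t.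
Proof.
rewrite /logder_gf; case e : (psize t) => [|n]; first by move: (psize_gt0 t); rewrite e.
rewrite /= e (_ : cut_conv pos_gf (logder_gf_fuel n) t = cut_conv pos_gf logder_gf t)
  ?subrK //.
apply: eq_cut_conv => p /mem_cuts_size hp; congr (_ * _); apply: logder_gf_stable => //.
by move: (psize_gt0 p.1) hp e; lia.
Qed.

(** A marked vertex other than the root lies in one branch x.  Cutting below the root
removes x or a part of it, and the equation of f on x collects both cases. *)
Lemma branches_gf_leibniz t :
  (psize t)%:R * branches_gf t = branches_gf t + cut_conv branches_gf logder_gf t.
Proof.
case: t => s; rewrite /cut_conv sum_cuts psize_PNode.
(* The cuts inside the branch x and at its root, summed. *)
have -> : (\sum_(x <- s) (branches_gf (PNode (rem x s)) * logder_gf x +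
     \sum_(p <- cuts x) branches_gf (PNode (p.1 :: rem x s)) * logder_gf p.2)) =
   \sum_(x <- s) (psize x)%:R * branches_gf (PNode s).
  rewrite big_seq [RHS]big_seq; apply: eq_bigr => x hx.
  rewrite (branches_gf_PNode s) (perm_big _ (perm_to_rem hx)) big_cons mulrA pos_gf_leibniz.
  rewrite mulrDl mulrC -branches_gf_PNode; congr (_ + _).
  rewrite /cut_conv mulr_suml; apply: eq_bigr => p _.
  by rewrite branches_gf_PNode big_cons -branches_gf_PNode mulrAC.
by rewrite -mulr_suml -addn1 natrD mulrDl natr_sum mul1r addrC.
Qed.

(** Functions on isomorphism classes. *)
Definition iso_inv V (a : ptree -> V) := forall t u, niso t u != 0%N -> a t = a u.

(** A nonzero permanent provides a bijection from s to us with nonzero weights. *)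
Lemma permanent_big (V : Type) (idx : V) (op : Monoid.com_law idx) (T : eqType)
  (w : T -> T -> nat)
   (F : T -> V) s us :
  (forall x y, x \in s -> w x y != 0%N -> F x = F y) -> permanent w s us != 0%N ->
  \big[op/idx]_(x <- s) F x = \big[op/idx]_(x <- us) F x.
Proof.
elim: s us => [|x s IH] us hF /=; first by case: us => //; rewrite !big_nil.
rewrite sum_nat_seq_neq0 => /hasP[y hy]; rewrite /= muln_eq0 negb_or => /andP[hxy hr].
rewrite (perm_big _ (perm_to_rem hy)) !big_cons; congr (op _ _).
  by apply: hF hxy; rewrite mem_head.
by apply: IH hr => z z' hz; apply: hF; rewrite inE hz orbT.
Qed.

Lemma psize_inv : iso_inv psize.
Proof.
move=> t; elim/ptree_nest_ind: t => s IH [us] h.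
by rewrite !psize_PNode (permanent_big _ _ h) // => x y hx; apply: IH.
Qed.

Lemma branches_gf_inv : iso_inv branches_gf.
Proof.
move=> t; elim/ptree_nest_ind: t => s IH [us] h.
rewrite !branches_gf_PNode (permanent_big _ _ h) // => x y hx hxy.
by rewrite /pos_gf /tree_gf (IH _ hx _ hxy).
Qed.

Lemma pos_gf_inv : iso_inv pos_gf.
Proof. by move=> t u h; rewrite /pos_gf /tree_gf (branches_gf_inv h). Qed.

(** * Coefficients of the dendriform operations *)

Lemma coefU1 (K : choiceType) (x k : K) : (<< x >> : {malg Qb[K]})@_k = (x == k)%:R.
Proof. exact: mcoeffU. Qed.

Section Malg.
Variable K : choiceType.
Implicit Type u : {malg Qb[K]}.

Lemma malg_sum u : u = \sum_(x <- msupp u) u@_x *: << x >>.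
Proof.
rewrite {1}(monalgE u); apply: eq_bigr => x _; apply/malgP => k.
by rewrite mcoeffZ mcoeffU coefU1 mulr_natr.
Qed.

Lemma sum_msupp u (z : K) : \sum_(x <- msupp u) u@_x * (x == z)%:R = u@_z.
Proof.
rewrite [in RHS](malg_sum u) (raddf_sum (mcoeff z)); apply: eq_bigr => x _.
by rewrite /= mcoeffZ coefU1.
Qed.

(** The sums over msupp u and over s both reduce to the common part. *)
Lemma sum_msupp_wide u (F : K -> Qb) (s : seq K) : uniq s ->
  (forall x, x \notin s -> F x = 0) ->
  \sum_(x <- msupp u) u@_x * F x = \sum_(x <- s) u@_x * F x.
Proof.
move=> us hF; rewrite [LHS](bigID (mem s)) [RHS](bigID (mem (msupp u))) /=.
rewrite [X in _ + X]big1 ?[X in _ = _ + X]big1 ?addr0.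
- rewrite -big_filter -[RHS]big_filter; apply: perm_big; apply: uniq_perm.
  + by rewrite filter_uniq ?fset_uniq.
  + by rewrite filter_uniq.
  by move=> x; rewrite !mem_filter andbC.
- by move=> x hx; rewrite mcoeff_outdom ?mul0r.
- by move=> x hx; rewrite hF ?mulr0.
Qed.
End Malg.

Section Bilin.
Variables (X1 X2 X3 : choiceType) (op : X1 -> X2 -> {malg Qb[X3]}).

Lemma bilin_coef u v z : (bilin op u v)@_z =
  \sum_(x <- msupp u) \sum_(y <- msupp v) u@_x * v@_y * (op x y)@_z.
Proof.
rewrite /bilin (raddf_sum (mcoeff z)); apply: eq_bigr => x _.
by rewrite (raddf_sum (mcoeff z)); apply: eq_bigr => y _; rewrite /= mcoeffZ.
Qed.

Lemma bilinU x y : bilin op << x >> << y >> = op x y.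
Proof. by rewrite /bilin !msuppU !oner_eq0 !big_seq_fset1 !mcoeffUU mulr1 scale1r. Qed.
End Bilin.

Definition coefs (u : Dend1) (z : pbt) : R := (u@_z)%:P.

(** The basis vector x as a function, with values in R. *)
Definition delta_tree (x : pbt) (z : pbt) : R := (x == z)%:R.

Lemma eq_Vee x1 x2 z1 z2 : (Vee x1 x2 == Vee z1 z2) = (x1 == z1) && (x2 == z2).
Proof. by apply/eqP/andP => [[-> ->]|[/eqP -> /eqP ->]]. Qed.

Lemma vee_coef u v z1 z2 : (vee u v)@_(Vee z1 z2) = u@_z1 * v@_z2.
Proof.
rewrite bilin_coef -(sum_msupp u) -(sum_msupp v) mulr_suml; apply: eq_bigr => x _.
by rewrite mulr_sumr; apply: eq_bigr => y _; rewrite coefU1 mulrACA -natrM mulnb eq_Vee.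
Qed.

Lemma vee_coef0 u v : (vee u v)@_Leaf = 0.
Proof.
by rewrite bilin_coef big1 // => x _; rewrite big1 // => y _; rewrite coefU1 mulr0.
Qed.

Lemma starZl (c : R) f g z : star_fun (fun x => c * f x) g z = c * star_fun f g z.
Proof. by rewrite /star_fun mulr_sumr; apply: eq_bigr => x _; rewrite mulrA. Qed.

Lemma starZr (c : R) f g z : star_fun f (fun x => c * g x) z = c * star_fun f g z.
Proof. by rewrite /star_fun mulr_sumr; apply: eq_bigr => x _; rewrite mulrCA. Qed.

Lemma delta_tree_Vee x1 x2 z1 z2 :
  delta_tree (Vee x1 x2) (Vee z1 z2) = delta_tree x1 z1 * delta_tree x2 z2.
Proof. by rewrite /delta_tree -natrM mulnb eq_Vee. Qed.

(** The recursion of star_tree is dual to that of coproduct. *)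
Lemma coefs_star_tree x y z :
  coefs (star_tree x y) z = star_fun (delta_tree x) (delta_tree y) z.
Proof.
have cfU w v : coefs << w >> v = delta_tree w v by rewrite /coefs coefU1 rmorph_nat.
have dL w : delta_tree Leaf w = (is_leaf w)%:R by rewrite /delta_tree; case: w.
elim: x y z => [|x1 _ x2 IHx] y z.
  rewrite -(@eq_star (fun w => (is_leaf w)%:R) _ (delta_tree y)); last by move=> w _;
    rewrite dL.
  by rewrite star_leaf_is; case: y => [|? ?]; rewrite -cfU.
elim: y z => [|y1 IHy y2 _] z.
  rewrite -(@eq_star (delta_tree (Vee x1 x2)) _ (fun w => (is_leaf w)%:R));
    last by move=> w _; rewrite dL.
  by rewrite star_is_leaf -cfU.
have -> : star_tree (Vee x1 x2) (Vee y1 y2) =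
    vee << x1 >> (star_tree x2 (Vee y1 y2)) + vee (star_tree (Vee x1 x2) y1) << y2 >> by [].
case: z => [|z1 z2].
  by rewrite /coefs mcoeffD !vee_coef0 addr0 star_leaf /delta_tree mulr0.
rewrite /coefs mcoeffD !vee_coef !rmorphD !rmorphM /= -!/(coefs _ _) !cfU IHx IHy
  star_vee addrC /=.
congr (_ + _).
  by rewrite mulrC -starZr; apply: eq_star => w _;
    rewrite delta_tree_Vee [_ * delta_tree y2 _]mulrC.
by rewrite -starZl; apply: eq_star => w _; rewrite delta_tree_Vee.
Qed.

Lemma coefs_prec_tree x y z :
  coefs (prec_tree x y) z = prec_fun (delta_tree x) (delta_tree y) z.
Proof.
case: z => [|z1 z2]; case: x => [|x1 x2] /=.
- by rewrite /coefs mcoeff0.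
- by rewrite /coefs vee_coef0.
- by rewrite /coefs mcoeff0 /star_fun big1 // => w _; rewrite /delta_tree mul0r.
rewrite /coefs vee_coef rmorphM /= coefU1 rmorph_nat -/(coefs _ _) coefs_star_tree
  -/(delta_tree _ _) -starZl.
by apply: eq_star => w _; rewrite delta_tree_Vee.
Qed.

Lemma coefs_succ_tree y x z :
  coefs (succ_tree y x) z = succ_fun (delta_tree y) (delta_tree x) z.
Proof.
case: z => [|z1 z2]; case: x => [|x1 x2] /=.
- by rewrite /coefs mcoeff0.
- by rewrite /coefs vee_coef0.
- by rewrite /coefs mcoeff0 /star_fun big1 // => w _; rewrite /delta_tree mulr0.
rewrite /coefs vee_coef rmorphM /= coefU1 rmorph_nat -/(coefs _ _) coefs_star_tree
  -/(delta_tree _ _).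
by rewrite mulrC -starZr; apply: eq_star => w _;
  rewrite delta_tree_Vee [delta_tree x1 _ * _]mulrC.
Qed.

Lemma coefs_sum u z : coefs u z = \sum_(x <- msupp u) (u@_x)%:P * delta_tree x z.
Proof.
rewrite /coefs -(sum_msupp u) rmorph_sum; apply: eq_bigr => x _.
by rewrite rmorphM /= rmorph_nat.
Qed.

Lemma star_fun_sums (I J : Type) (r : seq I) (s : seq J) (c : I -> R) (d : J -> R)
    (F : I -> pbt -> R) (G : J -> pbt -> R) z :
  star_fun (fun x => \sum_(i <- r) c i * F i x) (fun y => \sum_(j <- s) d j * G j y) z =
  \sum_(i <- r) \sum_(j <- s) c i * d j * star_fun (F i) (G j) z.
Proof.
rewrite star_sum_l; apply: eq_bigr => i _; rewrite starZl star_sum_r mulr_sumr.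
by apply: eq_bigr => j _; rewrite starZr mulrA.
Qed.

Lemma prec_fun_sums (I J : Type) (r : seq I) (s : seq J) (c : I -> R) (d : J -> R)
    (F : I -> pbt -> R) (G : J -> pbt -> R) z :
  prec_fun (fun x => \sum_(i <- r) c i * F i x) (fun y => \sum_(j <- s) d j * G j y) z =
  \sum_(i <- r) \sum_(j <- s) c i * d j * prec_fun (F i) (G j) z.
Proof.
case: z => [|z1 z2]; last exact: star_fun_sums.
by rewrite /= big1 // => i _; rewrite big1 // => j _; rewrite mulr0.
Qed.

Lemma succ_fun_sums (I J : Type) (r : seq I) (s : seq J) (c : I -> R) (d : J -> R)
    (F : I -> pbt -> R) (G : J -> pbt -> R) z :
  succ_fun (fun x => \sum_(i <- r) c i * F i x) (fun y => \sum_(j <- s) d j * G j y) z =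
  \sum_(i <- r) \sum_(j <- s) c i * d j * succ_fun (F i) (G j) z.
Proof.
case: z => [|z1 z2] /=; last exact: star_fun_sums.
by rewrite big1 // => i _; rewrite big1 // => j _; rewrite mulr0.
Qed.

Lemma prelie_fun_sums (I J : Type) (r : seq I) (s : seq J) (c : I -> R) (d : J -> R)
    (F : I -> pbt -> R) (G : J -> pbt -> R) z :
  prelie_fun (fun x => \sum_(i <- r) c i * F i x) (fun y => \sum_(j <- s) d j * G j y) z =
  \sum_(i <- r) \sum_(j <- s) c i * d j * prelie_fun (F i) (G j) z.
Proof.
rewrite /prelie_fun succ_fun_sums prec_fun_sums exchange_big -sumrB; apply: eq_bigr => i _.
rewrite -sumrB; apply: eq_bigr => j _; by rewrite mulrBr (mulrC (d j)).
Qed.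

Lemma eq_prelie_fun f f' g g' z :
  (forall x, (inner x <= inner z)%N -> f x = f' x /\ g x = g' x) ->
    prelie_fun f g z = prelie_fun f' g' z.
Proof.
case: z => // z1 z2 h; rewrite /prelie_fun /=; congr (_ - _).
  apply: eq_star => -[x y] /inner_coproduct /= hxy.
  by have [|_ ->] := h x; [|have [|-> _] := h (Vee y z2)] => //=; lia.
apply: eq_star => -[x y] /inner_coproduct /= hxy.
by have [|_ ->] := h y; [|have [|-> _] := h (Vee z1 x)] => //=; lia.
Qed.

Lemma coefs_bilin (op : pbt -> pbt -> Dend1) u v z :
  coefs (bilin op u v) z =
  \sum_(x <- msupp u) \sum_(y <- msupp v) (u@_x)%:P * (v@_y)%:P * coefs (op x y) z.
Proof.
rewrite /coefs bilin_coef rmorph_sum; apply: eq_bigr => x _.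
by rewrite rmorph_sum; apply: eq_bigr => y _; rewrite !rmorphM.
Qed.

Lemma coefs_prec u v z : coefs (prec u v) z = prec_fun (coefs u) (coefs v) z.
Proof.
have -> : coefs u = fun x => \sum_(i <- msupp u) (u@_i)%:P * delta_tree i x.
  by apply/funext => x; exact: coefs_sum.
have -> : coefs v = fun x => \sum_(i <- msupp v) (v@_i)%:P * delta_tree i x.
  by apply/funext => x; exact: coefs_sum.
rewrite prec_fun_sums coefs_bilin; apply: eq_bigr => i _; apply: eq_bigr => j _.
by rewrite coefs_prec_tree.
Qed.

Lemma coefs_succ u v z : coefs (succ v u) z = succ_fun (coefs v) (coefs u) z.
Proof.
have -> : coefs u = fun x => \sum_(i <- msupp u) (u@_i)%:P * delta_tree i x.
  by apply/funext => x; exact: coefs_sum.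
have -> : coefs v = fun x => \sum_(i <- msupp v) (v@_i)%:P * delta_tree i x.
  by apply/funext => x; exact: coefs_sum.
rewrite succ_fun_sums coefs_bilin; apply: eq_bigr => i _; apply: eq_bigr => j _.
by rewrite coefs_succ_tree.
Qed.

(** The transfer from elements of Dend to functions on trees. *)
Lemma coefs_dend_prelie u v z :
  coefs (dend_prelie u v) z = prelie_fun (coefs u) (coefs v) z.
Proof. by rewrite /prelie_fun -coefs_prec -coefs_succ /coefs mcoeffB rmorphB. Qed.

(** * From sums over planar trees to sums over isomorphism classes *)

Lemma niso_neq0 t u : (niso t u != 0%N) = iso t u.
Proof.
rewrite -card_isos -lt0n; apply/card_gt0P/existsP => -[f hf]; exists f.
  by rewrite inE in hf.
by rewrite inE.
Qed.

Lemma aut_niso t : aut t = niso t t.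
Proof. exact: card_isos. Qed.

Lemma is_iso_comp s t u (f : {ffun vertex s -> vertex t})
  (g : {ffun vertex t -> vertex u}) :
  is_iso f -> is_iso g -> is_iso [ffun x => g (f x)].
Proof.
case/and4P=> /injectiveP fi /forallP fs /eqP fr /forallP fc.
case/and4P=> /injectiveP gi /forallP gs /eqP gr /forallP gc.
apply/and4P; split.
- by apply/injectiveP => x y; rewrite !ffunE => /gi/fi.
- apply/forallP => z; have /codomP[y ->] := gs z; have /codomP[x ->] := fs y.
  by apply/codomP; exists x; rewrite ffunE.
- by rewrite ffunE fr gr.
- apply/forallP => w; apply/forallP => v; rewrite !ffunE.
  have /forallP/(_ (f v))/eqP -> := gc (f w).
  by have /forallP/(_ v) := fc w.
Qed.

Lemma niso_compr t u u' : iso u u' -> niso t u = niso t u'.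
Proof.
have h v v' : iso v v' -> (niso t v <= niso t v')%N.
  case/existsP => g hg; have /and4P[/injectiveP gi _ _ _] := hg.
  rewrite -!card_isos.
  pose c (f : {ffun vertex t -> vertex v}) := [ffun x => g (f x)].
  rewrite -(card_imset _ (_ : injective c)); last first.
    by move=> f f' /ffunP e; apply/ffunP => x; apply: gi; have := e x; rewrite !ffunE.
  apply/subset_leq_card/fintype.subsetP => _ /imsetP[f hf ->]; rewrite !inE in hf *.
  exact: is_iso_comp.
by move=> e; apply/eqP; rewrite eqn_leq !h // iso_sym.
Qed.

Lemma niso_compl t t' u : iso t t' -> niso t u = niso t' u.
Proof.
have h v v' : iso v v' -> (niso v' u <= niso v u)%N.
  case/existsP => g hg; have /and4P[/injectiveP gi /forallP gs _ _] := hg.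
  rewrite -!card_isos.
  pose c (f : {ffun vertex v' -> vertex u}) := [ffun x => f (g x)].
  rewrite -(card_imset _ (_ : injective c)); last first.
    move=> f f' /ffunP e; apply/ffunP => y; have /codomP[x ->] := gs y.
    by have := e x; rewrite !ffunE.
  apply/subset_leq_card/fintype.subsetP => _ /imsetP[f hf ->]; rewrite !inE in hf *.
  exact: is_iso_comp.
by move=> e; apply/eqP; rewrite eqn_leq !h // iso_sym.
Qed.

Lemma rtree_of_eq s t : (rtree_of s == rtree_of t) = iso s t.
Proof. by rewrite /rtree_of eqmodE. Qed.

Lemma rtree_ofK (T : rtree) : rtree_of (repr T) = T.
Proof. exact: reprK. Qed.

Lemma iso_repr t : iso (repr (rtree_of t)) t.
Proof. by rewrite -rtree_of_eq rtree_ofK. Qed.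

Lemma rtree_eq (S T : rtree) : (S == T) = iso (repr S) (repr T).
Proof. by rewrite -rtree_of_eq !rtree_ofK. Qed.

Lemma iso_inv_repr V (a : ptree -> V) t : iso_inv a -> a (repr (rtree_of t)) = a t.
Proof. by move=> ha; apply: ha; rewrite niso_neq0 iso_repr. Qed.

Definition rsize (T : rtree) : nat := psize (repr T).

Lemma rsize_of t : rsize (rtree_of t) = psize t.
Proof. exact: iso_inv_repr psize_inv. Qed.

(** Finite enumerations; only the finiteness of the set of trees of a given size
matters. *)
Fixpoint seqs_upto (T : Type) (k : nat) (L : seq T) : seq (seq T) :=
  if k is k'.+1 then [::] :: [seq x :: l | x <- L, l <- seqs_upto k' L] else [:: [::]].

Fixpoint ptrees_upto (n : nat) : seq ptree :=
  if n is n'.+1 then map PNode (seqs_upto n' (ptrees_upto n')) else [::].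

Lemma mem_seqs_upto (T : eqType) k (L l : seq T) :
  (size l <= k)%N -> {subset l <= L} -> l \in seqs_upto k L.
Proof.
elim: k l => [|k IH] [|x l] //= hl hs; rewrite inE; apply/orP; right.
apply: allpairs_f; first by apply: hs; rewrite mem_head.
by apply: IH => // y hy; apply: hs; rewrite inE hy orbT.
Qed.

Lemma mem_ptrees_upto n t : (psize t <= n)%N -> t \in ptrees_upto n.
Proof.
elim: n t => [|n IH] t; first by have := psize_gt0 t; case: psize.
case: t => s; rewrite psize_PNode ltnS => hs; apply: map_f; apply: mem_seqs_upto.
  apply: leq_trans hs; rewrite -sum1_size; apply: leq_sum => x _; exact: psize_gt0.
move=> x hx; apply: IH; apply: leq_trans hs.
by rewrite (perm_big _ (perm_to_rem hx)) big_cons leq_addr.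
Qed.

Definition rtrees_upto (n : nat) : seq rtree :=
  undup [seq rtree_of t | t <- ptrees_upto n & (psize t <= n)%N].

Lemma uniq_rtrees_upto n : uniq (rtrees_upto n).
Proof. exact: undup_uniq. Qed.

Lemma mem_rtrees_upto n T : (T \in rtrees_upto n) = (rsize T <= n)%N.
Proof.
rewrite mem_undup; apply/mapP/idP => [[t]|hT].
  by rewrite mem_filter => /andP[ht _] ->; rewrite rsize_of.
by exists (repr T); rewrite ?rtree_ofK // mem_filter hT mem_ptrees_upto.
Qed.

Definition inv_aut (T : rtree) : R := (((aut (repr T))%:R^-1 : rat)%:P)%:P.

(** The coefficient a(T) / aut(T) of a class, with values in R. *)
Definition class_coef (a : ptree -> R) (T : rtree) : R := inv_aut T * a (repr T).

Lemma aut_gt0 t : (0 < aut t)%N.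
Proof. by rewrite lt0n aut_niso niso_neq0 iso_refl. Qed.

Lemma inv_autK T : inv_aut T * (niso (repr T) (repr T))%:R = 1.
Proof.
rewrite /inv_aut -aut_niso -!polyC_natr -!polyCM mulVf // Num.Theory.pnatr_eq0 -lt0n.
exact: aut_gt0.
Qed.

(** Only the class of U contributes, with niso T U = aut T. *)
Lemma class_sum a U n : iso_inv a -> (psize U <= n)%N ->
  \sum_(T <- rtrees_upto n) class_coef a T * (niso (repr T) U)%:R = a U.
Proof.
move=> ha hU; have hT : rtree_of U \in rtrees_upto n by rewrite mem_rtrees_upto rsize_of.
rewrite (bigD1_seq _ hT (uniq_rtrees_upto n)) /= big1 ?addr0.
  rewrite -(niso_compr _ (iso_repr U)) /class_coef mulrAC inv_autK mul1r.
  exact: iso_inv_repr.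
move=> T hne; case: (niso (repr T) U =P 0%N) => [->|/eqP]; first by rewrite mulr0.
rewrite niso_neq0 => h; case/eqP: hne.
by rewrite -(rtree_ofK T); apply/eqP; rewrite rtree_of_eq.
Qed.

Lemma sum_vertexE t (M : nmodType) (F : seq nat -> M) :
  \sum_(v : vertex t) F (ssval v) = \sum_(v <- vertices t) F v.
Proof. exact: (@sum_vertex t M xpredT F). Qed.

(** niso g (repr U) is aut U if g is in the class U, and 0 otherwise. *)
Lemma class_indicator g (U : rtree) :
  (rtree_of g == U)%:R * (niso (repr U) (repr U))%:R = (niso g (repr U))%:R :> Qb.
Proof.
rewrite -[in X in X * _](rtree_ofK U) rtree_of_eq -niso_neq0.
case: (niso g (repr U) =P 0%N) => [->|/eqP]; first by rewrite mul0r.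
by rewrite niso_neq0 => h; rewrite (niso_compl _ h) mul1r.
Qed.

Lemma graft_rtree_coef S T (U : rtree) :
  (graft_rtree S T)@_U * (niso (repr U) (repr U))%:R =
  (\sum_(v <- vertices (repr S)) niso (graft v (repr S) (repr T)) (repr U))%:R.
Proof.
rewrite (raddf_sum (mcoeff U)) natr_sum -sum_vertexE mulr_suml; apply: eq_bigr => v _.
by rewrite /= coefU1 class_indicator.
Qed.

(** graft_cuts summed against a(S) / aut S and c(T) / aut T.  The right-hand side
depends on the class of U only, which is not visible on cuts. *)
Lemma cut_conv_graft a c U n : iso_inv a -> iso_inv c -> (psize U <= n)%N ->
  cut_conv a c U = \sum_(S <- rtrees_upto n) \sum_(T <- rtrees_upto n)
    class_coef a S * class_coef c T *
      (\sum_(v <- vertices (repr S)) niso (graft v (repr S) (repr T)) U)%:R.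
Proof.
move=> ha hc hU; rewrite /cut_conv.
under [RHS]eq_bigr => S _ do under eq_bigr => T _ do
  rewrite graft_cuts natr_sum mulr_sumr.
under [RHS]eq_bigr => S _ do rewrite exchange_big.
rewrite [RHS]exchange_big /= big_seq [RHS]big_seq; apply: eq_bigr => p /mem_cuts_size hp.
rewrite -(@class_sum a p.1 n) //; last by move: hp hU; lia.
rewrite -(@class_sum c p.2 n) //; last by move: hp hU; lia.
rewrite mulr_suml; apply: eq_bigr => S _; rewrite mulr_sumr; apply: eq_bigr => T _.
by rewrite natrM mulrACA.
Qed.

Lemma cut_conv_inv a c : iso_inv a -> iso_inv c -> iso_inv (cut_conv a c).
Proof.
move=> ha hc t u h; have e := psize_inv h.
rewrite (@cut_conv_graft a c t (psize t)) // (@cut_conv_graft a c u (psize t)) ?e //.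
apply: eq_bigr => S _; apply: eq_bigr => T _; congr (_ * _%:R).
by apply: eq_bigr => v _; apply: niso_compr; rewrite -niso_neq0.
Qed.

(** cut_conv preserves invariance, but g occurs in its own recursion: it is first
truncated to sizes where invariance is known. *)
Lemma logder_gf_inv : iso_inv logder_gf.
Proof.
move=> t u; have [n] := ubnP (psize t); elim: n t u => // n IH t u hn h.
have e := psize_inv h.
pose gp' x := if (psize x < n)%N then logder_gf x else 0.
have gp'_inv : iso_inv gp'.
  move=> x y hxy; rewrite /gp' -(psize_inv hxy); case: ifP => // hx.
  exact: IH.
have hE x : psize x = psize t ->
  logder_gf x = (psize x)%:R * pos_gf x - cut_conv pos_gf gp' x.
  move=> hx; rewrite pos_gf_leibniz
    (_ : cut_conv pos_gf gp' x = cut_conv pos_gf logder_gf x) ?addrK //.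
  apply: eq_cut_conv => p /mem_cuts_size hp; rewrite /gp' ifT //.
  by have := psize_gt0 p.1; move: hp hx hn; lia.
by rewrite !hE // -e (pos_gf_inv h) (cut_conv_inv pos_gf_inv gp'_inv h).
Qed.

Lemma class_coef_cut_conv a c U n : iso_inv a -> iso_inv c -> (rsize U <= n)%N ->
  class_coef (cut_conv a c) U = \sum_(S <- rtrees_upto n) \sum_(T <- rtrees_upto n)
    class_coef a S * class_coef c T * ((graft_rtree S T)@_U)%:P.
Proof.
move=> ha hc hU; rewrite /class_coef (@cut_conv_graft a c _ n) // mulr_sumr.
apply: eq_bigr => S _; rewrite mulr_sumr; apply: eq_bigr => T _; rewrite mulrCA.
congr (_ * _).
rewrite -[LHS]/(inv_aut U * _) -(rmorph_nat (polyC : {rmorphism Qb -> R}))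
  -graft_rtree_coef.
by rewrite rmorphM rmorph_nat /= mulrCA inv_autK mulr1.
Qed.

(** Grafting is compatible with isomorphisms: by graft_cuts, the coefficients depend on
the classes of s and t only. *)
Lemma graft_rtree_of s t : graft_rtree (rtree_of s) (rtree_of t) =
  \sum_(v <- vertices s) << rtree_of (graft v s t) >>.
Proof.
apply/malgP => U; apply: (@mulIf _ ((niso (repr U) (repr U))%:R : Qb)).
  by rewrite -polyC_natr polyC_eq0 Num.Theory.pnatr_eq0 niso_neq0 iso_refl.
rewrite graft_rtree_coef graft_cuts (raddf_sum (mcoeff U)) mulr_suml.
under eq_bigr => p _ do rewrite (niso_compl _ (iso_repr s)) (niso_compl _ (iso_repr t)).
rewrite -graft_cuts natr_sum; apply: eq_bigr => v _ /=.
by rewrite coefU1 class_indicator.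
Qed.

Lemma psize_graft v s t : v \in vertices s -> psize (graft v s t) = (psize s + psize t)%N.
Proof.
elim: v s => [|i v IH] [s] /=.
  by move=> _; rewrite map_rcons sumn_rcons.
rewrite -[_ :: flatten _]/(vertices (PNode s)) mem_vertices_cons => /andP[hi hv].
rewrite -!/(psize (PNode _)) !psize_PNode.
rewrite (perm_big _ (perm_set_nth (PNode [::]) (PNode s) _ hi)) big_cons.
rewrite (perm_big _ (perm_to_rem (mem_nth (PNode [::]) hi))) big_cons.
rewrite (set_nth_default (PNode [::])) // IH //. rewrite /= addSn; congr _.+1;
  exact: addnAC.
Qed.

Section Morphism.
Variable phi : {linear PreLie -> Dend1}.
Hypothesis phi_morph : prelie_morphism phi.
Hypothesis phi_bullet : phi << bullet >> = << Ytree >>.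

Lemma phi_graft S T : phi (graft_rtree S T) = dend_prelie (phi << S >>) (phi << T >>).
Proof. by rewrite -phi_morph /prelie bilinU. Qed.

(** The tree with branches s and u is the pre-Lie product of PNode s and u minus
graftings of u inside the branches of s; these have the same size but fewer
branches at the root. *)
Lemma phi_homog t z : inner z != psize t -> (phi << rtree_of t >>)@_z = 0.
Proof.
have [n] := ubnP (psize t); elim: n t z => // n IHn [s].
(* Inner induction on the number of branches at the root. *)
have [k] := ubnP (size s); elim: k s => // k IHk s hk z hn hz.
case/lastP: s hk hn hz => [|s u] hk hn hz.
  rewrite phi_bullet coefU1; case: eqP => // e; case/eqP: hz; by rewrite -e.
have hsz : psize (PNode (rcons s u)) = (psize (PNode s) + psize u)%N.
  exact: (@psize_graft [::] (PNode s) u (mem_vertices_nil _)).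
have [hs hu] : (psize (PNode s) < n)%N /\ (psize u < n)%N.
  by have := psize_gt0 u; have := psize_gt0 (PNode s); move: hn hsz; lia.
have E : << rtree_of (PNode (rcons s u)) >> =
    graft_rtree (rtree_of (PNode s)) (rtree_of u) -
    \sum_(v <- behead (vertices (PNode s))) << rtree_of (graft v (PNode s) u) >> :> PreLie.
  by rewrite graft_rtree_of vertices_PNode big_cons /= addrK.
rewrite E linearB mcoeffB phi_graft linear_sum (raddf_sum (mcoeff z)).
rewrite big_seq big1 ?subr0 => [|v hv].
  apply/eqP; rewrite -polyC_eq0; apply/eqP; rewrite -[LHS]/(coefs _ z) coefs_dend_prelie.
  have hom c x : (psize c < n)%N -> inner x != psize c ->
    coefs (phi << rtree_of c >>) x = 0.
    by move=> hc hx; rewrite /coefs IHn.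
  case: z hz => [_|z1 z2 hz]; rewrite /prelie_fun /= ?subrr //.
  rewrite /star_fun big_seq big1 ?[X in _ - X]big_seq ?[X in _ - X]big1 ?subrr //.
    move=> -[x y] /inner_coproduct /= hxy.
    case: (inner (Vee z1 x) =P psize (PNode s)) => [e|/eqP e]; last by rewrite hom ?mul0r.
    rewrite [X in _ * X]hom ?mulr0 //; apply: contraNneq hz => e'.
    by rewrite hsz -e -e' /= -hxy; apply/eqP; lia.
  move=> -[x y] /inner_coproduct /= hxy.
  case: (inner (Vee y z2) =P psize (PNode s)) => [e|/eqP e];
    last by rewrite [X in _ * X]hom ?mulr0.
  rewrite hom ?mul0r //; apply: contraNneq hz => e'.
  by rewrite hsz -e -e' /= -hxy; apply/eqP; lia.
have hv' : v \in vertices (PNode s) by apply: mem_behead.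
have hg := psize_graft u hv'; rewrite -hsz in hg.
case: v hv hv' hg => [|i v].
  by have := uniq_vertices (PNode s); rewrite vertices_PNode /= => /andP[/negP h _] /h.
move=> _; rewrite mem_vertices_cons => /andP[hi _] /= hg.
apply: IHk; rewrite ?[psize _]hg //.
by rewrite size_set_nth (maxn_idPr hi); move: hk; rewrite size_rcons.
Qed.

Lemma phi_homog_rtree T z : inner z != rsize T -> (phi << T >>)@_z = 0.
Proof. by move=> h; rewrite -(rtree_ofK T) phi_homog. Qed.

Lemma phi_coef (u : PreLie) z n : (inner z <= n)%N ->
  (phi u)@_z = \sum_(T <- rtrees_upto n) u@_T * (phi << T >>)@_z.
Proof.
move=> hz; rewrite {1}(malg_sum u) linear_sum (raddf_sum (mcoeff z)) /=.
rewrite -(@sum_msupp_wide _ u (fun T => (phi << T >>)@_z) (rtrees_upto n)).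
- by apply: eq_bigr => T _; rewrite linearZ mcoeffZ.
- exact: uniq_rtrees_upto.
move=> T; rewrite mem_rtrees_upto => hT; apply: phi_homog_rtree.
by apply: contraNneq hT => <-.
Qed.

(** The image by phi of the series of the a(T) T / aut(T).  By homogeneity, trees of
size inner z suffice. *)
Definition phihat (a : ptree -> R) (z : pbt) : R :=
  \sum_(T <- rtrees_upto (inner z)) class_coef a T * coefs (phi << T >>) z.

(** Enlarging the range of the sum adds trees of the wrong degree. *)
Lemma phihatE a z n : (inner z <= n)%N ->
  phihat a z = \sum_(T <- rtrees_upto n) class_coef a T * coefs (phi << T >>) z.
Proof.
move=> hz; rewrite [RHS](bigID (fun T => rsize T <= inner z)%N) /= [X in _ + X]big1 ?addr0.
  rewrite -big_filter; apply: perm_big; apply: uniq_perm.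
  - exact: uniq_rtrees_upto.
  - by rewrite filter_uniq ?uniq_rtrees_upto.
  move=> T; rewrite mem_filter !mem_rtrees_upto.
  by case: leqP => //= h; rewrite (leq_trans h).
by move=> T hT; rewrite /coefs phi_homog_rtree ?mulr0 //; apply: contraNneq hT => ->.
Qed.

(** phi is a morphism on finite sums; the bound n = inner z covers every term that
contributes to z. *)
Lemma phihat_cut_conv a c z :
  iso_inv a -> iso_inv c -> phihat (cut_conv a c) z = prelie_fun (phihat a) (phihat c) z.
Proof.
move=> ha hc; set n := inner z; rewrite (@phihatE _ _ n) //.
rewrite (@eq_prelie_fun _
  (fun x => \sum_(T <- rtrees_upto n) class_coef a T * coefs (phi << T >>) x)
   _ (fun x => \sum_(T <- rtrees_upto n) class_coef c T * coefs (phi << T >>) x));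
     last first.
  by move=> x hx; rewrite -!phihatE.
rewrite prelie_fun_sums big_seq.
under eq_bigr => U hU do
  rewrite (@class_coef_cut_conv a c U n ha hc) -?mem_rtrees_upto // mulr_suml.
rewrite -big_seq exchange_big /=; apply: eq_bigr => S _.
under eq_bigr => U _ do rewrite mulr_suml.
rewrite exchange_big /=; apply: eq_bigr => T _.
rewrite -coefs_dend_prelie -phi_graft /coefs (phi_coef _ (leqnn n)) rmorph_sum mulr_sumr.
by apply: eq_bigr => U _; rewrite -mulrA -polyCM.
Qed.
End Morphism.

(** * The series NTP on words *)

Lemma wmul_nil f g : wmul f g [::] = f [::] * g [::].
Proof. by rewrite /wmul big_ord1. Qed.

Lemma wmul_cons f g x w :
  wmul f g (x :: w) = f [::] * g (x :: w) + wmul (fun u => f (x :: u)) g w.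
Proof. by rewrite /wmul big_ord_recl. Qed.

Lemma wmulDl f f' g w : wmul (fun u => f u + f' u) g w = wmul f g w + wmul f' g w.
Proof. by rewrite /wmul -big_split; apply: eq_bigr => i _; rewrite /= mulrDl. Qed.

Lemma wmulZl c f g w : wmul (fun u => c * f u) g w = c * wmul f g w.
Proof. by rewrite /wmul mulr_sumr; apply: eq_bigr => i _; rewrite mulrA. Qed.

Lemma wmulDr f g g' w : wmul f (fun u => g u + g' u) w = wmul f g w + wmul f g' w.
Proof. by rewrite /wmul -big_split; apply: eq_bigr => i _; rewrite /= mulrDr. Qed.

Lemma wmulZr c f g w : wmul f (fun u => c * g u) w = c * wmul f g w.
Proof. by rewrite /wmul mulr_sumr; apply: eq_bigr => i _; rewrite mulrCA. Qed.

Lemma eq_wmul f f' g g' w : f =1 f' -> g =1 g' -> wmul f g w = wmul f' g' w.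
Proof. by move=> hf hg; apply: eq_bigr => i _; rewrite hf hg. Qed.

Lemma wmulA f g h w : wmul (wmul f g) h w = wmul f (wmul g h) w.
Proof.
elim: w f g h => [|x w IH] f g h; first by rewrite !wmul_nil mulrA.
rewrite !wmul_cons wmul_nil mulrDr mulrA -addrA; congr (_ + _).
rewrite -IH -wmulZl -wmulDl; apply: eq_wmul => // u; exact: wmul_cons.
Qed.

Lemma wmul_unit g w : wmul (single [::] 1) g w = g w.
Proof.
case: w => [|x w]; first by rewrite wmul_nil /single eqxx mul1r.
rewrite wmul_cons {1}/single eqxx mul1r /wmul big1 ?addr0 // => i _.
by rewrite /single mul0r.
Qed.

(** The series of the c_k a^k. *)
Definition pow_series (a : letter) (c : nat -> Qb) : fseries word :=
  fun w => (w == nseq (size w) a)%:R * c (size w).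

Lemma wsum_pow a (c : nat -> Qb) (c' : nat -> Qb) : c' 0%N = 0 ->
  (forall k, (0 < k)%N -> c k = c' k) ->
  wsum [set k | (0 < k)%N]%classic (fun k => single (nseq k a) (c k)) =1 pow_series a c'.
Proof.
move=> c0 hc w; rewrite /wsum /pow_series /single.
have hne k : w = nseq k a -> k = size w by move=> ->; rewrite size_nseq.
case: (posnP (size w)) => hw.
  rewrite hw c0 mulr0 fsbig1 // => k /= hk; case: eqP => // /hne; rewrite hw => e.
  by rewrite e in hk.
rewrite (fsbigE [:: size w]) //.
- rewrite big_mkcond big_seq1 mem_set //=.
  by case: eqP; rewrite ?mul1r ?mul0r // hc.
- by move=> k /=; rewrite inE => /eqP ->.
- by move=> k /= _; rewrite inE => hk; case: eqP => // /hne e; rewrite e eqxx in hk.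
Qed.

Lemma Pser_pow : Pser =1 pow_series lp Pcoef.
Proof. by apply: wsum_pow => // -[|k] // _; rewrite ca_chain_const. Qed.

Lemma Nser_pow : Nser =1 pow_series lm Ncoef.
Proof. by apply: wsum_pow => [|[|k] // _]; rewrite ?ca_chain_const // /Ncoef mulr0. Qed.

(** As g vanishes on the words starting with a, only the longest prefix of a's can be
cut off. *)
Lemma wmul_pow a c g i v : (forall u, g (a :: u) = 0) -> head (~~ a) v = ~~ a ->
  wmul (pow_series a c) g (nseq i a ++ v) = c i * g v.
Proof.
move=> hg hv; elim: i c => [|i IH] c /=.
  case: v hv => [|x v] /= hv; first by rewrite wmul_nil /pow_series eqxx mul1r.
  rewrite wmul_cons {1}/pow_series eqxx mul1r /wmul big1 ?addr0 // => k _.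
  by rewrite /pow_series /= eqseq_cons hv; case: (a); rewrite !mul0r.
rewrite wmul_cons hg mulr0 add0r -(IH (fun k => c k.+1)); apply: eq_wmul => // u.
by rewrite /pow_series /= eqseq_cons eqxx.
Qed.

(** P N has no constant term, so its k-th power has no word shorter than k. *)
Lemma Tser_wide n w : (size w < n)%N ->
  Tser w = \sum_(k < n) 'X^k * wpow (wmul Pser Nser) k w.
Proof.
have h0 : wmul Pser Nser [::] = 0 by rewrite wmul_nil Pser_pow /pow_series /= !mulr0 mul0r.
have hpow k u : (size u < k)%N -> wpow (wmul Pser Nser) k u = 0.
  elim: k u => // k IH u hu; apply: big1 => -[[|i] hi] _; first by rewrite take0 h0 mul0r.
  rewrite [X in _ * X](_ : _ = 0) ?mulr0 //; apply: IH; rewrite size_drop; move: hi hu;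
    rewrite /= ; lia.
move=> hw; rewrite /Tser /wsum (fsbigE (iota 0 n)) ?iota_uniq //.
  rewrite -(big_mkord xpredT (fun k => 'X^k * wpow (wmul Pser Nser) k w)) /index_iota subn0.
  by apply: eq_bigl => k; rewrite in_setT.
move=> k _; rewrite mem_iota /= add0n -leqNgt => hk.
by rewrite hpow ?mulr0 // (leq_trans hw).
Qed.

(** The equation T = 1 + b P N T. *)
Lemma Tser_rec w : Tser w = single [::] 1 w + 'X * wmul (wmul Pser Nser) Tser w.
Proof.
rewrite (@Tser_wide (size w).+2) // big_ord_recl expr0 mul1r; congr (_ + _).
rewrite [in RHS]/wmul mulr_sumr.
under [RHS]eq_bigr => i _ do rewrite (@Tser_wide (size w).+1) ?size_drop ?ltnS ?leq_subr
  // mulr_sumr mulr_sumr.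
rewrite exchange_big; apply: eq_bigr => k _.
rewrite lift0 exprS -mulrA
  -[wpow _ _.+1 _]/(wmul (wmul Pser Nser) (wpow (wmul Pser Nser) k) w).
rewrite -wmulZr {1}/wmul mulr_sumr; apply: eq_bigr => i _.
by [].
Qed.

(** By the equation of T, NTP = N P A0 with A0 = 1 + b NTP.  The words of N and P being
powers of one letter, this reads off the first block of a word. *)
Lemma NTP_block_series w :
  last lm (lm :: w) = lp -> (NTP (lm :: w))%:P = block_series polP (lm :: w).
Proof.
pose A0 := (fun u => single [::] 1 u + 'X * NTP u) : fseries word.
have TP u : wmul Tser Pser u = wmul (pow_series lp Pcoef) A0 u.
  rewrite (@eq_wmul _ (fun u => single [::] 1 u + 'X * wmul (wmul Pser Nser) Tser u) Pser
    Pser) //;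
    last exact: Tser_rec.
  rewrite wmulDl wmulZl wmul_unit wmulDr wmulZr; congr (_ + 'X * _).
    rewrite Pser_pow; elim: u (Pcoef) => [|x u IH] c.
      by rewrite wmul_nil /single eqxx mulr1.
    rewrite wmul_cons /single /= mulr0 add0r.
    have [hx|hx] := eqVneq x lp; last first.
      rewrite /pow_series /= eqseq_cons (negPf hx) mul0r /wmul big1 // => i _.
      by rewrite eqseq_cons (negPf hx) !mul0r.
    have := IH (fun k => c k.+1); rewrite /pow_series hx /= eqseq_cons eqxx /= => ->.
    by apply: eq_wmul => // v; rewrite eqseq_cons eqxx.
  rewrite !wmulA (@eq_wmul _ (pow_series lp Pcoef) _ NTP) //; last first.
    by move=> v; rewrite /NTP wmulA.
  exact: Pser_pow.
have NE u : NTP u = wmul (pow_series lm Ncoef) (wmul (pow_series lp Pcoef) A0) u.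
  rewrite /NTP wmulA; apply: eq_wmul; [exact: Nser_pow | exact: TP].
have Q_lm u : wmul (pow_series lp Pcoef) A0 (lm :: u) = 0.
  rewrite wmul_cons {1}/pow_series /= mulr0 mul0r add0r /wmul big1 // => i _.
  by rewrite /pow_series /= ?eqseq_cons !mul0r.
have N_lp u : NTP (lp :: u) = 0.
  rewrite NE wmul_cons {1}/pow_series /Ncoef /= !mulr0 mul0r add0r /wmul big1 // => i _.
  by rewrite /pow_series /= ?eqseq_cons !mul0r.
have A_lp u : A0 (lp :: u) = 0 by rewrite /A0 N_lp mulr0 /single addr0.
(* A0 vanishes on the words starting with p, and P A0 on those starting with m. *)
have block i j v : head lm v = lm ->
    NTP (nseq i lm ++ nseq j.+1 lp ++ v) = Ncoef i * (Pcoef j.+1 * A0 v).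
  move=> hv; rewrite NE wmul_pow //; congr (_ * _).
  exact: wmul_pow.
move: w; apply: (word_block_ind (P := fun W => (NTP W)%:P = block_series polP W)).
  move=> i j; rewrite block_series_block -[X in NTP X]cats0 -catA block //.
  rewrite /A0 /single eqxx NE wmul_nil /pow_series /= /Ncoef !mulr0 !mul0r mulr0 addr0
    mulr1.
  by rewrite rmorphM.
move=> i j V hV IH; rewrite block_series_cat ?block_series_block -?IH;
  last by rewrite last_cat /=; elim: (j).
rewrite -catA block // /A0 /single add0r /polN /polP /b -!polyCM; congr (_%:P); ring.
Qed.

(** * The equation defining F and the images in Dend *)

(** The tree T with a new root below its root; these are the trees occurring in
pre-Lie products of bullet. *)
Definition Bplus (T : rtree) : rtree := rtree_of (PNode [:: repr T]).

Lemma niso_PNode1 x y : niso (PNode [:: x]) (PNode [:: y]) = niso x y.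
Proof. by rewrite /= big_seq1 /= eqxx muln1. Qed.

Lemma Bplus_inj : injective Bplus.
Proof.
move=> S T /eqP; rewrite rtree_of_eq -niso_neq0 niso_PNode1 niso_neq0 -rtree_eq.
by move/eqP.
Qed.

Lemma graft_bullet T : graft_rtree bullet T = << Bplus T >>.
Proof. by rewrite -{1}(rtree_ofK T) graft_rtree_of big_seq1. Qed.

Lemma prelie_bullet_Bplus G T : prelie_series (single bullet 1) G (Bplus T) = G T.
Proof.
rewrite /prelie_series /bilin_series (fsbigE [:: (bullet, T)]) //.
  by rewrite big_mkcond big_seq1 in_setT /= /single eqxx mul1r graft_bullet coefU1 eqxx
    mulr1.
move=> [S T'] _; rewrite inE /= /single => h; case: eqP => [e|_]; last by rewrite !mul0r.
rewrite e graft_bullet coefU1; case: eqP => [/Bplus_inj e'|_]; last by rewrite mulr0.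
by rewrite e e' eqxx in h.
Qed.

Lemma prelie_bullet0 G z :
  (forall T, z <> Bplus T) -> prelie_series (single bullet 1) G z = 0.
Proof.
move=> hz; rewrite /prelie_series /bilin_series fsbig1 // => -[S T] _ /=.
rewrite /single; case: eqP => [->|_]; last by rewrite !mul0r.
rewrite graft_bullet coefU1; case: eqP => [e|_]; last by rewrite mulr0.
by case: (hz T).
Qed.

(** The series of the connected flows of rate 1 at the root. *)
Definition Fflow : fseries rtree :=
  fun T => ((aut (repr T))%:R^-1 : rat) *: flow_gf 1 (repr T) 1.

(** The generating polynomials of the closed connected flows and, next, of the connected
flows of rate 1, as constants of R. *)
Definition closed_fun (t : ptree) : R := ((tree_gf t)`_0)%:P.
Definition rate1_fun (t : ptree) : R := ((pos_gf t)`_1)%:P.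

Lemma closed_fun_inv : iso_inv closed_fun.
Proof. by move=> t u h; rewrite /closed_fun /tree_gf (branches_gf_inv h). Qed.

Lemma rate1_fun_inv : iso_inv rate1_fun.
Proof. by move=> t u h; rewrite /rate1_fun (pos_gf_inv h). Qed.

Lemma class_coefC (c : ptree -> Qb) T :
  class_coef (fun t => (c t)%:P) T = (((aut (repr T))%:R^-1 : rat) *: c (repr T))%:P.
Proof. by rewrite /class_coef /inv_aut -polyCM mul_polyC. Qed.

Lemma Ec_class_coef T : (Ec T)%:P = class_coef closed_fun T.
Proof. by rewrite /closed_fun (class_coefC (fun t => (tree_gf t)`_0)) /Ec
  closed_connected_flows_gf flow_gf_rate0. Qed.

Lemma Fflow_class_coef T : (Fflow T)%:P = class_coef rate1_fun T.
Proof. by rewrite /rate1_fun (class_coefC (fun t => (pos_gf t)`_1)) /Fflow flow_gf_rate1.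
  Qed.

Lemma Ec_bullet : Ec bullet = 1.
Proof.
apply: polyC_inj; rewrite Ec_class_coef /class_coef.
have h : niso (repr bullet) (PNode [::]) != 0%N by rewrite niso_neq0 iso_repr.
have e : repr bullet = PNode [::].
  by case: (repr bullet) h => -[|x s] //=; rewrite big_nil.
by rewrite /inv_aut aut_niso e /= /closed_fun tree_gf_coef0 invr1 !polyC1 mulr1.
Qed.

(** T and B+(T) have the same number of automorphisms. *)
Lemma Ec_Bplus T : Ec (Bplus T) = 'X * Fflow T.
Proof.
apply: polyC_inj; rewrite polyCM Ec_class_coef Fflow_class_coef /class_coef.
have h := iso_repr (PNode [:: repr T]).
rewrite (iso_inv_repr _ closed_fun_inv) /inv_aut !aut_niso (niso_compl _ h)
  (niso_compr _ h) niso_PNode1.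
by rewrite /closed_fun tree_gf_coef0 polyCM mulrCA.
Qed.

Lemma Ec_other z : z <> bullet -> (forall T, z <> Bplus T) -> Ec z = 0.
Proof.
move=> hb hB; apply: polyC_inj; rewrite Ec_class_coef /class_coef /closed_fun tree_gf_coef0.
have ez := rtree_ofK z; case: (repr z) ez => -[|x [|y s]] ez; last by rewrite mulr0.
  by case: hb.
case: (hB (rtree_of x)); rewrite -ez; apply/eqP.
by rewrite rtree_of_eq -niso_neq0 niso_PNode1 niso_neq0 iso_sym iso_repr.
Qed.

Lemma bullet_Bplus T : bullet <> Bplus T.
Proof. by move/eqP; rewrite rtree_of_eq -niso_neq0. Qed.

(** The coefficient of B+(T) in the equation is b times that of T in F; no other tree but
bullet carries a closed connected flow. *)
Lemma Fflow_unique : unique (fun G => Ec = single bullet 1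
                          \+ 'X \*o prelie_series (single bullet 1) G) Fflow.
Proof.
split.
  apply/funext => z /=; rewrite /single.
  have [->|hz] := eqVneq z bullet.
    by rewrite Ec_bullet prelie_bullet0 ?mulr0 ?addr0 //; exact: bullet_Bplus.
  have [[T ->]|hB] := pselect (exists T, z = Bplus T).
    by rewrite add0r prelie_bullet_Bplus Ec_Bplus.
  have hB' T : z <> Bplus T by move=> e; apply: hB; exists T.
  by rewrite prelie_bullet0 // Ec_other ?mulr0 ?addr0 //; apply/eqP.
move=> G hG; apply/funext => T.
have := congr1 (fun f => f (Bplus T)) hG; rewrite /= Ec_Bplus prelie_bullet_Bplus /single.
case: eqP => [e|_]; first by case: (@bullet_Bplus T).
rewrite add0r => /eqP; rewrite -subr_eq0 -mulrBr mulf_eq0 polyX_eq0 subr_eq0.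
by move/eqP.
Qed.

Section Image.
Variable phi : {linear PreLie -> Dend1}.
Hypothesis phi_morph : prelie_morphism phi.
Hypothesis phi_bullet : phi << bullet >> = << Ytree >>.
Notation phihat := (phihat phi).
Let homogr := phi_homog_rtree phi_morph phi_bullet.

Lemma lin_series_phihat (f : fseries rtree) a z : (forall T, (f T)%:P = class_coef a T) ->
  (lin_series phi f z)%:P = phihat a z.
Proof.
move=> hf; rewrite /lin_series (fsbigE (rtrees_upto (inner z))) ?uniq_rtrees_upto //.
  rewrite big_mkcond rmorph_sum; apply: eq_bigr => T _.
  by rewrite in_setT rmorphM /= hf.
move=> T _; rewrite mem_rtrees_upto => hT; rewrite homogr ?mulr0 //.
by apply: contraNneq hT => <-.
Qed.

Lemma phihatD a a' z : phihat (fun t => a t + a' t) z = phihat a z + phihat a' z.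
Proof.
rewrite /phihat -big_split; apply: eq_bigr => T _.
by rewrite /class_coef /= mulrDr mulrDl.
Qed.

Lemma phihatB a a' z : phihat (fun t => a t - a' t) z = phihat a z - phihat a' z.
Proof.
rewrite /phihat -sumrB; apply: eq_bigr => T _.
by rewrite /class_coef /= mulrBr mulrBl.
Qed.

Lemma phihatZ (c : R) a z : phihat (fun t => c * a t) z = c * phihat a z.
Proof. by rewrite /phihat mulr_sumr; apply: eq_bigr => T _; rewrite /class_coef; ring. Qed.

Lemma eq_phihat a a' z : (forall t, a t = a' t) -> phihat a z = phihat a' z.
Proof. by move=> h; apply: eq_bigr => T _; rewrite /class_coef h. Qed.

Lemma deg_der_phihat a z : deg_der (phihat a) z = phihat (fun t => (psize t)%:R * a t) z.
Proof.
rewrite /deg_der /phihat mulr_sumr; apply: eq_bigr => T _; rewrite /class_coef.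
have [e|ne] := eqVneq (inner z) (rsize T); first by rewrite e /rsize; ring.
by rewrite /coefs homogr // !mulr0.
Qed.

Definition dot (t : ptree) : R := (is_dot t)%:R.

Lemma dot_inv : iso_inv dot.
Proof. by case=> -[|x s] [[|y us]] //=; rewrite ?big_nil. Qed.

Lemma phihat_dot z : phihat dot z = deltaY z.
Proof.
rewrite (@phihatE _ phi_morph phi_bullet _ z (inner z).+1) //.
have hb : bullet \in rtrees_upto (inner z).+1 by rewrite mem_rtrees_upto rsize_of.
rewrite (bigD1_seq _ hb (uniq_rtrees_upto _)) /= big1 ?addr0 => [|T hT].
  have := @inv_autK bullet; rewrite /class_coef (iso_inv_repr _ dot_inv) mulr1.
  rewrite (niso_compl _ (iso_repr _)) (niso_compr _ (iso_repr _)) /= mulr1 => ->.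
  by rewrite mul1r /coefs phi_bullet coefU1 rmorph_nat /deltaY eq_sym.
rewrite /class_coef (_ : dot (repr T) = 0) ?mulr0 ?mul0r // /dot.
have := rtree_ofK T; case: (repr T) => -[|x s] // e.
by rewrite -e eqxx in hT.
Qed.

Lemma phihat_Leaf a : phihat a Leaf = 0.
Proof. by rewrite /phihat big_nil. Qed.

Lemma phihat_Ytree : phihat branches_gf Ytree = 1.
Proof.
have <- : phihat dot Ytree = 1 by rewrite phihat_dot /deltaY eqxx.
rewrite /phihat big_seq [RHS]big_seq; apply: eq_bigr => T;
  rewrite mem_rtrees_upto /class_coef.
rewrite /rsize /dot; case: (repr T) => -[|x s] //.
by rewrite psize_PNode big_cons; have := psize_gt0 x; case: psize.
Qed.

Lemma phihat_coef a i z : ((phihat a z)`_i)%:P = phihat (fun t => ((a t)`_i)%:P) z.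
Proof.
rewrite /phihat coef_sum rmorph_sum; apply: eq_bigr => T _;
  rewrite /class_coef /inv_aut /coefs.
by rewrite mulrAC -polyCM coefCM !rmorphM /= mulrAC.
Qed.

(** E^c = bullet + b bullet <- F, in terms of cut_conv: cutting below the root of a
tree leaves a single vertex only if the root has one branch. *)
Lemma closed_fun_conv t : closed_fun t = dot t + b * cut_conv dot rate1_fun t.
Proof.
rewrite /closed_fun tree_gf_coef0 /dot /cut_conv; case: t => -[|x [|y s]].
- by rewrite big_nil mulr0 addr0.
- rewrite sum_cuts big_seq1 /= eqxx /= mul1r big1 ?addr0 ?add0r; last first.
    by move=> p _; rewrite mul0r.
  by rewrite polyCM.
rewrite sum_cuts [X in b * X]big1_seq ?mulr0 ?addr0 // => z /andP[_ hz].
rewrite [X in _ + X]big1 ?addr0; last by move=> p _; rewrite mul0r.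
case e : (rem z _) => [|z' s'] /=; rewrite ?mul0r //.
by have := size_rem hz; rewrite e.
Qed.

Lemma deltaY_Vee z1 z2 : deltaY (Vee z1 z2) = (is_leaf z1)%:R * (is_leaf z2)%:R.
Proof.
have hl x : (x == Leaf) = is_leaf x by case: x.
by rewrite /deltaY eq_Vee !hl -natrM mulnb.
Qed.

Lemma prelie_fun_deltaY F z : prelie_fun deltaY F z = veeL F z - veeR F z.
Proof.
case: z => [|z1 z2]; rewrite /prelie_fun //=; congr (_ - _).
  rewrite mulrC -[in RHS](star_is_leaf F) -starZr; apply: eq_star => -[x y] _ /=.
  by rewrite deltaY_Vee [X in _ * X]mulrC.
rewrite -[in RHS](star_leaf_is F) -starZl; apply: eq_star => -[x y] _ /=.
by rewrite deltaY_Vee.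
Qed.

Lemma phihat_closed z :
  phihat closed_fun z = deltaY z
    + b * (veeL (phihat rate1_fun) z - veeR (phihat rate1_fun) z).
Proof.
rewrite (eq_phihat _ closed_fun_conv) phihatD phihatZ phihat_cut_conv //;
  [|exact: dot_inv|exact: rate1_fun_inv].
rewrite phihat_dot; congr (_ + _ * _).
by rewrite -prelie_fun_deltaY; apply: eq_prelie_fun => x _; rewrite phihat_dot.
Qed.

(** The images of f, g and X satisfy the hypotheses of solve_F. *)
Lemma phihat_rate1 z : phihat rate1_fun z = - block_series polP (leaves lm z).
Proof.
have E z' : ((phihat pos_gf z')`_1)%:P = phihat rate1_fun z' by exact: phihat_coef.
rewrite -E.
have Nff z' : deg_der (phihat pos_gf) z'
  = phihat logder_gf z' + prelie_fun (phihat pos_gf) (phihat logder_gf) z'.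
  rewrite deg_der_phihat -phihat_cut_conv //; [|exact: pos_gf_inv|exact: logder_gf_inv].
  by rewrite -phihatD; apply: eq_phihat => t; rewrite pos_gf_leibniz.
have NfX z' : deg_der (phihat branches_gf) z'
  = phihat branches_gf z' + prelie_fun (phihat branches_gf) (phihat logder_gf) z'.
  rewrite deg_der_phihat -phihat_cut_conv //;
    [|exact: branches_gf_inv|exact: logder_gf_inv].
  by rewrite -phihatD; apply: eq_phihat => t; rewrite branches_gf_leibniz.
apply: (solve_F Nff NfX phihat_Ytree (phihat_Leaf _)).
  move=> z'; apply: (@polyC_inj Qb); rewrite phihat_coef polyC0.
  rewrite /phihat big1 // => T _; by rewrite /class_coef pos_gf_coef0 polyC0 mulr0 mul0r.
move=> z'.
have -> : deltaY z' + b * (veeL (fun z => ((phihat pos_gf z)`_1)%:P) z'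
    - veeR (fun z => ((phihat pos_gf z)`_1)%:P) z') = phihat closed_fun z'.
  by rewrite phihat_closed; case: z' => [|? ?] //=; rewrite !E.
rewrite -phihat_dot -phihatD -phihatB -!phihatZ -phihatD; apply: eq_phihat => t.
by rewrite [pos_gf t + _]addrC /closed_fun -tree_gf_split tree_gf_eq.
Qed.

Lemma phihat_rate1_NTP z : phihat rate1_fun z = - (tree_series NTP z)%:P.
Proof.
rewrite phihat_rate1; congr (- _); case: (boolP (is_leaf z)) => hz.
  by case: z hz => // _; rewrite /block_series /= polP0 mulr0.
have -> : tree_series NTP z = NTP (full_canopy z) by case: z hz.
rewrite (full_canopyE lm hz); have [w hw] := leaves_shape lm hz; rewrite hw.
by rewrite NTP_block_series //= last_rcons.
Qed.

Lemma image_F : lin_series phi Fflow = \- tree_series NTP.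
Proof.
apply/funext => z; apply: polyC_inj; rewrite (lin_series_phihat _ Fflow_class_coef).
by rewrite phihat_rate1_NTP /= polyCN.
Qed.

Lemma image_Ec : lin_series phi Ec
         = (single Ytree 1
            \+ 'X \*o vee_series (single Leaf 1) (tree_series NTP))
           \- 'X \*o vee_series (tree_series NTP) (single Leaf 1).
Proof.
apply/funext => z; apply: polyC_inj;
  rewrite (lin_series_phihat _ Ec_class_coef) phihat_closed /=.
have hl x : (single Leaf 1 x)%:P = (is_leaf x)%:R :> R.
  by rewrite /single; case: x.
rewrite polyCB polyCD !polyCM -/b.
have -> : (single Ytree 1 z)%:P = deltaY z by rewrite /single /deltaY; case: eqP.
case: z => [|z1 z2]; first by rewrite /= !polyC0 subr0 !mulr0 addr0 subr0.
by rewrite /= !polyCM !hl !phihat_rate1_NTP; ring.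
Qed.

End Image.

(** As above, an enumeration witnessing finiteness. *)
Fixpoint pbts_upto (n : nat) : seq pbt :=
  if n is n'.+1 then
    Leaf :: [seq Vee x y | x <- pbts_upto n', y <- pbts_upto n'] else [:: Leaf].

Lemma mem_pbts_upto n x : (inner x <= n)%N -> x \in pbts_upto n.
Proof.
elim: n x => [|n IH] [|x1 x2] //= hx; rewrite inE; apply/orP; right.
by apply: allpairs_f; apply: IH; lia.
Qed.

Lemma coef_fsum (A : set pbt) (f : fseries pbt) n y :
  (forall x, A x -> (inner x <= n)%N) ->
  (\sum_(x \in A) f x *: (<< x >> : Dend1))@_y = if y \in A then f y else 0.
Proof.
move=> hA; rewrite (fsbigE (undup [seq x <- pbts_upto n | x \in A])) ?undup_uniq //.
- rewrite (raddf_sum (mcoeff y)) /= big_mkcond.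
  under eq_bigr do rewrite mcoeffZ coefU1.
  case: ifPn => hy.
    have hm : y \in undup [seq x <- pbts_upto n | x \in A].
      by rewrite mem_undup mem_filter hy mem_pbts_upto //; apply: hA; rewrite -in_setE.
    rewrite (bigD1_seq _ hm (undup_uniq _)) /= hy eqxx mulr1 big1 ?addr0 // => x /negPf ->.
    by rewrite mulr0; case: ifP.
  rewrite big1 // => x _; case: ifPn => // hx.
  by case: eqP => [e|_]; rewrite ?mulr0 // -e hx in hy *.
- by move=> x /=; rewrite mem_undup mem_filter => /andP[+ _]; rewrite in_setE.
move=> x hx; rewrite mem_undup mem_filter mem_pbts_upto ?hA // andbT.
by move=> /negP; case; apply/mem_set.
Qed.

Lemma size_leaves d x : size (leaves d x) = (inner x).+1.
Proof. by elim: x d => //= x1 IH1 x2 IH2 d; rewrite size_cat IH1 IH2 addSn addnS. Qed.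

Lemma size_canopy x : size (canopy x) = (inner x).-1.
Proof.
case: x => [|x1 x2] //; have := size_leaves lm (Vee x1 x2).
rewrite -(full_canopyE lm) //= => /eqP; rewrite size_rcons !eqSS => /eqP -> //.
Qed.

Lemma ribbon_coef w y : (ribbon_image (Some w))@_y = (~~ is_leaf y && (canopy y == w))%:R.
Proof.
have -> : ribbon_image (Some w) =
    \sum_(x \in [set x : pbt | x != Leaf /\ canopy x = w]%classic) (1 : Qb) *:
      (<< x >> : Dend1).
  by apply: eq_fsbigr => x _; rewrite scale1r.
rewrite (@coef_fsum _ (fun=> 1) (size w).+1); last first.
  by move=> x /= [_ <-]; rewrite size_canopy; case: inner.
case: ifPn; first by rewrite in_setE /= => -[hy ->]; case: y hy => //; rewrite eqxx.
move=> hy; case: andP => // -[h1 /eqP h2]; case/negP: hy; rewrite in_setE /=; split=> //.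
by case: y h1 h2.
Qed.

(** Each homogeneous component is a finite combination of ribbons, with the same
coefficients.  The component of degree 0 vanishes because f has no constant term. *)
Lemma canopy_series_descent (c : word -> Qb) (f : fseries pbt) :
  (forall x, f x = if x is Leaf then 0 else c (canopy x)) -> in_descent_algebra f.
Proof.
move=> hf n.
pose s : {malg Qb[option word]} :=
  if n is n'.+1 then \sum_(t : n'.-tuple bool) c t *: << Some (t : word) >> else 0.
exists s => //; apply/malgP => y.
have hc : (hcomp n f)@_y = if inner y == n then f y else 0.
  rewrite /hcomp (@coef_fsum _ f n); last by move=> x /= ->.
  have -> : (y \in [set x | inner x = n]%classic) = (inner y == n) by apply/idP/eqP;
    rewrite in_setE.
  by [].
have hs : (Sym_embed s)@_y = if is_leaf y then s@_None else s@_(Some (canopy y)).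
  rewrite /Sym_embed (raddf_sum (mcoeff y)).
  transitivity (s@_(if is_leaf y then None else Some (canopy y))); last by case: is_leaf.
  rewrite -(sum_msupp s); apply: eq_bigr => -[w|] _; rewrite /= mcoeffZ; congr (_ * _).
    by rewrite ribbon_coef; case: (is_leaf y) => //=; rewrite eq_sym; congr (_%:R);
      case: eqP => [->|h]; rewrite ?eqxx //; case: eqP => // -[].
  by rewrite coefU1; case: y {hc}.
have sN : s@_None = 0.
  rewrite /s; case: (n) => [|n']; rewrite ?mcoeff0 // (raddf_sum (mcoeff _)) big1 // => t _.
  by rewrite /= mcoeffZ coefU1 mulr0.
have sS w : s@_(Some w) = if (size w).+1 == n then c w else 0.
  rewrite /s; case: (n) => [|n']; rewrite ?mcoeff0 // (raddf_sum (mcoeff _)).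
  under eq_bigr do rewrite /= mcoeffZ coefU1.
  rewrite eqSS; case: ifPn => hw.
    rewrite (bigD1 (Tuple hw)) //= eqxx mulr1 big1 ?addr0 // => t ht.
    case: eqP => [[e]|_]; last by rewrite mulr0.
    by case/eqP: ht; apply: val_inj.
  rewrite big1 // => t _; case: eqP => [[e]|_]; last by rewrite mulr0.
  by rewrite -e size_tuple eqxx in hw.
rewrite hs hc hf sN sS size_canopy.
by case: y {hc hs} => [|y1 y2] //=; case: ifP.
Qed.

Lemma NTP_descent : in_descent_algebra (\- tree_series NTP).
Proof.
apply: (@canopy_series_descent (fun w => - NTP (lm :: rcons w lp))) => -[|x1 x2] /=.
  by rewrite oppr0.
by [].
Qed.

Theorem corollary6p7 (phi : {linear PreLie -> Dend1})
    (phi_morph : prelie_morphism phi)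
    (phi_bullet : phi << bullet >> = << Ytree >>) :
  exists F : fseries rtree,
    unique (fun G => Ec = single bullet 1
                          \+ 'X \*o prelie_series (single bullet 1) G) F
    /\ lin_series phi Ec
         = (single Ytree 1
            \+ 'X \*o vee_series (single Leaf 1) (tree_series NTP))
           \- 'X \*o vee_series (tree_series NTP) (single Leaf 1)
    /\ lin_series phi F = \- tree_series NTP
    /\ in_descent_algebra (lin_series phi F).
Proof.
exists Fflow; split; first exact: Fflow_unique.
split; first exact: image_Ec.
have hF := image_F phi_morph phi_bullet; split=> //.
by rewrite hF; exact: NTP_descent.
Qed.
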